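(* Let $f(\tau)=\prod_{n\mid N}\eta(n\tau)^{r_n}=\sum_nc_f(n)q^n$ be a weakly admissible eta-quotient of level $N$ and weight $k$, and for $l\in L_f$ let $$c_l=l^{-\frac k2}\sum_{\substack{a\mid l,\ d=l/a\\(a,N)=1}}\Big(\frac a\varpi\Big)a^kc_f\Big(\frac{l x_N}{24a^2}\Big)\sum_{\substack{0\le b<d\\(a,b,d)=1}}\Big(\frac{-Nb}{(a,d)}\Big)^{2k}e\Big(bd\Big(\frac{x_N}{24l}-\frac{x_N}{24}\Big)\Big)\psi_{l,\mathbf r}(a,b)$$ (with $c_f(y)=0$ if $y\notin\frac{x_N}{24}+\mathbb{Z}$). Then $l\mapsto c_l$ is multiplicative on $L_f$: $c_{l_1l_2}=c_{l_1}c_{l_2}$ for all $l_1,l_2\in L_f$ with $\gcd(l_1,l_2)=1$ (gcd in the positive integers).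
   Context: $e(x)=\exp(2\pi ix)$, $q=e(\tau)$, $\eta(\tau)=q^{1/24}\prod(1-q^n)$, $r_n\in\mathbb{Z}$, level $N=\operatorname{lcm}\{n:r_n\ne0\}$, $k=\frac12\sum r_n$, $\mathbf r=(r_n)_{n\mid N}$, $x_N=\sum nr_n$, $\varpi=\prod(N/n)^{|r_n|}$; $f=\sum_{n\in\frac{x_N}{24}+\mathbb{Z}_{\ge0}}c_f(n)q^n$. $\widetilde{\Gamma_0(N)}$: pairs $(\gamma,\varepsilon(c\tau+d)^{1/2})$, $\gamma=\begin{pmatrix}a&b\\c&d\end{pmatrix}\in\Gamma_0(N)$, $\varepsilon=\pm1$, principal root, product $(\gamma_1,\phi_1)(\gamma_2,\phi_2)=(\gamma_1\gamma_2,\phi_1(\gamma_2\tau)\phi_2(\tau))$; $(g|_k(\gamma,\phi))(\tau)=\phi(\tau)^{-2k}g(\gamma\tau)$. Character of $f$: $\chi(\gamma,\varepsilon(c\tau+d)^{1/2})=\varepsilon^{-2k}e(\frac1{24}\sum r_n\Psi\begin{pmatrix}a&bn\\c/n&d\end{pmatrix})$, $\Psi\begin{pmatrix}a&b\\c&d\end{pmatrix}=\frac{a+d}c+12s(-d,c)-3$ ($c>0$), $\frac{a+d}c+12s(d,-c)+3$ ($c<0$), $b$ ($c=0,a>0$), $-b-6$ ($c=0,a<0$), $s$ Dedekind sum. Weakly admissible: $f\in M_k(\Gamma_0(N),\chi)$ and either $\dim M_k(\Gamma_0(N),\chi)=1$ or ($\dim M_k\ge2$, $\dim S_k(\Gamma_0(N),\chi)=1$,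 $f$ a cusp form), where $M_k,S_k$ are the spaces of holomorphic $g$ with $g|_k\gamma=\chi(\gamma)g$ whose expansions at all cusps have only nonnegative (resp. positive) exponents. $m_f=24/\gcd(24,\sum(N/n)r_n,\sum nr_n)$; $L_f=\{l\ge1:l\equiv1\bmod m_f\}$ if $k\in\mathbb{Z}$, additionally perfect squares if $k\in\frac12+\mathbb{Z}$. With $d=l/a$: $\psi_{l,\mathbf r}(a,b)=e(-\frac{k+\delta}4(d-1)+\frac{(k+\delta)(l-1)(N-1)}4)$ if $2\nmid l$; $e(-\frac{k+\delta}4(a-1)-\frac{N(k+\delta)(1+\delta_1)}4b)$ if $2\mid l,2\mid N$; $1$ if $2\mid l,2\nmid N$; $\delta=0$ (resp. $1$) if $\varpi=2^\alpha(4m+1)$ (resp. $2^\alpha(4m+3)$); $\delta_1=1$ if $2\mid l$, $4\mid N$, $k\in\frac12+\mathbb{Z}$, $v_2(\varpi)$ odd, else $0$. $(\frac mn)$: Kronecker–Jacobi symbol with $(\frac m0)=0$ for $m\ne\pm1$, $(\frac{\pm1}0)=1$. *)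

(* Defs.v *)
From Stdlib Require Import Reals ZArith.
From Coquelicot Require Import Coquelicot.
From mathcomp Require Import ssreflect ssrfun ssrbool eqtype ssrnat seq div prime.

Set Implicit Arguments.
Unset Strict Implicit.

Definition Csum {A : Type} (s : seq A) (F : A -> C) : C :=
  foldr (fun x acc => Cplus (F x) acc) (RtoC 0) s.
Definition Cprod {A : Type} (s : seq A) (F : A -> C) : C :=
  foldr (fun x acc => Cmult (F x) acc) (RtoC 1) s.
Definition Zsum {A : Type} (s : seq A) (F : A -> Z) : Z :=
  foldr (fun x acc => (F x + acc)%Z) 0%Z s.

Fixpoint Cpow_nat (z : C) (n : nat) : C :=
  match n with O => RtoC 1 | S n => Cmult z (Cpow_nat z n) end.
Definition CpowZ (z : C) (n : Z) : C :=
  match n with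
  | Z0 => RtoC 1
  | Zpos p => Cpow_nat z (Pos.to_nat p)
  | Zneg p => Cinv (Cpow_nat z (Pos.to_nat p))
  end.

Definition cexp (z : C) : C :=
  (exp (fst z) * cos (snd z), exp (fst z) * sin (snd z))%R.
Definition ee (z : C) : C := cexp (Cmult (0%R, (2 * PI)%R) z).
Definition eR (x : R) : C := ee (RtoC x).

(* principal square root (argument in (-pi/2, pi/2]) *)
Definition csqrt (z : C) : C :=
  let x := fst z in let y := snd z in let m := Cmod z in
  (sqrt ((m + x) / 2), (if Rle_dec 0 y then 1 else -1) * sqrt ((m - x) / 2))%R.

Definition Hp (tau : C) : Prop := (0 < snd tau)%R.

Definition eta_partial (tau : C) (M : nat) : C :=
  Cprod (iota 1 M) (fun m => Cminus (RtoC 1) (ee (Cmult (RtoC (INR m)) tau))).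
Definition eta (tau : C) : C :=
  Cmult (ee (Cmult (RtoC (/ 24)) tau))
        (@lim C_CompleteNormedModule (filtermap (eta_partial tau) eventually)).

Definition is_level (r : nat -> Z) (N : nat) : Prop :=
  (0 < N)%N /\ (forall n, r n <> 0%Z -> n %| N) /\
  (forall M, (0 < M)%N -> (forall n, r n <> 0%Z -> n %| M) -> N %| M).

Definition eta_quotient (r : nat -> Z) (N : nat) (tau : C) : C :=
  Cprod (divisors N) (fun n => CpowZ (eta (Cmult (RtoC (INR n)) tau)) (r n)).

Definition twok (r : nat -> Z) (N : nat) : Z := Zsum (divisors N) r.
Definition xN (r : nat -> Z) (N : nat) : Z :=
  Zsum (divisors N) (fun n => (Z.of_nat n * r n)%Z).
Definition varpi (r : nat -> Z) (N : nat) : nat :=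
  foldr (fun n acc => (N %/ n) ^ (Z.abs_nat (r n)) * acc)%N 1%N (divisors N).

(* q-expansion coefficients of f = q^{x_N/24} prod_{n|N} prod_{m>=1} (1-q^{nm})^{r_n}.
   Formal power series are coefficient functions nat -> Z.  *)
Definition ps_mul (A B : nat -> Z) (j : nat) : Z :=
  Zsum (iota 0 j.+1) (fun i => (A i * B (j - i)%N)%Z).
Definition ps_one (j : nat) : Z := if j == 0%N then 1%Z else 0%Z.
Fixpoint ps_pow (A : nat -> Z) (e : nat) : nat -> Z :=
  match e with O => ps_one | S e => ps_mul A (ps_pow A e) end.
Definition one_minus_X (k : nat) (j : nat) : Z :=
  if j == 0%N then 1%Z else if j == k then (-1)%Z else 0%Z.
(* (1 - X^k)^{-1} = sum_i X^{k i}  (k >= 1) *)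
Definition geomX (k : nat) (j : nat) : Z := if k %| j then 1%Z else 0%Z.
Definition factor_pow (k : nat) (e : Z) : nat -> Z :=
  match e with
  | Zneg p => ps_pow (geomX k) (Pos.to_nat p)
  | _ => ps_pow (one_minus_X k) (Z.to_nat e)
  end.
(* coefficient of X^j in prod_{n|N} prod_{m>=1} (1-X^{nm})^{r_n}; the factors with
   m > j are 1 + O(X^{j+1}) and do not affect it. *)
Definition eta_coef (r : nat -> Z) (N : nat) (j : nat) : Z :=
  (foldr (fun n acc =>
     foldr (fun m acc' => ps_mul (factor_pow (n * m) (r n)) acc') acc (iota 1 j))
   ps_one (divisors N)) j.
(* c_f(p/q) for q > 0: c_f(y) = coefficient of q^y, which is 0 unless
   y in x_N/24 + Z_{>=0};  p/q - x_N/24 = (24 p - x_N q)/(24 q). *)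
Definition cf_at (r : nat -> Z) (N : nat) (p q : Z) : Z :=
  let t := (24 * p - xN r N * q)%Z in
  let den := (24 * q)%Z in
  if ((t mod den =? 0)%Z && (0 <=? t)%Z) then eta_coef r N (Z.to_nat (t / den))
  else 0%Z.

Definition legendre (m : Z) (p : nat) : Z :=
  let pz := Z.of_nat p in
  if (m mod pz =? 0)%Z then 0%Z
  else if has (fun x => ((x * x - m) mod pz =? 0)%Z) (map Z.of_nat (iota 0 p))
       then 1%Z else (-1)%Z.
Definition kron_p (m : Z) (p : nat) : Z :=
  if p == 2%N then
    (if Z.even m then 0%Z
     else if ((m mod 8 =? 1)%Z || (m mod 8 =? 7)%Z) then 1%Z else (-1)%Z)
  else legendre m p.
Definition kron (m n : Z) : Z :=
  if (n =? 0)%Z then (if (Z.abs m =? 1)%Z then 1%Z else 0%Z)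
  else ((if (n <? 0)%Z then (if (m <? 0)%Z then (-1)%Z else 1%Z) else 1%Z) *
        foldr (fun pe acc => (kron_p m pe.1 ^ Z.of_nat pe.2 * acc)%Z) 1%Z
              (prime_decomp (Z.abs_nat n)))%Z.

Definition saw (p k : Z) : R :=
  if (p mod k =? 0)%Z then 0%R else (IZR (p mod k) / IZR k - / 2)%R.
Definition dedekind_sum (h k : Z) : R :=
  foldr (fun j acc => (saw (Z.of_nat j) k * saw (h * Z.of_nat j) k + acc)%R) 0%R
        (iota 1 (Z.to_nat k - 1)).
Definition Psi (a b c d : Z) : R :=
  if (0 <? c)%Z then (IZR (a + d) / IZR c + 12 * dedekind_sum (- d) c - 3)%R
  else if (c <? 0)%Z then (IZR (a + d) / IZR c + 12 * dedekind_sum d (- c) + 3)%R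
  else if (0 <? a)%Z then IZR b else (- IZR b - 6)%R.

Definition sgnC (eps : bool) : C := if eps then RtoC 1 else RtoC (-1).

(* chi(gamma, eps (c tau + d)^{1/2}) ; eps = true means +1, false means -1 *)
Definition eta_char (r : nat -> Z) (N : nat) (a b c d : Z) (eps : bool) : C :=
  Cmult (CpowZ (sgnC eps) (- twok r N))
   (eR (/ 24 * foldr (fun n acc => (IZR (r n) *
          Psi a (b * Z.of_nat n) (c / Z.of_nat n) d + acc)%R) 0%R (divisors N))%R).

Definition mobius (a b c d : Z) (tau : C) : C :=
  Cdiv (Cplus (Cmult (RtoC (IZR a)) tau) (RtoC (IZR b)))
       (Cplus (Cmult (RtoC (IZR c)) tau) (RtoC (IZR d))).
Definition slash (tk : Z) (g : C -> C) (a b c d : Z) (eps : bool) (tau : C) : C :=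
  Cmult (CpowZ (Cmult (sgnC eps)
                 (csqrt (Cplus (Cmult (RtoC (IZR c)) tau) (RtoC (IZR d)))))
               (- tk))
        (g (mobius a b c d tau)).

Definition cusp_expansion (strict : bool) (G : C -> C) : Prop :=
  exists (h kappa : R) (A : nat -> C),
    (0 < h)%R /\
    (forall tau, Hp tau ->
       is_series (fun m => Cmult (A m) (ee (Cmult (RtoC ((INR m + kappa) / h)) tau)))
                 (G tau)) /\
    (forall m, A m <> RtoC 0 ->
       if strict then (0 < INR m + kappa)%R else (0 <= INR m + kappa)%R).

Definition holomorphic_H (g : C -> C) : Prop :=
  forall tau, Hp tau -> @ex_derive C_AbsRing C_NormedModule g tau.

Definition transforms (N : nat) (tk : Z) (chi : Z -> Z -> Z -> Z -> bool -> C)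
  (g : C -> C) : Prop :=
  forall (a b c d : Z) (eps : bool), (a * d - b * c = 1)%Z -> (Z.of_nat N | c)%Z ->
    forall tau, Hp tau -> slash tk g a b c d eps tau = Cmult (chi a b c d eps) (g tau).

Definition in_Mk (N : nat) (tk : Z) (chi : Z -> Z -> Z -> Z -> bool -> C)
  (g : C -> C) : Prop :=
  holomorphic_H g /\ transforms N tk chi g /\
  (forall a b c d : Z, (a * d - b * c = 1)%Z -> cusp_expansion false (slash tk g a b c d true)).
Definition in_Sk (N : nat) (tk : Z) (chi : Z -> Z -> Z -> Z -> bool -> C)
  (g : C -> C) : Prop :=
  holomorphic_H g /\ transforms N tk chi g /\
  (forall a b c d : Z, (a * d - b * c = 1)%Z -> cusp_expansion true (slash tk g a b c d true)).

(* dimension statements for a space of functions on H (functions equal on H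
   are identified) *)
Definition dim_eq1 (P : (C -> C) -> Prop) : Prop :=
  exists g0, P g0 /\ (exists tau, Hp tau /\ g0 tau <> RtoC 0) /\
    forall g, P g -> exists c : C, forall tau, Hp tau -> g tau = Cmult c (g0 tau).
Definition dim_ge2 (P : (C -> C) -> Prop) : Prop :=
  exists g1 g2, P g1 /\ P g2 /\
    forall c1 c2 : C,
      (forall tau, Hp tau -> Cplus (Cmult c1 (g1 tau)) (Cmult c2 (g2 tau)) = RtoC 0) ->
      c1 = RtoC 0 /\ c2 = RtoC 0.

Definition weakly_admissible (r : nat -> Z) (N : nat) : Prop :=
  let P := in_Mk N (twok r N) (eta_char r N) in
  let S := in_Sk N (twok r N) (eta_char r N) in
  let f := eta_quotient r N in
  P f /\ (dim_eq1 P \/ (dim_ge2 P /\ dim_eq1 S /\ S f)).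

Definition m_f (r : nat -> Z) (N : nat) : nat :=
  (24 %/ Z.to_nat (Z.gcd 24 (Z.gcd (Zsum (divisors N)
          (fun n => (Z.of_nat (N %/ n) * r n)%Z)) (xN r N))))%N.

Definition in_Lf (r : nat -> Z) (N : nat) (l : nat) : Prop :=
  (1 <= l)%N /\ l = 1 %[mod m_f r N] /\
  (Z.odd (twok r N) = true -> exists t : nat, l = (t * t)%N).

Definition delta (r : nat -> Z) (N : nat) : R :=
  let w := varpi r N in
  if (w %/ 2 ^ logn 2 w) %% 4 == 1%N then 0%R else 1%R.
Definition delta1 (r : nat -> Z) (N : nat) (l : nat) : R :=
  if [&& ~~ odd l, 4 %| N, Z.odd (twok r N) & odd (logn 2 (varpi r N))]
  then 1%R else 0%R.

Definition psi (r : nat -> Z) (N : nat) (l a b : nat) : C :=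
  let d := (l %/ a)%N in
  let kd := (IZR (twok r N) / 2 + delta r N)%R in
  if odd l then
    eR (- (kd / 4) * (INR d - 1) + kd * (INR l - 1) * (INR N - 1) / 4)%R
  else if ~~ odd N then
    eR (- (kd / 4) * (INR a - 1) - INR N * kd * (1 + delta1 r N l) / 4 * INR b)%R
  else RtoC 1.

Definition c_l (r : nat -> Z) (N : nat) (l : nat) : C :=
  let tk := twok r N in
  let x := xN r N in
  Cmult (RtoC (Rpower (INR l) (- IZR tk / 4)))
   (Csum [seq a <- divisors l | coprime a N] (fun a =>
     let d := (l %/ a)%N in
     Cmult (RtoC (IZR (kron (Z.of_nat a) (Z.of_nat (varpi r N))) *
                  Rpower (INR a) (IZR tk / 2) *
                  IZR (cf_at r N (Z.of_nat l * x) (24 * Z.of_nat a ^ 2))))%R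
      (Csum [seq b <- iota 0 d | gcdn (gcdn a b) d == 1%N] (fun b =>
         Cmult (Cmult
           (CpowZ (RtoC (IZR (kron (- Z.of_nat N * Z.of_nat b)
                                   (Z.of_nat (gcdn a d))))) tk)
           (eR (INR b * INR d * (IZR x / (24 * INR l) - IZR x / 24))%R))
           (psi r N l a b))))).

(* Main.v *)
(* For [l] in [L_f] and [g] in Gamma0(N), the quotient [f(g t / l) / f(g t)] only depends on the
   class of [g] modulo the elements of Gamma0(N) whose upper right entry is divisible by [l];
   this follows from an explicit formula for the multiplier of [f] (Dedekind sums, Jacobi symbols)
   and from the congruence [l = 1 mod m_f].  Summing these quotients over a transversal and
   multiplying by [f] therefore gives a function with the same multiplier as [f].  Choosing
   representatives adapted to the triangular matrices [(a b; 0 d)], [a d = l], turns it into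
   [sum w(a, b) f((a t + b) / d)], where [w(a, b)] is the weight occurring in [c_l].  This function
   is holomorphic, with nonnegative (positive) exponents at all cusps when [f] has them, so weak
   admissibility makes it a multiple of [f]; comparing coefficients of [q^(x_N/24)], the factor is
   [l^(k/2) c_l].  For coprime [l1], [l2] the products of two transversals, one of them conjugated
   by [diag(1, l2)], form a transversal for [l1 l2], and the quotients multiply. *)

Require Import Defs.
From mathcomp Require Import fintype ssralg poly zmodp.
From Stdlib Require Import Reals ZArith Lia Lra Znumtheory IndefiniteDescription Classical.
From Coquelicot Require Import Coquelicot.
From mathcomp Require Import ssreflect ssrfun ssrbool eqtype ssrnat seq div bigop prime.
From mathcomp Require Import zify.

Set Implicit Arguments.
Unset Strict Implicit.
Local Open Scope Z_scope.

(** The quotients f(g t / l) / f(g t) carry the same automorphy factor above and below, so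
    half-integral weight needs no double cover; in the passage to triangular matrices the only extra
    root is that of the positive number a. The price is that each weight in [c_l] has to be
    recognised exactly as the inverse of a multiplier value, up to a translation factor. Residues
    suffice: [Psi] modulo 3 is a polynomial in the entries, and modulo 8 such a polynomial plus the
    sign of a Jacobi symbol, which Gauss's lemma extracts from the Dedekind sum. This makes the
    multiplier explicit when c > 0 and d is odd and positive. The representative of (a b; 0 d) is
    free enough to prescribe divisors prime to a of its lower left entry: N m_f removes the part of
    the exponent with sum (N/n) r_n, 64 N (for odd a) reduces the Jacobi symbols to data of a and b,
    and a further factor l2 leaves room for conjugation by diag(1, l2). What then remains is a
    congruence modulo 8, and the cases in the definition of [psi] are the cases of that
    congruence. *)

(** * Finite sums and products over lists *)

Definition Zprod {A : Type} (s : seq A) (F : A -> Z) : Z :=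
  foldr (fun x acc => F x * acc) 1 s.

Section SumsOverLists.
Variable A : Type.
Implicit Types (s : seq A) (F G : A -> Z).

Lemma Zsum_cat s1 s2 F : Zsum (s1 ++ s2) F = Zsum s1 F + Zsum s2 F.
Proof. by elim: s1 => //= x s1 ->; ring. Qed.

Lemma ZsumD s F G : Zsum s (fun x => F x + G x) = Zsum s F + Zsum s G.
Proof. by elim: s => //= x s ->; ring. Qed.

Lemma ZsumMl s F c : Zsum s (fun x => c * F x) = c * Zsum s F.
Proof. by elim: s => /= [|x s ->]; ring. Qed.

Lemma Zsum_const s c : Zsum s (fun => c) = c * Z.of_nat (size s).
Proof. elim: s => [|x s IH] /=; first by rewrite Z.mul_0_r. by rewrite IH; lia. Qed.

Lemma Zsum_map B (h : B -> A) (t : seq B) F : Zsum (map h t) F = Zsum t (fun y => F (h y)).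
Proof. by elim: t => //= y t ->. Qed.

Lemma Zprod_map B (h : B -> A) (t : seq B) F : Zprod (map h t) F = Zprod t (fun y => F (h y)).
Proof. by elim: t => //= y t ->. Qed.

Lemma Zprod_cat s1 s2 F : Zprod (s1 ++ s2) F = Zprod s1 F * Zprod s2 F.
Proof. by elim: s1 => [|x s1 IH] /=; [case: (Zprod s2 F)|rewrite IH; ring]. Qed.

Lemma ZprodM s F G : Zprod s (fun x => F x * G x) = Zprod s F * Zprod s G.
Proof. by elim: s => //= x s ->; ring. Qed.

End SumsOverLists.

Lemma Zsum_exchange A B (s : seq A) (t : seq B) (F : A -> B -> Z) :
  Zsum s (fun x => Zsum t (F x)) = Zsum t (fun y => Zsum s (fun x => F x y)).
Proof.
elim: s => /= [|x s IH]; first by rewrite Zsum_const.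
by rewrite IH -ZsumD.
Qed.

Lemma eq_Zsum (A : eqType) (s : seq A) (F G : A -> Z) :
  (forall x, x \in s -> F x = G x) -> Zsum s F = Zsum s G.
Proof.
elim: s => //= x s IH h; rewrite h ?mem_head // IH // => y ys.
by apply: h; rewrite inE ys orbT.
Qed.

Lemma eq_Zprod (A : eqType) (s : seq A) (F G : A -> Z) :
  (forall x, x \in s -> F x = G x) -> Zprod s F = Zprod s G.
Proof.
elim: s => //= x s IH h; rewrite h ?mem_head // IH // => y ys.
by apply: h; rewrite inE ys orbT.
Qed.

Lemma Zsum_perm (A : eqType) (s1 s2 : seq A) F : perm_eq s1 s2 -> Zsum s1 F = Zsum s2 F.
Proof.
move=> p; apply: (catCA_perm_ind (P := fun s => Zsum s1 F = Zsum s F)) p _ => // t1 t2 t3 ->.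
by rewrite !Zsum_cat; ring.
Qed.

Lemma Zprod_perm (A : eqType) (s1 s2 : seq A) F : perm_eq s1 s2 -> Zprod s1 F = Zprod s2 F.
Proof.
move=> p; apply: (catCA_perm_ind (P := fun s => Zprod s1 F = Zprod s F)) p _ => // t1 t2 t3 ->.
by rewrite !Zprod_cat; ring.
Qed.

(** An injective self-map of a finite set is onto. It serves for multiplication by a unit on
    residues and on absolutely least residues. *)
Lemma perm_map_self (T : eqType) (s : seq T) (h : T -> T) :
  uniq s -> {in s, forall x, h x \in s} -> {in s &, injective h} -> perm_eq (map h s) s.
Proof.
move=> us hs hi.
have um : uniq (map h s) by rewrite map_inj_in_uniq.
have sub : {subset map h s <= s} by move=> y /mapP [x xs ->]; exact: hs.
have [_ e] := uniq_min_size um sub (eq_leq (esym (size_map h s))).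
exact: uniq_perm.
Qed.

Lemma iota_rcons m n : iota m n.+1 = iota m n ++ [:: (m + n)%N].
Proof. by rewrite -addn1 iotaD. Qed.

Lemma two_sum_id n : 2 * Zsum (iota 1 n) Z.of_nat = Z.of_nat n * (Z.of_nat n + 1).
Proof. elim: n => // n IH; rewrite iota_rcons Zsum_cat [Zsum [:: _] _]/=; lia. Qed.

Lemma six_sum_sq n : 6 * Zsum (iota 1 n) (fun j => Z.of_nat j * Z.of_nat j)
  = Z.of_nat n * (Z.of_nat n + 1) * (2 * Z.of_nat n + 1).
Proof. elim: n => // n IH; rewrite iota_rcons Zsum_cat [Zsum [:: _] _]/=; lia. Qed.

Lemma coprime_mul_mod_neq0 (c : Z) (d j : nat) :
  Z.gcd c (Z.of_nat d) = 1 -> (0 < j < d)%N -> (c * Z.of_nat j) mod Z.of_nat d <> 0.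
Proof.
move=> g hj /Z.mod_divide h.
have : (Z.of_nat d | Z.of_nat j) by apply: (Z.gauss _ c); [apply: h; lia|rewrite Z.gcd_comm].
by move=> /Z.divide_pos_le; lia.
Qed.

(** A unit c permutes the nonzero residues modulo d. The function [G] is left free so that both the
    linear and the quadratic power sums can be compared. *)
Lemma mul_mod_perm (c : Z) (d : nat) (G : Z -> Z) : (0 < d)%N -> Z.gcd c (Z.of_nat d) = 1 ->
  Zsum (iota 1 d.-1) (fun j => G ((c * Z.of_nat j) mod Z.of_nat d))
  = Zsum (iota 1 d.-1) (fun j => G (Z.of_nat j)).
Proof.
move=> d0 g.
pose h (j : nat) := Z.to_nat ((c * Z.of_nat j) mod Z.of_nat d).
have hE j : Z.of_nat (h j) = (c * Z.of_nat j) mod Z.of_nat d.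
  rewrite Z2Nat.id //; have := Z.mod_pos_bound (c * Z.of_nat j) (Z.of_nat d); lia.
have p : perm_eq (map h (iota 1 d.-1)) (iota 1 d.-1).
  apply: perm_map_self; first exact: iota_uniq.
  - move=> j; rewrite !mem_iota => hj.
    have := @coprime_mul_mod_neq0 c d j g; rewrite -hE => h0.
    have := Z.mod_pos_bound (c * Z.of_nat j) (Z.of_nat d); rewrite -hE.
    move: (h j) h0 => k; lia.
  - move=> i j; rewrite !mem_iota => hi hj e.
    have {}e : (c * Z.of_nat i) mod Z.of_nat d = (c * Z.of_nat j) mod Z.of_nat d by rewrite -!hE e.
    have dv : (Z.of_nat d | Z.of_nat i - Z.of_nat j).
      apply: (Z.gauss _ c); last by rewrite Z.gcd_comm.
      apply/Z.mod_divide; first lia.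
      by rewrite Z.mul_sub_distr_l Zminus_mod e Z.sub_diag Z.mod_0_l; lia.
    case: dv => k hk; have k0 : k = 0 by nia.
    by lia.
rewrite -[RHS](Zsum_perm _ p) Zsum_map.
by apply: eq_Zsum => j _; rewrite hE.
Qed.

(** * Dedekind sums *)

Definition ded_fl (c : Z) (d j : nat) : Z := (c * Z.of_nat j) / Z.of_nat d.

(* The integer 12 d s(c, d). *)
Definition ded12 (c : Z) (d : nat) : Z :=
  let D := Z.of_nat d in
  2 * c * (D - 1) * (2 * D - 1) - 12 * Zsum (iota 1 d.-1) (fun j => Z.of_nat j * ded_fl c d j)
  - 3 * D * (D - 1).

Lemma ded_flE (c : Z) (d j : nat) : (0 < d)%N ->
  (c * Z.of_nat j) mod Z.of_nat d = c * Z.of_nat j - Z.of_nat d * ded_fl c d j.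
Proof. by move=> d0; rewrite /ded_fl Zmod_eq_full; lia. Qed.

Lemma foldr_IZR (A : eqType) (s : seq A) (F : A -> R) (G : A -> Z) (k : R) :
  (forall x, x \in s -> (k * F x = IZR (G x))%R) ->
  (k * foldr (fun x acc => F x + acc) 0 s = IZR (Zsum s G))%R.
Proof.
elim: s => [|x s IH] h /=; first by rewrite Rmult_0_r.
rewrite Rmult_plus_distr_l h ?mem_head // IH ?plus_IZR // => y ys.
by apply: h; rewrite inE ys orbT.
Qed.

(** Sum c j = d floor(c j / d) + (c j mod d) over j: the residues again run through 1, ..., d -
    1. *)
Lemma sum_ded_fl (c : Z) (d : nat) : (0 < d)%N -> Z.gcd c (Z.of_nat d) = 1 ->
  2 * Zsum (iota 1 d.-1) (ded_fl c d) = (c - 1) * (Z.of_nat d - 1).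
Proof.
move=> d0 g; have := mul_mod_perm (fun x => x) d0 g; cbv beta.
have -> : Zsum (iota 1 d.-1) (fun j => (c * Z.of_nat j) mod Z.of_nat d) =
   c * Zsum (iota 1 d.-1) Z.of_nat + - Z.of_nat d * Zsum (iota 1 d.-1) (ded_fl c d).
  rewrite -!ZsumMl -ZsumD; apply: eq_Zsum => j _; rewrite ded_flE //; ring.
have := two_sum_id d.-1.
move: (Zsum _ _) (Zsum _ _) => T S h1 h2.
have -> : Z.of_nat d = Z.of_nat d.-1 + 1 by lia.
have {}h2 : Z.of_nat d * T = (c - 1) * S by lia.
have {}h2 : Z.of_nat d * (2 * T) = Z.of_nat d * ((c - 1) * Z.of_nat d.-1).
  have -> : Z.of_nat d * (2 * T) = 2 * ((c-1) * S) by lia.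
  have -> : 2 * ((c-1)*S) = (c-1) * (2 * S) by ring.
  rewrite h1; have -> : Z.of_nat d = Z.of_nat d.-1 + 1 by lia. ring.
apply Z.mul_reg_l in h2; lia.
Qed.

(** For 0 < j < d both sawtooth arguments are non-integral, so each term is (j/d - 1/2)((c j mod
    d)/d - 1/2); one more factor d clears all denominators. *)
Lemma ded12E (c : Z) (d : nat) : (0 < d)%N -> Z.gcd c (Z.of_nat d) = 1 ->
  (12 * INR d * dedekind_sum c (Z.of_nat d) = IZR (ded12 c d))%R.
Proof.
move=> d0 g; have D0 : (0 < INR d)%R by apply: lt_0_INR; lia.
apply: (Rmult_eq_reg_l (INR d)); last lra.
have -> : (INR d * (12 * INR d * dedekind_sum c (Z.of_nat d)) =
           12 * INR d * INR d * dedekind_sum c (Z.of_nat d))%R by ring.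
rewrite /dedekind_sum Nat2Z.id.
have -> : (d - 1)%N = d.-1 by lia.
pose G (j : nat) := 12 * c * (Z.of_nat j * Z.of_nat j) +
  (- 12 * Z.of_nat d * (Z.of_nat j * ded_fl c d j) + (- 6 * Z.of_nat d * (Z.of_nat j) +
   (- 6 * Z.of_nat d * ((c * Z.of_nat j) mod Z.of_nat d) + 3 * Z.of_nat d * Z.of_nat d))).
rewrite (foldr_IZR (G := G)) => [|j]; last first.
  rewrite mem_iota => hj; rewrite /saw.
  have nz := @coprime_mul_mod_neq0 c d j g.
  rewrite (Z.mod_small (Z.of_nat j)); last lia.
  case: Z.eqb_spec => [|_]; first lia.
  case: Z.eqb_spec => [|_]; first by move=> h; case: nz => //; lia.
  rewrite /G ded_flE // !(plus_IZR, minus_IZR, mult_IZR, opp_IZR) -!INR_IZR_INZ.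
  field; lra.
rewrite /G !ZsumD !ZsumMl Zsum_const size_iota.
have -> := mul_mod_perm (fun x => x) d0 g.
rewrite INR_IZR_INZ -mult_IZR; congr IZR; rewrite /ded12.
have := two_sum_id d.-1; have := six_sum_sq d.-1.
have -> : Z.of_nat d = Z.of_nat d.-1 + 1 by lia.
move: (Zsum _ _) (Zsum _ _) (Zsum _ _) (Z.of_nat d.-1) => S T U m h1 h2; nia.
Qed.

(* From the permutation identity sum (c j mod d)^2 = sum j^2. *)
Lemma ded12_mul (c : Z) (d : nat) : (0 < d)%N -> Z.gcd c (Z.of_nat d) = 1 ->
  let D := Z.of_nat d in
  c * ded12 c d = (c * c + 1) * (D - 1) * (2 * D - 1) - 3 * c * D * (D - 1)
    - 6 * D * Zsum (iota 1 d.-1) (fun j => ded_fl c d j * ded_fl c d j).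
Proof.
move=> d0 g D; have := mul_mod_perm (fun x => x * x) d0 g; cbv beta.
have -> : Zsum (iota 1 d.-1) (fun j =>
   (c * Z.of_nat j) mod Z.of_nat d * ((c * Z.of_nat j) mod Z.of_nat d)) =
   c * c * Zsum (iota 1 d.-1) (fun j => Z.of_nat j * Z.of_nat j) +
   (- 2 * c * D * Zsum (iota 1 d.-1) (fun j => Z.of_nat j * ded_fl c d j) +
    D * D * Zsum (iota 1 d.-1) (fun j => ded_fl c d j * ded_fl c d j)).
  rewrite -!ZsumMl -!ZsumD; apply: eq_Zsum => j _; rewrite ded_flE // /D; ring.
rewrite /ded12; have := six_sum_sq d.-1.
rewrite -/D; have Dm : Z.of_nat d.-1 = D - 1 by rewrite /D; lia.
rewrite Dm; have D1 : 0 < D by rewrite /D; lia.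
move: (Zsum _ _) (Zsum _ _) (Zsum _ _) => V U S h1 h2.
apply: (Z.mul_reg_l _ _ D); first lia.
have h3 : 6 * (2 * c * D * U) = (c * c - 1) * (6 * S) + 6 * (D * D * V) by lia.
rewrite h1 in h3. nia.
Qed.

(** Column sum of the lattice point count below: in column j the heights are 1, ..., f with f =
    floor(c j / d). *)
Lemma sum_le_id (m : nat) (f : Z) : 0 <= f <= Z.of_nat m ->
  2 * Zsum (iota 1 m) (fun i => if Z.of_nat i <=? f then Z.of_nat i else 0) = f * (f + 1).
Proof.
elim: m f => [|m IH] f hf; first by rewrite (_ : f = 0); [|lia].
rewrite iota_rcons Zsum_cat Z.mul_add_distr_l [Zsum [:: _] _]/=.
case: Z.leb_spec => h; last by rewrite IH; lia.
have ef : f = Z.of_nat m + 1 by lia.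
rewrite (eq_Zsum (G := fun i => if Z.of_nat i <=? Z.of_nat m then Z.of_nat i else 0)).
  rewrite (IH (Z.of_nat m)); nia.
move=> i; rewrite mem_iota => hi; do 2 case: Z.leb_spec => //; lia.
Qed.

(** Row count for the same points: in row i they are those with j > g = floor(d i / c). *)
Lemma sum_gt_count (m : nat) (g : Z) : 0 <= g <= Z.of_nat m ->
  Zsum (iota 1 m) (fun j => if g <? Z.of_nat j then 1 else 0) = Z.of_nat m - g.
Proof.
elim: m => [|m IH] hg; first by rewrite /=; lia.
rewrite iota_rcons Zsum_cat [Zsum [:: _] _]/=.
case: Z.ltb_spec => h; first by rewrite IH; lia.
rewrite (eq_Zsum (G := fun=> 0)) ?Zsum_const; first lia.
move=> i; rewrite mem_iota => hi; case: Z.ltb_spec => //; lia.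
Qed.

(* Counts the lattice points below the line through (0,0) and (d,c) in two ways. *)
Lemma ded_fl_exchange (c d : nat) : (0 < c)%N -> (0 < d)%N -> Z.gcd (Z.of_nat c) (Z.of_nat d) = 1 ->
  Zsum (iota 1 d.-1) (fun j => ded_fl (Z.of_nat c) d j * (ded_fl (Z.of_nat c) d j + 1))
  = Z.of_nat c * (Z.of_nat c - 1) * (Z.of_nat d - 1)
    - 2 * Zsum (iota 1 c.-1) (fun i => Z.of_nat i * ded_fl (Z.of_nat d) c i).
Proof.
move=> c0 d0 g.
rewrite (eq_Zsum (G := fun j => 2 * Zsum (iota 1 c.-1) (fun i =>
   if Z.of_nat i <=? ded_fl (Z.of_nat c) d j then Z.of_nat i else 0))); last first.
  move=> j; rewrite mem_iota => hj; rewrite sum_le_id // /ded_fl; split.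
    apply: Z.div_pos; nia.
  have : Z.of_nat c * Z.of_nat j / Z.of_nat d < Z.of_nat c; last lia.
  apply: Z.div_lt_upper_bound; nia.
rewrite ZsumMl Zsum_exchange.
rewrite (eq_Zsum (G := fun i => (Z.of_nat d - 1) * Z.of_nat i + -1 * (Z.of_nat i * ded_fl (Z.of_nat d) c i))).
  rewrite ZsumD !ZsumMl; have := two_sum_id c.-1.
  have -> : Z.of_nat c.-1 = Z.of_nat c - 1 by lia.
  move: (Zsum _ _) (Zsum _ _) => S T; nia.
move=> i; rewrite mem_iota => hi.
rewrite (eq_Zsum (G := fun j => Z.of_nat i * (if ded_fl (Z.of_nat d) c i <? Z.of_nat j then 1 else 0))).
  rewrite ZsumMl sum_gt_count.
    by rewrite (_ : Z.of_nat d.-1 = Z.of_nat d - 1); [ring|lia].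
  rewrite /ded_fl; split; first by apply: Z.div_pos; nia.
  have : Z.of_nat d * Z.of_nat i / Z.of_nat c < Z.of_nat d; last lia.
  apply: Z.div_lt_upper_bound; nia.
move=> j; rewrite mem_iota => hj; rewrite /ded_fl.
(* No lattice point of the open rectangle lies on the line, so i <= c j / d and j > d i / c are the
   same condition. *)
have ne : Z.of_nat d * Z.of_nat i <> Z.of_nat c * Z.of_nat j.
  move=> e; have := @coprime_mul_mod_neq0 (Z.of_nat c) d j g; rewrite -e.
  by rewrite Z.mul_comm Z_mod_mult => h; apply: h; lia.
case: Z.leb_spec => h1; case: Z.ltb_spec => h2; try lia.
- have e1 := Z.mul_div_le (Z.of_nat c * Z.of_nat j) (Z.of_nat d).
  have e2 : Z.of_nat c * Z.of_nat j < Z.of_nat d * Z.of_nat i.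
    have e3 := Z.mul_div_le (Z.of_nat d * Z.of_nat i) (Z.of_nat c). nia.
  nia.
- have e1 := Z.mul_succ_div_gt (Z.of_nat c * Z.of_nat j) (Z.of_nat d).
  have e2 := Z.mul_succ_div_gt (Z.of_nat d * Z.of_nat i) (Z.of_nat c).
  nia.
Qed.

(** Eliminating the sum of the squared floors between [ded12_mul] and the lattice point count leaves
    exactly the floor sum that defines [ded12 d c]. This is Dedekind's reciprocity law with
    denominators cleared. *)
Lemma ded12_reciprocity (c d : nat) : (0 < c)%N -> (0 < d)%N -> Z.gcd (Z.of_nat c) (Z.of_nat d) = 1 ->
  Z.of_nat c * ded12 (Z.of_nat c) d + Z.of_nat d * ded12 (Z.of_nat d) c
  = Z.of_nat c * Z.of_nat c + Z.of_nat d * Z.of_nat d + 1 - 3 * Z.of_nat c * Z.of_nat d.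
Proof.
move=> c0 d0 g; rewrite (ded12_mul d0 g).
have := ded_fl_exchange c0 d0 g.
rewrite (eq_Zsum (G := fun j : nat => ded_fl (Z.of_nat c) d j * ded_fl (Z.of_nat c) d j + ded_fl (Z.of_nat c) d j));
  last by move=> j _; ring.
rewrite (@ZsumD nat); have := sum_ded_fl d0 g; rewrite /ded12.
move: (Z.of_nat c) (Z.of_nat d) (Zsum _ _) (Zsum _ _) (Zsum _ _) => C D S T U h1 h2; nia.
Qed.

(** * The Jacobi symbol *)

(* The sign of the absolutely least residue of x modulo the odd number d. *)
Definition half_sign (x : Z) (d : nat) : Z := 1 - 2 * ((2 * x / Z.of_nat d) mod 2).

(* The Jacobi symbol (c / d), for d odd and coprime to c, in the form of Gauss's lemma. *)
Definition jac (c : Z) (d : nat) : Z :=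
  Zprod (iota 1 d./2) (fun j => half_sign (c * Z.of_nat j) d).

Definition pm1 (z : Z) : Prop := z = 1 \/ z = -1.

Lemma pm1_mul y z : pm1 y -> pm1 z -> pm1 (y * z).
Proof. by rewrite /pm1; lia. Qed.

Lemma pm1_sq z : pm1 z -> z * z = 1.
Proof. by case=> ->. Qed.

Lemma half_sign_pm1 x d : pm1 (half_sign x d).
Proof.
rewrite /half_sign /pm1; have := Z.mod_pos_bound (2 * x / Z.of_nat d) 2; lia.
Qed.

Lemma Zprod_pm1 (A : Type) (s : seq A) F : (forall x, pm1 (F x)) -> pm1 (Zprod s F).
Proof. by move=> h; elim: s => [|x s IH] /=; [left|apply: pm1_mul]. Qed.

Lemma jac_pm1 c d : pm1 (jac c d).
Proof. by apply: Zprod_pm1 => j; exact: half_sign_pm1. Qed.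

Lemma half_sign_mod x d k : (0 < d)%N -> half_sign (x + Z.of_nat d * k) d = half_sign x d.
Proof.
move=> d0; rewrite /half_sign.
have -> : 2 * (x + Z.of_nat d * k) = 2 * x + (2 * k) * Z.of_nat d by ring.
rewrite Z.div_add; last lia.
by rewrite (Z.mul_comm 2 k) Z_mod_plus_full.
Qed.

Lemma jac_mod c d k : (0 < d)%N -> jac (c + Z.of_nat d * k) d = jac c d.
Proof.
move=> d0; apply: eq_Zprod => j _.
have -> : (c + Z.of_nat d * k) * Z.of_nat j = c * Z.of_nat j + Z.of_nat d * (k * Z.of_nat j) by ring.
exact: half_sign_mod.
Qed.

(** As d is odd and prime-to-zero residues stay nonzero after doubling, floor(-2x/d) = -floor(2x/d)
    - 1, which flips the parity. *)
Lemma half_sign_opp x d : odd d -> x mod Z.of_nat d <> 0 -> half_sign (- x) d = - half_sign x d.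
Proof.
move=> od x0; rewrite /half_sign; have d0 : 0 < Z.of_nat d by lia.
have nz : (2 * x) mod Z.of_nat d <> 0.
  move=> /Z.mod_divide h; apply: x0; apply/Z.mod_divide; first lia.
  apply: (Z.gauss _ 2); first by apply: h; lia.
  have [k ->] : exists k, Z.of_nat d = 1 + k * 2 by exists (Z.of_nat d./2); lia.
  by rewrite Z.gcd_comm Z.gcd_add_mult_diag_r.
have -> : 2 * - x = - (2 * x) by ring.
rewrite Z.div_opp_l_nz //; last lia.
move: (2 * x / _) => q.
have -> : (- q - 1) mod 2 = 1 - q mod 2; last lia.
by have := Z.mod_pos_bound q 2; have := Z.mod_pos_bound (-q-1) 2; have := Z.div_mod q 2; have := Z.div_mod (-q-1) 2; lia.
Qed.

(** Absolute value of the absolutely least residue; [half_sign] is its sign. *)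
Definition half_abs (x : Z) (d : nat) : nat :=
  let r := Z.to_nat (x mod Z.of_nat d) in if (2 * r < d)%N then r else (d - r)%N.

Lemma half_absE x d : odd d ->
  exists k, x = half_sign x d * Z.of_nat (half_abs x d) + Z.of_nat d * k.
Proof.
move=> od; rewrite /half_sign /half_abs; have d0 : 0 < Z.of_nat d by lia.
have := Z.div_mod x (Z.of_nat d); have := Z.mod_pos_bound x (Z.of_nat d) d0.
move: (x mod _) (x / _) => r q hr /(_ ltac:(lia)) ->.
have -> : 2 * (Z.of_nat d * q + r) = 2 * r + (2 * q) * Z.of_nat d by ring.
rewrite Z.div_add; last lia.
case: ifP => h.
  exists q; rewrite Z.div_small; last lia.
  rewrite (_ : (0 + 2 * q) mod 2 = 0); last by rewrite Z.add_0_l Z.mul_comm Z_mod_mult.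
  rewrite Z2Nat.id; lia.
exists (q + 1).
have -> : 2 * r / Z.of_nat d = 1 by symmetry; apply: (Z.div_unique_pos _ _ _ (2 * r - Z.of_nat d)); lia.
have -> : (1 + 2 * q) mod 2 = 1 by rewrite (Z.mul_comm 2 q) Z_mod_plus_full.
lia.
Qed.

Lemma half_abs_bound x d : odd d -> x mod Z.of_nat d <> 0 -> (0 < half_abs x d <= d./2)%N.
Proof.
move=> od x0; rewrite /half_abs; have d0 : 0 < Z.of_nat d by lia.
have := Z.mod_pos_bound x (Z.of_nat d) d0; move: (x mod _) x0 => r r0 hr.
by case: ifP; lia.
Qed.

(** Equal absolute values force d to divide c (i - j) or c (i + j); since 0 < i + j < d, only i = j
    is possible. *)
Lemma half_abs_inj c d : odd d -> Z.gcd c (Z.of_nat d) = 1 ->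
  {in iota 1 d./2 &, injective (fun j => half_abs (c * Z.of_nat j) d)}.
Proof.
move=> od g i j; rewrite !mem_iota => hi hj e.
have [k hk] := half_absE (c * Z.of_nat i) od.
have [m hm] := half_absE (c * Z.of_nat j) od.
rewrite -e in hm.
have dv z : (Z.of_nat d | c * z) -> (Z.of_nat d | z).
  by move=> h; apply: (Z.gauss _ c) => //; rewrite Z.gcd_comm.
have s1 := half_sign_pm1 (c * Z.of_nat i) d; have s2 := half_sign_pm1 (c * Z.of_nat j) d.
have [h|h] : half_sign (c * Z.of_nat i) d = half_sign (c * Z.of_nat j) d \/
             half_sign (c * Z.of_nat i) d = - half_sign (c * Z.of_nat j) d.
  by rewrite /pm1 in s1 s2; lia.
- have [q hq] : (Z.of_nat d | Z.of_nat i - Z.of_nat j).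
    apply: dv; exists (k - m); rewrite h in hk; rewrite Z.mul_sub_distr_l; lia.
  have : q = 0 by nia.
  lia.
- have [q hq] : (Z.of_nat d | Z.of_nat i + Z.of_nat j).
    apply: dv; exists (k + m); rewrite h in hk; rewrite Z.mul_add_distr_l; lia.
  have : 0 < q < 1 by nia.
  lia.
Qed.

Lemma half_abs_perm c d : odd d -> Z.gcd c (Z.of_nat d) = 1 ->
  perm_eq (map (fun j => half_abs (c * Z.of_nat j) d) (iota 1 d./2)) (iota 1 d./2).
Proof.
move=> od g; apply: perm_map_self; [exact: iota_uniq| |exact: half_abs_inj].
move=> j; rewrite !mem_iota => hj.
have := @half_abs_bound (c * Z.of_nat j) d od.
have := @coprime_mul_mod_neq0 c d j g.
by move=> h1 h2; have := h2 (h1 ltac:(lia)); lia.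
Qed.

Lemma gcd_mul_1 a b c : Z.gcd a c = 1 -> Z.gcd b c = 1 -> Z.gcd (a * b) c = 1.
Proof.
move=> h1 h2; apply/Zgcd_1_rel_prime/rel_prime_sym/rel_prime_mult;
  by apply/rel_prime_sym/Zgcd_1_rel_prime.
Qed.

(** Reindex the product for c1 by j -> |c2 j|; the signs of the c2 j then come out because
    [half_sign] is an odd function. *)
Lemma jac_mul c1 c2 d : odd d -> Z.gcd c1 (Z.of_nat d) = 1 -> Z.gcd c2 (Z.of_nat d) = 1 ->
  jac (c1 * c2) d = jac c1 d * jac c2 d.
Proof.
move=> od g1 g2.
have -> : jac c1 d = Zprod (iota 1 d./2) (fun j => half_sign (c1 * Z.of_nat (half_abs (c2 * Z.of_nat j) d)) d).
  by rewrite -(Zprod_map _ _ (fun k => half_sign (c1 * Z.of_nat k) d)) /jac; apply/esym/Zprod_perm/half_abs_perm.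
rewrite -ZprodM; apply: eq_Zprod => j; rewrite mem_iota => hj.
have [k hk] := half_absE (c2 * Z.of_nat j) od.
have -> : c1 * c2 * Z.of_nat j = c1 * (c2 * Z.of_nat j) by ring.
have nz := @coprime_mul_mod_neq0 c2 d j g2 ltac:(lia).
have hb := half_abs_bound od nz.
rewrite {1}hk.
move: (half_abs _ _) hb => h hb.
have -> : c1 * (half_sign (c2 * Z.of_nat j) d * Z.of_nat h + Z.of_nat d * k)
  = c1 * (half_sign (c2 * Z.of_nat j) d * Z.of_nat h) + Z.of_nat d * (c1 * k) by ring.
rewrite half_sign_mod; last lia.
case: (half_sign_pm1 (c2 * Z.of_nat j) d) => ->.
  by rewrite Z.mul_1_r Z.mul_1_l.
rewrite (_ : c1 * (-1 * Z.of_nat h) = - (c1 * Z.of_nat h)); last ring.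
rewrite half_sign_opp //; first by ring.
by apply: coprime_mul_mod_neq0 => //; lia.
Qed.

Lemma Zprod_sign (A : Type) (s : seq A) (F : A -> Z) :
  Zprod s (fun x => 1 - 2 * (F x mod 2)) = 1 - 2 * (Zsum s F mod 2).
Proof.
elim: s => //= x s ->.
rewrite [(F x + _) mod 2]Zplus_mod.
have := Z.mod_pos_bound (F x) 2; have := Z.mod_pos_bound (Zsum s F) 2.
move: (F x mod 2) (Zsum s F mod 2) => u v hu hv.
have [->|->] : u = 0 \/ u = 1 by lia.
  by have [->|->] : v = 0 \/ v = 1 by lia.
by have [->|->] : v = 0 \/ v = 1 by lia.
Qed.

Lemma Zsum_even_odd h (F : nat -> Z) :
  Zsum (iota 1 (2 * h)) F = Zsum (iota 1 h) (fun i => F (2 * i)%N + F (2 * i).-1).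
Proof.
elim: h => // h IH; rewrite (_ : (2 * h.+1 = (2 * h).+2)%N); last lia.
have one x (G : nat -> Z) : Zsum [:: x] G = G x by rewrite /= Z.add_0_r.
rewrite !iota_rcons !Zsum_cat IH !one.
have -> : (1 + (2 * h).+1 = 2 * (1 + h))%N by lia.
have -> : (1 + 2 * h = (2 * (1 + h)).-1)%N by lia.
ring.
Qed.

Lemma Zsum_mod_even (s : seq nat) (F G : nat -> Z) :
  exists k, Zsum s (fun i => 2 * F i + G i) = 2 * k + Zsum s G.
Proof. by exists (Zsum s F); rewrite ZsumD ZsumMl. Qed.

(** Modulo 8 only the parity of sum j floor(c j / d) matters, hence only the floors at odd j ([nu]).
    Those at even j ([mu]) give the exponent in Gauss's lemma, and [mu + nu] is known from
    [sum_ded_fl]. *)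
Lemma ded12_mod8 c d : odd d -> Z.gcd c (Z.of_nat d) = 1 ->
  exists k, ded12 c d = Z.of_nat d + 1 - 2 * jac c d + 8 * k.
Proof.
move=> od g.
have d0 : (0 < d)%N by lia.
pose mu := Zsum (iota 1 d./2) (fun i => ded_fl c d (2 * i)).
have jE : jac c d = 1 - 2 * (mu mod 2).
  rewrite -Zprod_sign; apply: eq_Zprod => j _; rewrite /half_sign /ded_fl.
  have -> // : 2 * (c * Z.of_nat j) = c * Z.of_nat (2 * j)%N by lia.
have hd : d.-1 = (2 * d./2)%N by lia.
pose nu := Zsum (iota 1 d./2) (fun i => ded_fl c d (2 * i).-1).
have s1 : 2 * (mu + nu) = (c - 1) * (Z.of_nat d - 1).
  by rewrite -(sum_ded_fl d0 g) hd Zsum_even_odd ZsumD.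
have [k s2] : exists k, Zsum (iota 1 d.-1) (fun j => Z.of_nat j * ded_fl c d j) = 2 * k + nu.
  rewrite hd Zsum_even_odd.
  have [k hk] := Zsum_mod_even (iota 1 d./2) (fun i => Z.of_nat i * ded_fl c d (2 * i)%N + (Z.of_nat i - 1) * ded_fl c d (2 * i).-1) (fun i => ded_fl c d (2 * i).-1).
  exists k; rewrite -hk; apply: eq_Zsum => i; rewrite mem_iota => hi.
  have -> : Z.of_nat (2 * i)%N = 2 * Z.of_nat i by lia.
  have -> : Z.of_nat (2 * i).-1 = 2 * Z.of_nat i - 1 by lia.
  ring.
rewrite /ded12 s2 jE.
have := Z.div_mod mu 2 ltac:(lia); have := Z.mod_pos_bound mu 2 ltac:(lia).
move: (mu / 2) (mu mod 2) => m e he hm.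
have hd' : Z.of_nat d = 2 * Z.of_nat d./2 + 1 by lia.
move: s1; rewrite hd'; move: (Z.of_nat d./2) => h s1.
have nE : nu = (c - 1) * h - (2 * m + e) by nia.
rewrite nE.
have [[q ->]|[q ->]] : (exists q, h = 2 * q) \/ (exists q, h = 2 * q + 1).
  by case: (Z.Even_or_Odd h) => -[q ->]; [left|right]; exists q.
- exists (2 * c * (2 * q) * (2 * q) - c * (2 * q) - 3 * k + 3 * m + e + q * (1 - 6 * q)); ring.
- exists (2 * c * (2 * q + 1) * (2 * q + 1) - c * (2 * q + 1) - 3 * k + 3 * m + e
     - (2 * q + 1) * (1 + 3 * q)); ring.
Qed.

Lemma jac1 c : jac c 1 = 1. Proof. by []. Qed.

Lemma jac_sq c d : odd d -> Z.gcd c (Z.of_nat d) = 1 -> jac (c * c) d = 1.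
Proof. by move=> od g; rewrite jac_mul // pm1_sq //; exact: jac_pm1. Qed.

Lemma jac_1 d : odd d -> jac 1 d = 1.
Proof. by move=> od; rewrite -[1]Z.mul_1_r jac_sq // Z.gcd_1_l. Qed.

(* [sgn4 n] is (-1)^((n-1)/2) for odd n. *)
Definition sgn4 (c d : nat) : Z := if ((c %% 4 == 3) && (d %% 4 == 3))%N then -1 else 1.

(** Dedekind reciprocity with both sums replaced through [ded12_mod8]: for each pair of classes
    modulo 4, the wrong sign contradicts it. *)
Lemma jac_recip (c d : nat) : odd c -> odd d -> Z.gcd (Z.of_nat c) (Z.of_nat d) = 1 ->
  jac (Z.of_nat c) d = jac (Z.of_nat d) c * sgn4 c d.
Proof.
move=> oc od g.
have g' : Z.gcd (Z.of_nat d) (Z.of_nat c) = 1 by rewrite Z.gcd_comm.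
have [k hk] := ded12_mod8 od g; have [m hm] := ded12_mod8 oc g'.
have := @ded12_reciprocity c d ltac:(lia) ltac:(lia) g.
rewrite hk hm.
have [p hp] : exists p, Z.of_nat c = 4 * p + (if (c %% 4 == 3)%N then 3 else 1).
  by exists (Z.of_nat (c %/ 4)%N); case: ifP; lia.
have [q hq] : exists q, Z.of_nat d = 4 * q + (if (d %% 4 == 3)%N then 3 else 1).
  by exists (Z.of_nat (d %/ 4)%N); case: ifP; lia.
rewrite hp hq /sgn4.
have := jac_pm1 (Z.of_nat c) d; have := jac_pm1 (Z.of_nat d) c; rewrite hp hq.
move: (c %% 4 == 3)%N (d %% 4 == 3)%N => b1 b2.
case: b1; case: b2; cbv beta iota delta [andb] => -[->|->] [->|->] // h; exfalso; lia.
Qed.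

(** Dedekind reciprocity for the pair (2, d), where the other sum [ded12 d 2] vanishes. *)
Lemma jac_two (d : nat) : odd d ->
  jac 2 d = if ((d %% 8 == 1) || (d %% 8 == 7))%N then 1 else -1.
Proof.
move=> od.
have g : Z.gcd (Z.of_nat 2) (Z.of_nat d) = 1.
  have -> : Z.of_nat d = 1 + Z.of_nat d./2 * 2 by lia.
  by rewrite Z.gcd_add_mult_diag_r.
have [k hk] := ded12_mod8 od g.
have := @ded12_reciprocity 2 d isT ltac:(lia) g.
rewrite hk; have -> : ded12 (Z.of_nat d) 2 = 0.
  rewrite /ded12 (_ : Zsum _ _ = Z.of_nat d./2); first by lia.
  change (1 * (Z.of_nat d * 1 / 2) + 0 = Z.of_nat d./2).
  rewrite Z.mul_1_l Z.add_0_r.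
  by symmetry; apply: (Z.div_unique_pos _ _ _ 1); lia.
have [q hq] : exists q, Z.of_nat d = 8 * q + Z.of_nat (d %% 8)%N by exists (Z.of_nat (d %/ 8)%N); lia.
have r : Z.of_nat (d %% 8)%N = 1 \/ Z.of_nat (d %% 8)%N = 3 \/ Z.of_nat (d %% 8)%N = 5 \/ Z.of_nat (d %% 8)%N = 7 by lia.
have := jac_pm1 (Z.of_nat 2) d; change (Z.of_nat 2) with 2; rewrite hq => j e.
case: ifP => b; case: r => [|[|[]]] r; rewrite r in e; try (exfalso; lia); case: j e => -> e //; exfalso; lia.
Qed.

Lemma gcd_shift c d k : Z.gcd (c + d * k) d = Z.gcd c d.
Proof. by rewrite Z.gcd_comm Z.mul_comm Z.gcd_add_mult_diag_r Z.gcd_comm. Qed.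

Lemma gcd_mul_l a b c : Z.gcd a (b * c) = 1 -> Z.gcd a b = 1.
Proof.
move=> /Zgcd_1_rel_prime h; apply/Zgcd_1_rel_prime/rel_prime_sym.
by apply: rel_prime_div (rel_prime_sym _ _ h) _; exists c; rewrite Z.mul_comm.
Qed.

Lemma gcd_mul_r a b c : Z.gcd a (b * c) = 1 -> Z.gcd a c = 1.
Proof. by rewrite Z.mul_comm; exact: gcd_mul_l. Qed.

Lemma sgn4_mul (c d1 d2 : nat) : odd c -> odd d1 -> odd d2 -> sgn4 c (d1 * d2) = sgn4 c d1 * sgn4 c d2.
Proof.
move=> oc o1 o2; rewrite /sgn4 -modnMm.
have : [|| d1 %% 4 == 1 | d1 %% 4 == 3]%N by lia.
have : [|| d2 %% 4 == 1 | d2 %% 4 == 3]%N by lia.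
by case: (c %% 4 == 3)%N; move=> /orP [] /eqP -> /orP [] /eqP ->.
Qed.

Lemma sgn4_pm1 c d : pm1 (sgn4 c d).
Proof. by rewrite /sgn4; case: ifP; [right|left]. Qed.

Lemma odd_Z_of_nat n : odd n = Z.odd (Z.of_nat n).
Proof. by elim: n => // n IH; rewrite Nat2Z.inj_succ Z.odd_succ -Z.negb_odd -IH. Qed.

(** Gauss's lemma does not show multiplicativity in the denominator; reciprocity converts it into
    multiplicativity in the numerator. For this, c is first replaced by a positive odd number in its
    class modulo d1 d2. *)
Lemma jac_mulr c (d1 d2 : nat) : odd d1 -> odd d2 -> Z.gcd c (Z.of_nat (d1 * d2)) = 1 ->
  jac c (d1 * d2) = jac c d1 * jac c d2.
Proof.
move=> o1 o2 g.
have od : odd (d1 * d2) by rewrite oddM o1.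
(* The term 2 |c| makes c + d1 d2 K nonnegative, the second term makes it odd, because d1 d2 is
   odd. *)
pose K := 2 * Z.abs c + (if Z.odd c then 0 else 1).
pose c' := Z.to_nat (c + Z.of_nat (d1 * d2) * K).
have c'E : Z.of_nat c' = c + Z.of_nat (d1 * d2) * K.
  rewrite Z2Nat.id // /K; have D0 : 1 <= Z.of_nat (d1 * d2)%N by lia.
  have := Z.mul_le_mono_nonneg_r 1 _ K _ D0; rewrite /K.
  by case: (Z.odd c) => h; have := h ltac:(lia); lia.
have oc : odd c'.
  rewrite odd_Z_of_nat.
  rewrite c'E Z.odd_add Z.odd_mul /K Z.odd_add Z.odd_mul.
  rewrite -odd_Z_of_nat od.
  by case: (Z.odd c).
have gc : Z.gcd (Z.of_nat c') (Z.of_nat (d1 * d2)) = 1 by rewrite c'E gcd_shift.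
have e0 : jac c (d1 * d2) = jac (Z.of_nat c') (d1 * d2) by rewrite c'E jac_mod //; lia.
have e1 : jac c d1 = jac (Z.of_nat c') d1.
  by rewrite c'E Nat2Z.inj_mul -Z.mul_assoc jac_mod //; lia.
have e2 : jac c d2 = jac (Z.of_nat c') d2.
  by rewrite c'E Nat2Z.inj_mul (Z.mul_comm (Z.of_nat d1)) -Z.mul_assoc jac_mod //; lia.
rewrite Nat2Z.inj_mul in gc.
have g1 := gcd_mul_l gc; have g2 := gcd_mul_r gc.
rewrite e0 e1 e2 (@jac_recip c' (d1 * d2)) //; last by rewrite Nat2Z.inj_mul.
rewrite (@jac_recip c' d1) // (@jac_recip c' d2) //.
rewrite Nat2Z.inj_mul jac_mul // ?sgn4_mul //; first ring.
  by rewrite Z.gcd_comm.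
by rewrite Z.gcd_comm.
Qed.

Lemma odd_dvd (m n : nat) : (m %| n)%N -> odd n -> odd m.
Proof. by move=> /dvdnP [k ->]; rewrite oddM => /andP []. Qed.

(* For fixed m the symbol (m / t) only depends on t modulo 8 m. *)
Lemma jac_top_period (m t : nat) : (0 < m)%N -> odd t -> Z.gcd (Z.of_nat m) (Z.of_nat t) = 1 ->
  (exists k, t = 1 + 8 * m * k)%N -> jac (Z.of_nat m) t = 1.
Proof.
elim/ltn_ind: m t => m IH t m0 ot g [k tE].
case om : (odd m).
  rewrite jac_recip // (_ : sgn4 m t = 1); last first.
    rewrite /sgn4 (_ : (t %% 4 == 3)%N = false) ?andbF //.
    by rewrite tE (_ : 1 + 8 * m * k = 1 + 2 * m * k * 4)%N ?modnMDr //; lia.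
  rewrite Z.mul_1_r.
  have -> : Z.of_nat t = 1 + Z.of_nat m * (8 * Z.of_nat k) by lia.
  by rewrite jac_mod ?jac_1.
have mE : m = (2 * m./2)%N by lia.
have g2 : Z.gcd (2 * Z.of_nat m./2) (Z.of_nat t) = 1 by rewrite -g; congr Z.gcd; lia.
rewrite Z.gcd_comm in g2; have g3 := gcd_mul_l g2; have g4 := gcd_mul_r g2.
rewrite Z.gcd_comm in g3; rewrite Z.gcd_comm in g4.
rewrite (_ : Z.of_nat m = 2 * Z.of_nat m./2); last lia.
rewrite jac_mul // jac_two // IH //; try lia.
  by rewrite (_ : (t %% 8 == 1)%N) //; rewrite tE (_ : 1 + 8 * m * k = 1 + m * k * 8)%N ?modnMDr //; lia.
by exists (2 * k)%N; lia.
Qed.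

Lemma dvdn_Z (m n : nat) : (Z.of_nat m | Z.of_nat n) <-> (m %| n)%N.
Proof.
split; last by move=> /dvdnP [k ->]; exists (Z.of_nat k); lia.
case: m => [|m] [k hk]; first by rewrite (_ : n = 0%N) //; lia.
by apply/dvdnP; exists (Z.to_nat k); nia.
Qed.

Lemma gcdn_Z (m n : nat) : Z.gcd (Z.of_nat m) (Z.of_nat n) = Z.of_nat (gcdn m n).
Proof.
apply: Z.gcd_unique; first exact: Nat2Z.is_nonneg.
- by apply/dvdn_Z; exact: dvdn_gcdl.
- by apply/dvdn_Z; exact: dvdn_gcdr.
move=> q h1 h2; apply/Z.divide_abs_l.
have aq : Z.abs q = Z.of_nat (Z.abs_nat q) by lia.
rewrite aq; apply/dvdn_Z; rewrite dvdn_gcd.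
by apply/andP; split; apply/dvdn_Z; rewrite -aq; apply/Z.divide_abs_l.
Qed.

Lemma coprime_Z (m n : nat) : Z.gcd (Z.of_nat m) (Z.of_nat n) = 1 <-> coprime m n.
Proof. by rewrite gcdn_Z /coprime; split=> [h|/eqP ->//]; apply/eqP; lia. Qed.

Lemma prime_Z (p : nat) : prime p -> Znumtheory.prime (Z.of_nat p).
Proof.
move=> pp; apply: prime_intro; first by have := prime_gt1 pp; lia.
move=> n hn; apply/Zgcd_1_rel_prime.
have -> : n = Z.of_nat (Z.to_nat n) by lia.
by apply/coprime_Z; rewrite coprime_sym prime_coprime // gtnNdvd; lia.
Qed.

Lemma prime_dvd_Zprod (p : nat) (s : seq nat) (F : nat -> Z) : prime p ->
  (Z.of_nat p | Zprod s F) -> exists2 j, j \in s & (Z.of_nat p | F j).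
Proof.
move=> pp; elim: s => [|x s IH] /= h.
  have : (2 <= p)%N by exact: prime_gt1.
  by move/Z.divide_1_r_nonneg: h => h; have := h ltac:(lia); lia.
case: (prime_mult _ (prime_Z pp) _ _ h) => h'; first by exists x; rewrite ?mem_head.
by have [j js hj] := IH h'; exists j => //; rewrite inE js orbT.
Qed.

(* Gauss's lemma: compare the product of the c j (1 <= j <= (p-1)/2) with that of
   their absolutely least residues. *)
Lemma jac_euler (p : nat) (c : nat) : prime p -> odd p -> Z.gcd (Z.of_nat c) (Z.of_nat p) = 1 ->
  exists k, Z.of_nat (c ^ p./2) = jac (Z.of_nat c) p + Z.of_nat p * k.
Proof.
move=> pp op g.
have hc h (s : seq nat) : size s = h -> Zprod s (fun j => Z.of_nat c * Z.of_nat j) = Z.of_nat (c ^ h)%N * Zprod s Z.of_nat.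
  elim: s h => [|x s IH] h /= <- //=.
  by rewrite (IH (size s)) // expnS; lia.
have := hc p./2 (iota 1 p./2) (size_iota _ _).
have [k hk] : exists k, Zprod (iota 1 p./2) (fun j => Z.of_nat c * Z.of_nat j) =
   jac (Z.of_nat c) p * Zprod (iota 1 p./2) Z.of_nat + Z.of_nat p * k.
  have pz := Zprod_perm Z.of_nat (half_abs_perm op g).
  rewrite Zprod_map in pz; rewrite -pz -ZprodM {pz}.
  elim: (iota 1 p./2) => [|j s [k IH]] /=; first by exists 0; rewrite Z.mul_0_r.
  rewrite IH; have [m hm] := half_absE (Z.of_nat c * Z.of_nat j) op.
  rewrite {1}hm; move: (half_sign _ _) (Z.of_nat (half_abs _ _)) (Zprod s _) => x y z.
  by exists (m * (z + Z.of_nat p * k) + x * y * k); ring.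
rewrite hk => e.
have dv : (Z.of_nat p | (Z.of_nat (c ^ p./2)%N - jac (Z.of_nat c) p) * Zprod (iota 1 p./2) Z.of_nat).
  by exists k; rewrite Z.mul_sub_distr_r -e; ring.
have pr : rel_prime (Z.of_nat p) (Zprod (iota 1 p./2) Z.of_nat).
  apply: prime_rel_prime; first exact: prime_Z.
  move=> /(prime_dvd_Zprod pp) [j]; rewrite mem_iota => hj /Z.divide_pos_le; lia.
rewrite Z.mul_comm in dv.
have [m hm] := Gauss _ _ _ dv pr.
by exists m; lia.
Qed.

Section EulerCriterion.
Import GRing.Theory.
Local Open Scope ring_scope.

(** The squares of 1, ..., (p-1)/2 are distinct roots of X^((p-1)/2) - 1 over F_p; a root c outside
    this list would exceed the degree. *)
Lemma square_root_mod (p c : nat) : prime p -> odd p -> ~~ (p %| c)%N ->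
  (forall j, 0 < j < p -> exists k, (j * j) ^ p./2 = 1 + p * k)%N ->
  (exists k, c ^ p./2 = 1 + p * k)%N -> exists2 j, (j < p)%N & (j * j = c %[mod p])%N.
Proof.
move=> pp op pc hsq [k hk].
have ch : p \in [pchar 'F_p] by exact: pchar_Fp.
have nat0 n : (n%:R == 0 :> 'F_p) = (p %| n)%N by rewrite (dvdn_pcharf ch).
have nateq m n : (m%:R == n%:R :> 'F_p) = (m == n %[mod p])%N.
  wlog le : m n / (n <= m)%N => [th|].
    by case: (leqP n m) => [/th //|/ltnW /th e]; rewrite eq_sym e eq_sym.
  by rewrite -subr_eq0 -natrB // nat0 eqn_mod_dvd.
pose sq := [seq ((j * j)%:R : 'F_p) | j <- iota 1 p./2].
case cs : (c%:R \in sq).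
  have /mapP [j] := cs; rewrite mem_iota => hj e; exists j; first lia.
  by apply/eqP; rewrite -nateq -e.
pose P : {poly 'F_p} := 'X^(p./2) - 1.
have h0 : (0 < p./2)%N by have := prime_gt1 pp; lia.
have sP : size P = p./2.+1 by rewrite /P -[1]polyC1 size_XnsubC.
have rootP n : (exists k, n ^ p./2 = 1 + p * k)%N -> root P n%:R.
  move=> [m hm]; rewrite /root !hornerE -natrX hm natrD natrM (pcharf0 ch).
  by rewrite mul0r addr0 subrr.
have : (size (c%:R :: sq) < size P)%N.
  apply: max_poly_roots.
  - by rewrite -size_poly_eq0 sP.
  - rewrite /= rootP /=; last by exists k.
    apply/allP => y /mapP [j]; rewrite mem_iota => hj ->; apply: rootP; apply: hsq; lia.
  - rewrite /= cs /= map_inj_in_uniq ?iota_uniq // => i j; rewrite !mem_iota => hi hj /eqP.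
    rewrite -subr_eq0 !natrM -!expr2 subr_sqr mulf_eq0 -natrD nat0 => /orP [|].
      rewrite subr_eq0 nateq !modn_small; [by move/eqP|lia|lia].
    by move/dvdn_leq; lia.
by rewrite sP /= size_map size_iota ltnn.
Qed.
End EulerCriterion.

(** The symbol [legendre] searches for a square root. A square has symbol 1 by multiplicativity;
    conversely a symbol 1 means c^((p-1)/2) = 1 by [jac_euler], and [square_root_mod] supplies the
    root. *)
Lemma jac_legendre (p : nat) (m : Z) : prime p -> odd p -> Z.gcd m (Z.of_nat p) = 1 ->
  jac m p = legendre m p.
Proof.
move=> pp op g; rewrite /legendre.
have p2 := prime_gt1 pp.
pose c := Z.to_nat (m mod Z.of_nat p).
have cE : Z.of_nat c = m mod Z.of_nat p by rewrite Z2Nat.id //; apply: (Z.mod_pos_bound _ _ _).1; lia.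
have mE : m = Z.of_nat c + Z.of_nat p * (m / Z.of_nat p) by rewrite cE {1}(Z.div_mod m (Z.of_nat p)); lia.
have gc : Z.gcd (Z.of_nat c) (Z.of_nat p) = 1 by rewrite mE gcd_shift in g.
have pc : ~~ (p %| c)%N by rewrite -prime_coprime // coprime_sym; apply/coprime_Z.
case: Z.eqb_spec => h0.
  by move: pc; rewrite (_ : c = 0%N) ?dvdn0 //; lia.
have sqP x : Z.gcd (Z.of_nat x) (Z.of_nat p) = 1 -> jac (Z.of_nat (x * x)%N) p = 1.
  by move=> gx; rewrite Nat2Z.inj_mul jac_sq.
rewrite [in LHS]mE jac_mod; last lia.
rewrite has_map; case: hasP => [[j]|nex].
  rewrite mem_iota /= => hj /Z.eqb_spec /Z.mod_divide h.
  have [k hk] := h ltac:(lia).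
  have -> : Z.of_nat c = Z.of_nat (j * j)%N + Z.of_nat p * (- k - m / Z.of_nat p) by lia.
  rewrite jac_mod; last lia.
  rewrite sqP //.
  apply/coprime_Z; rewrite coprime_sym prime_coprime //; apply/negP => /dvdn_Z [q hq].
  have : (Z.of_nat p | m) by exists (q * Z.of_nat j - k); nia.
  by move=> /Z.mod_divide; lia.
case: (jac_pm1 (Z.of_nat c) p) => // j1; case: nex.
have [j hj je] : exists2 j, (j < p)%N & (j * j = c %[mod p])%N.
  apply: square_root_mod => //.
    move=> j hj; have gj : Z.gcd (Z.of_nat j) (Z.of_nat p) = 1.
      by apply/coprime_Z; rewrite coprime_sym prime_coprime // gtnNdvd; lia.
    have [k hk] := @jac_euler p (j * j) pp op ltac:(by rewrite Nat2Z.inj_mul; apply: gcd_mul_1).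
    rewrite sqP // in hk; exists (Z.to_nat k).
    move: (_ ^ _)%N hk => X hk; nia.
  have [k hk] := jac_euler pp op gc; rewrite j1 in hk; exists (Z.to_nat k).
  move: (_ ^ _)%N hk => X hk; nia.
exists j; first by rewrite mem_iota.
rewrite /=; apply/Z.eqb_spec/Z.mod_divide; first lia.
have := divn_eq (j * j) p; have := divn_eq c p; rewrite je; move: (c %% p)%N => r h1 h2.
exists (Z.of_nat (j * j %/ p) - Z.of_nat (c %/ p) - m / Z.of_nat p); lia.
Qed.

Lemma modn_Z (m n : nat) : Z.of_nat m mod Z.of_nat n = Z.of_nat (m %% n)%N.
Proof.
case: n => [|n]; first by rewrite modn0; case: (Z.of_nat m).
symmetry; apply: (Z.mod_unique_pos _ _ (Z.of_nat (m %/ n.+1)%N)); first by have := ltn_pmod m (ltn0Sn n); lia.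
by rewrite {1}(divn_eq m n.+1); lia.
Qed.

Definition kron_list (m : Z) (s : seq (nat * nat)) : Z :=
  foldr (fun pe acc => kron_p m pe.1 ^ Z.of_nat pe.2 * acc) 1 s.
Definition pfactor_list (s : seq (nat * nat)) : nat :=
  foldr (fun pe acc => (pe.1 ^ pe.2 * acc)%N) 1%N s.

Lemma kron_listE m n : (0 < n)%N -> kron m (Z.of_nat n) = kron_list m (prime_decomp n).
Proof.
move=> n0; rewrite /kron.
case: Z.eqb_spec; first lia.
case: Z.ltb_spec; first lia.
by move=> _ _; rewrite Z.mul_1_l Zabs2Nat.id.
Qed.

Lemma pfactor_listE n : (0 < n)%N -> n = pfactor_list (prime_decomp n).
Proof.
move=> n0; rewrite {1}[n]prod_prime_decomp //.
by elim: (prime_decomp n) => [|x s IH]; rewrite ?big_nil // big_cons IH.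
Qed.

Lemma prime_decomp_all n : all (fun pe => prime pe.1) (prime_decomp n).
Proof. by apply/allP => -[p e] /mem_prime_decomp [pp _ _]. Qed.

(** Comparison principle: a function [th] multiplicative in the denominator agrees with the
    Kronecker symbol once it does so at primes. [P] is a side condition inherited by factors, such
    as oddness or coprimality. *)
Lemma kron_list_mult (m : Z) (P : nat -> Prop) (th : nat -> Z) (s : seq (nat * nat)) :
  th 1%N = 1 ->
  (forall u v, P (u * v)%N -> [/\ P u, P v & th (u * v)%N = th u * th v]) ->
  (forall p, prime p -> P p -> kron_p m p = th p) ->
  all (fun pe => prime pe.1) s -> P (pfactor_list s) -> kron_list m s = th (pfactor_list s).
Proof.
move=> th1 hm hp; elim: s => [//|[p e] s IH] /= /andP [pp ps] hP.
have [h1 h2 ->] := hm _ _ hP; rewrite IH //; congr (_ * _).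
elim: e h1 {hP} => [|e IHe] h1; first by rewrite expn0 th1.
move: h1; rewrite expnS => /hm [h3 h4 ->].
by rewrite Nat2Z.inj_succ Z.pow_succ_r ?IHe ?hp //; lia.
Qed.

Lemma pm1_pow z n : pm1 z -> pm1 (z ^ Z.of_nat n).
Proof.
move=> h; elim: n => [|n IH]; first by left.
by rewrite Nat2Z.inj_succ Z.pow_succ_r; [exact: pm1_mul|lia].
Qed.

Lemma kron_jac (m : Z) (n : nat) : odd n -> Z.gcd m (Z.of_nat n) = 1 ->
  kron m (Z.of_nat n) = jac m n.
Proof.
move=> on g; have n0 : (0 < n)%N by lia.
rewrite kron_listE // [in RHS](pfactor_listE n0).
apply: (@kron_list_mult m (fun n => odd n /\ Z.gcd m (Z.of_nat n) = 1) (jac m)) => //.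
- move=> u v []; rewrite oddM => /andP [ou ov]; rewrite Nat2Z.inj_mul => gu.
  split; [by split=> //; exact: gcd_mul_l gu|by split=> //; exact: gcd_mul_r gu|].
  by rewrite jac_mulr // Nat2Z.inj_mul.
- move=> p pp [op gp]; rewrite jac_legendre // /kron_p.
  by case: eqP => // p2; rewrite p2 in op.
- exact: prime_decomp_all.
- by rewrite -pfactor_listE.
Qed.

Definition odd_part (n : nat) : nat := (n %/ 2 ^ logn 2 n)%N.

Lemma odd_partE n : (0 < n)%N -> odd_part n = (n`_2^')%N.
Proof.
move=> n0; rewrite /odd_part -p_part -{1}(partnC 2%N n0) mulKn //.
Qed.

Lemma odd_partM u v : (0 < u * v)%N -> odd_part (u * v) = (odd_part u * odd_part v)%N.
Proof.
by move=> h; have := h; rewrite muln_gt0 => /andP [u0 v0]; rewrite !odd_partE // partnM.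
Qed.

Lemma odd_part_odd n : (0 < n)%N -> odd (odd_part n).
Proof.
move=> n0; rewrite odd_partE //; have := part_pnat (2%N)^' n.
by rewrite p'natE // dvdn2 negbK.
Qed.

Lemma odd_part_id n : odd n -> odd_part n = n.
Proof. by move=> on; rewrite /odd_part lognE dvdn2 on /= andbF divn1. Qed.

(* Quadratic reciprocity: turns the Kronecker symbol (a / n) of the paper into symbols with odd
   denominator. *)
Lemma kron_recip (a n : nat) : odd a -> (0 < n)%N -> coprime a n ->
  kron (Z.of_nat a) (Z.of_nat n) = jac (Z.of_nat n) a * sgn4 a (odd_part n).
Proof.
move=> oa n0 cop; rewrite kron_listE // [in RHS](pfactor_listE n0).
apply: (@kron_list_mult _ (fun n => (0 < n)%N /\ coprime a n)
          (fun n => jac (Z.of_nat n) a * sgn4 a (odd_part n))).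
- by rewrite jac_1 // /sgn4 /= andbF.
- move=> u v []; rewrite muln_gt0 => /andP [u0 v0]; rewrite coprimeMr => /andP [cu cv].
  split=> //; rewrite odd_partM ?muln_gt0 ?u0 // sgn4_mul ?odd_part_odd //.
  rewrite Nat2Z.inj_mul jac_mul //; first ring.
    by apply/coprime_Z; rewrite coprime_sym.
  by apply/coprime_Z; rewrite coprime_sym.
- move=> p pp [p0 ca]; rewrite /kron_p; case: eqP => [->|/eqP p2].
    rewrite /odd_part /= (_ : sgn4 a _ = 1); last by rewrite /sgn4 /= andbF.
    rewrite Z.mul_1_r jac_two //.
    rewrite (_ : Z.even (Z.of_nat a) = false); last by rewrite -Z.negb_odd -odd_Z_of_nat oa.
    have e k : (Z.of_nat a mod 8 =? Z.of_nat k) = (a %% 8 == k)%N.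
      by rewrite (modn_Z a 8); apply/Z.eqb_spec/eqP; lia.
    by rewrite -(e 1%N) -(e 7%N).
  have op : odd p by case: (even_prime pp) => // e; rewrite e in p2.
  have g : Z.gcd (Z.of_nat a) (Z.of_nat p) = 1 by apply/coprime_Z.
  by rewrite -jac_legendre // odd_part_id // jac_recip.
- exact: prime_decomp_all.
- by rewrite -pfactor_listE.
Qed.

Lemma kron_pm1 (m : Z) (n : nat) : (0 < n)%N -> Z.gcd m (Z.of_nat n) = 1 ->
  pm1 (kron m (Z.of_nat n)).
Proof.
move=> n0 g; rewrite kron_listE //; have := prime_decomp_all n.
move: g; rewrite [X in Z.of_nat X](pfactor_listE n0).
elim: (prime_decomp n) => [|[p e] s IH] /=; first by left.
rewrite Nat2Z.inj_mul => g /andP [pp ps]; apply: pm1_mul; last exact: IH (gcd_mul_r g) ps.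
case: e g => [|e] g; first by left.
apply: pm1_pow; move/gcd_mul_l: g; rewrite expnS Nat2Z.inj_mul => /gcd_mul_l g.
rewrite /kron_p; case: eqP => [p2|/eqP p2].
  rewrite (_ : Z.even m = false); first by case: ifP; [left|right].
  apply/negbTE/negP => /Z.even_spec [k hk]; move: g; rewrite hk p2 Z.mul_comm.
  by rewrite (_ : Z.of_nat 2 = 1 * 2) // Z.gcd_mul_mono_r; lia.
have op : odd p by case: (even_prime pp) => // h; rewrite h in p2.
by rewrite -jac_legendre //; exact: jac_pm1.
Qed.

(** * The multiplier of the eta quotient *)

Lemma saw_opp p k : 0 < k -> saw (- p) k = (- saw p k)%R.
Proof.
move=> k0; rewrite /saw; case: (Z.eqb_spec (p mod k) 0) => h.
  by rewrite Z.mod_opp_l_z ?h //=; [ring|lia].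
rewrite Z.mod_opp_l_nz //; last lia.
case: Z.eqb_spec => h'; first by have := Z.mod_pos_bound p k k0; lia.
rewrite minus_IZR; field; apply: not_0_IZR; lia.
Qed.

Lemma dedekind_sum_opp h k : 0 < k -> dedekind_sum (- h) k = (- dedekind_sum h k)%R.
Proof.
move=> k0; rewrite /dedekind_sum; elim: (iota _ _) => [|j s IH] /=; first by ring.
by rewrite IH Z.mul_opp_l saw_opp //; ring.
Qed.

Lemma det1_gcd a b c d : a * d - b * c = 1 -> Z.gcd c d = 1.
Proof.
move=> h; apply/Zgcd_1_rel_prime/bezout_rel_prime/(Bezout_intro _ _ _ (- b) a); lia.
Qed.

(** [Psi] contains s(-d, c), whose denominator c may be even. Reciprocity exchanges it for s(c, d),
    which is accessible modulo 8 when d is odd. *)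
Lemma Psi_ded12 (a b : Z) (c d : nat) : (0 < c)%N -> (0 < d)%N ->
  a * Z.of_nat d - b * Z.of_nat c = 1 ->
  (IZR (Z.of_nat d) * Psi a b (Z.of_nat c) (Z.of_nat d)
   = IZR (b - Z.of_nat c + ded12 (Z.of_nat c) d))%R.
Proof.
move=> c0 d0 det; have g := det1_gcd det.
have g' : Z.gcd (Z.of_nat d) (Z.of_nat c) = 1 by rewrite Z.gcd_comm.
rewrite /Psi; case: Z.ltb_spec => h; last lia.
rewrite dedekind_sum_opp //.
have e1 := ded12E c0 g'; rewrite INR_IZR_INZ in e1.
have rec : (IZR (Z.of_nat c) * IZR (ded12 (Z.of_nat c) d) + IZR (Z.of_nat d) * IZR (ded12 (Z.of_nat d) c)
  = IZR (Z.of_nat c) * IZR (Z.of_nat c) + IZR (Z.of_nat d) * IZR (Z.of_nat d) + 1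
    - 3 * IZR (Z.of_nat c) * IZR (Z.of_nat d))%R.
  rewrite -!mult_IZR -!plus_IZR -minus_IZR; congr IZR; rewrite (ded12_reciprocity c0 d0 g); lia.
have C0 : (IZR (Z.of_nat c) <> 0)%R by apply: not_0_IZR; lia.
have det' : (IZR a * IZR (Z.of_nat d) - IZR b * IZR (Z.of_nat c) = 1)%R.
  by rewrite -!mult_IZR -minus_IZR det.
rewrite (plus_IZR a) (plus_IZR (b - _)) minus_IZR.
move: (IZR (Z.of_nat c)) (IZR (Z.of_nat d)) (IZR (ded12 (Z.of_nat c) d)) (IZR (ded12 (Z.of_nat d) c))
  (IZR a) (IZR b) (dedekind_sum _ _) C0 e1 rec det' => C D U V A B s C0 e1 rec det'.
apply: (Rmult_eq_reg_l C) => //.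
have -> : (C * (D * ((A + D) / C + 12 * - s - 3)) = D * (A + D) - D * (12 * C * s) - 3 * C * D)%R by field.
rewrite e1; nra.
Qed.

Lemma Z_dvd_mul_cancel p a b : Z.gcd p a = 1 -> (p | a * b) -> (p | b).
Proof. by move=> g h; apply: (Z.gauss _ a). Qed.

Lemma Zcases2 q : exists t, q = 2 * t \/ q = 2 * t + 1.
Proof.
exists (q / 2); have := Z.div_mod q 2 ltac:(lia); have := Z.mod_pos_bound q 2 ltac:(lia).
by move: (q / 2) (q mod 2) => u v; lia.
Qed.

Lemma Zcases3 q : exists t, q = 3 * t \/ q = 3 * t + 1 \/ q = 3 * t + 2.
Proof.
exists (q / 3); have := Z.div_mod q 3 ltac:(lia); have := Z.mod_pos_bound q 3 ltac:(lia).
by move: (q / 3) (q mod 3) => u v; lia.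
Qed.

(** [Psi] is an integer z with d z = b - c + 12 d s(c, d): divisibility by d follows after
    multiplication by c from [ded12_mul]. The class modulo 8 comes from [ded12_mod8]; the class
    modulo 3 from the definition of [ded12] if 3 does not divide d, and from [ded12_mul], after
    multiplication by c, if it does. The term 6 (1 - J) is 0 or 12, that is, the sign J as an
    exponent of e(1/24). *)
Lemma Psi_mod24 (a b : Z) (c d : nat) : (0 < c)%N -> odd d ->
  a * Z.of_nat d - b * Z.of_nat c = 1 ->
  exists k, Psi a b (Z.of_nat c) (Z.of_nat d) =
    IZR (Z.of_nat c * (a * (1 - Z.of_nat d * Z.of_nat d) - Z.of_nat d) + b * Z.of_nat d
         + 3 * (Z.of_nat d - 1) + 6 * (1 - jac (Z.of_nat c) d) + 24 * k).
Proof.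
move=> c0 od det; have g := det1_gcd det; have d0 : (0 < d)%N by lia.
have hP := Psi_ded12 c0 d0 det.
have hm := ded12_mul d0 g; cbv zeta in hm.
have [k8 h8] := ded12_mod8 od g.
have h3 : exists S, ded12 (Z.of_nat c) d =
   2 * Z.of_nat c * (Z.of_nat d - 1) * (2 * Z.of_nat d - 1) - 12 * S - 3 * Z.of_nat d * (Z.of_nat d - 1).
  by eexists; rewrite /ded12; reflexivity.
case: h3 => S h3.
have dd : exists m, Z.of_nat d * Z.of_nat d = 8 * m + 1.
  have [q hq] : exists q, Z.of_nat d = 2 * q + 1 by exists (Z.of_nat d./2); lia.
  have [t [ht|ht]] : exists t, q = 2 * t \/ q = 2 * t + 1 by exact: Zcases2.
    by exists (2 * t * t + t); rewrite hq ht; ring.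
  by exists (2 * t * t + 3 * t + 1); rewrite hq ht; ring.
case: dd => m8 dd.
have jp := jac_pm1 (Z.of_nat c) d.
move: (jac _ _) jp h8 => J jp h8.
have D0 : Z.of_nat d <> 0 by lia.
have oD : exists q, Z.of_nat d = 2 * q + 1 by exists (Z.of_nat d./2); lia.
move: (Z.of_nat c) (Z.of_nat d) (ded12 _ _) (Zsum _ _) D0 oD g hP hm h8 h3 dd det
  => C D U V D0 oD g hP hm h8 h3 dd det {c0 od d0 c d}.
have [z hz] : (D | b - C + U).
  apply: (@Z_dvd_mul_cancel D C); first by rewrite Z.gcd_comm.
  exists (a + (C * C + 1) * (2 * D - 3) - 3 * C * (D - 1) - 6 * V).
  by rewrite Z.mul_add_distr_l hm; nia.
pose E := C * (a * (1 - D * D) - D) + b * D + 3 * (D - 1) + 6 * (1 - J).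
have zP : Psi a b C D = IZR z.
  apply: (Rmult_eq_reg_l (IZR D)); last exact: not_0_IZR.
  by rewrite hP hz mult_IZR Rmult_comm.
have [u hu] : (8 | z - E).
  apply: (@Z_dvd_mul_cancel 8 D).
    rewrite (_ : 8 = 2 * 2 * 2) // Z.gcd_comm; case: oD => q ->.
    have g2 : Z.gcd 2 (2 * q + 1) = 1 by rewrite Z.add_comm Z.mul_comm Z.gcd_add_mult_diag_r.
    by rewrite Z.gcd_comm; apply: gcd_mul_1 => //; apply: gcd_mul_1.
  case: oD => q hq.
  have -> : D * (z - E) = (b - C + U) - D * E by rewrite hz; ring.
  have -> : D * E = C * (a * D * (1 - (D * D)) - D * D) + b * (D * D) + 3 * (D * D) - 3 * D + 6 * D * (1 - J).
    by rewrite /E; ring.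
  rewrite h8 dd; case: jp => ->.
    by exists (k8 + C * a * D * m8 + C * m8 - b * m8 - 3 * m8 + q); rewrite hq; ring.
  by exists (k8 + C * a * D * m8 + C * m8 - b * m8 - 3 * m8 - D); ring.
have [v hv] : (3 | z - E).
  have [e [he|he]] : exists e, D = 3 * e \/ (D * D = 3 * e + 1 /\ Z.gcd 3 D = 1).
    have [t [ht|[ht|ht]]] : exists t, D = 3 * t \/ D = 3 * t + 1 \/ D = 3 * t + 2 by exact: Zcases3.
    - by exists t; left.
    - exists (3 * t * t + 2 * t); right; split; first by rewrite ht; ring.
      by rewrite ht Z.add_comm Z.mul_comm Z.gcd_add_mult_diag_r.
    - exists (3 * t * t + 4 * t + 1); right; split; first by rewrite ht; ring.
      by rewrite ht Z.add_comm Z.mul_comm Z.gcd_add_mult_diag_r.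
  - have g3 : Z.gcd 3 C = 1 by rewrite Z.gcd_comm; rewrite he in g; exact: gcd_mul_l g.
    apply: (@Z_dvd_mul_cancel 3 C) => //.
    have [w cc] : exists w, C * C = 3 * w + 1.
      have [t [ht|[ht|ht]]] : exists t, C = 3 * t \/ C = 3 * t + 1 \/ C = 3 * t + 2 by exact: Zcases3.
      - by move: g3; rewrite ht Z.gcd_mul_diag_l.
      - by exists (3 * t * t + 2 * t); rewrite ht; ring.
      - by exists (3 * t * t + 4 * t + 1); rewrite ht; ring.
    have [W hW] : exists W, C * z = a + 3 * W.
      exists ((C * C + 1) * (2 * e - 1) - C * (D - 1) - 2 * V).
      apply: (Z.mul_reg_l _ _ D) => //.
      have -> : D * (C * z) = C * (b - C + U) by rewrite hz; ring.
      rewrite Z.mul_add_distr_l hm.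
      have -> : (C * C + 1) * (D - 1) * (2 * D - 1) = (C * C + 1) * (1 - 3 * D + 2 * D * (3 * e)).
        by rewrite -he; ring.
      lia.
    have -> : C * (z - E) = C * z - C * E by ring.
    have -> : C * E = (C * C) * (a * (1 - D * D) - D) + C * b * D + 3 * C * (D - 1) + 6 * C * (1 - J).
      by rewrite /E; ring.
    rewrite hW cc he.
    exists (W - w * (a * (1 - 3 * e * (3 * e)) - 3 * e) + 3 * a * e * e + e - C * b * e
       - C * (3 * e - 1) - 2 * C * (1 - J)); ring.
  - case: he => he g3; apply: (@Z_dvd_mul_cancel 3 D) => //.
    have -> : D * (z - E) = (b - C + U) - D * E by rewrite hz; ring.
    have -> : D * E = C * (a * D * (1 - (D * D)) - D * D) + b * (D * D) + 3 * (D * D) - 3 * D + 6 * D * (1 - J).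
      by rewrite /E; ring.
    rewrite h3 (_ : 2 * C * (D - 1) * (2 * D - 1) = 2 * C * (2 * (D * D) - 3 * D + 1)); last ring.
    rewrite he.
    exists (2 * C * (2 * e - D + 1) - 4 * S - D * (D - 1) + C * a * D * e + C * e - b * e
       - 3 * e - 1 + D - 2 * D * (1 - J)); ring.
exists (3 * u - v); rewrite zP; congr IZR; rewrite -/E; lia.
Qed.

Definition em (z : Z) : C := eR (IZR z / 24).

Lemma eR_trig x : eR x = (cos (2 * PI * x), sin (2 * PI * x))%R.
Proof.
rewrite /eR /ee /cexp /=.
have -> : (0 * x - 2 * PI * 0 = 0)%R by ring.
have -> : (0 * 0 + 2 * PI * x = 2 * PI * x)%R by ring.
by rewrite exp_0 !Rmult_1_l.
Qed.

Lemma eR_add x y : eR (x + y) = Cmult (eR x) (eR y).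
Proof.
rewrite !eR_trig Rmult_plus_distr_l cos_plus sin_plus /Cmult /=.
by congr pair; ring.
Qed.

Lemma eR_0 : eR 0 = RtoC 1.
Proof. by rewrite eR_trig Rmult_0_r cos_0 sin_0. Qed.

Lemma eR_1 : eR 1 = RtoC 1.
Proof. by rewrite eR_trig Rmult_1_r cos_2PI sin_2PI. Qed.

Lemma eR_opp x : Cmult (eR x) (eR (- x)) = RtoC 1.
Proof. by rewrite -eR_add Rplus_opp_r eR_0. Qed.

Lemma eR_nat n : eR (INR n) = RtoC 1.
Proof. by elim: n => [|n IH]; [exact: eR_0|rewrite S_INR eR_add IH eR_1 Cmult_1_l]. Qed.

Lemma eR_int z : eR (IZR z) = RtoC 1.
Proof.
have [h|h] : 0 <= z \/ 0 <= - z by lia.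
  by rewrite -(Z2Nat.id z) // -INR_IZR_INZ eR_nat.
have := eR_opp (IZR z); rewrite -opp_IZR -(Z2Nat.id (- z)) // -INR_IZR_INZ eR_nat.
by rewrite Cmult_1_r.
Qed.

Lemma em_add y z : em (y + z) = Cmult (em y) (em z).
Proof. by rewrite /em -eR_add plus_IZR; congr eR; field. Qed.

Lemma em_24 z : em (24 * z) = RtoC 1.
Proof. by rewrite /em mult_IZR -(eR_int z); congr eR; field. Qed.

Lemma em_mod y z : (24 | y - z) -> em y = em z.
Proof.
move=> [k hk]; have -> : y = z + 24 * k by lia.
by rewrite em_add em_24 Cmult_1_r.
Qed.

Definition yN (r : nat -> Z) (N : nat) : Z :=
  Zsum (divisors N) (fun n => Z.of_nat (N %/ n) * r n).

Lemma divn_Z (c n : nat) : (0 < n)%N -> (n %| c)%N -> Z.of_nat c / Z.of_nat n = Z.of_nat (c %/ n).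
Proof.
by move=> n0 dv; symmetry; apply: (Z.div_unique_pos _ _ _ 0); [lia|rewrite -{1}(divnK dv); lia].
Qed.

(** A sign depends only on the parity of its exponent, so in the additive notation 1 - J taking
    powers is linear modulo 4. *)
Lemma pm1_powZ J r : pm1 J -> exists k, 1 - J ^ Z.of_nat (Z.abs_nat r) = r * (1 - J) + 4 * k.
Proof.
have pow1 n : (1 ^ Z.of_nat n = 1) by apply: Z.pow_1_l; lia.
have powm n : (-1) ^ Z.of_nat n = if odd n then -1 else 1.
  by elim: n => // n IH; rewrite Nat2Z.inj_succ Z.pow_succ_r ?IH /=; [case: (odd n)|lia].
case=> ->; first by exists 0; rewrite pow1; lia.
rewrite powm; have [t [ht|ht]] := Zcases2 r; case: ifP => h.
- lia.
- by exists (- t); lia.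
- by exists (- t); lia.
- lia.
Qed.

Lemma Zsum_cons (A : Type) (x : A) s F : Zsum (x :: s) F = F x + Zsum s F.
Proof. by []. Qed.

Lemma Zprod_cons (A : Type) (x : A) s F : Zprod (x :: s) F = F x * Zprod s F.
Proof. by []. Qed.

(** Sum [Psi_mod24] over the matrices (a, b n; c/n, d). Writing c/n = (c/N)(N/n) collects the terms
    with c into [yN] and those with b n into [xN]. *)
Lemma eta_char_val r N (a b : Z) (c d : nat) :
  (0 < c)%N -> (N %| c)%N -> odd d -> a * Z.of_nat d - b * Z.of_nat c = 1 ->
  eta_char r N a b (Z.of_nat c) (Z.of_nat d) true =
  em (Z.of_nat (c %/ N) * yN r N * (a * (1 - Z.of_nat d * Z.of_nat d) - Z.of_nat d)
      + b * Z.of_nat d * xN r N + 3 * twok r N * (Z.of_nat d - 1)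
      + 6 * (1 - Zprod (divisors N) (fun n => jac (Z.of_nat (c %/ n)) d ^ Z.of_nat (Z.abs_nat (r n))))).
Proof.
move=> c0 Nc od det.
have N0 : (0 < N)%N by apply: dvdn_gt0 Nc.
rewrite /eta_char.
have -> : CpowZ (sgnC true) (- twok r N) = RtoC 1.
  have p1 n : Cpow_nat (RtoC 1) n = RtoC 1 by elim: n => //= n ->; rewrite Cmult_1_l.
  rewrite /sgnC /CpowZ; case: (- _) => //= p; rewrite p1 //.
  by apply: injective_projections => /=; field.
rewrite Cmult_1_l.
have [k hk] : exists k, foldr (fun n acc => (IZR (r n) *
          Psi a (b * Z.of_nat n) (Z.of_nat c / Z.of_nat n) (Z.of_nat d) + acc)%R) 0%R (divisors N)
   = IZR (Z.of_nat (c %/ N) * yN r N * (a * (1 - Z.of_nat d * Z.of_nat d) - Z.of_nat d)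
      + b * Z.of_nat d * xN r N + 3 * twok r N * (Z.of_nat d - 1)
      + 6 * (1 - Zprod (divisors N) (fun n => jac (Z.of_nat (c %/ n)) d ^ Z.of_nat (Z.abs_nat (r n)))) + 24 * k).
  rewrite /yN /xN /twok.
  (* Generalising one copy of the list while keeping this inclusion retains n | N in the induction;
     the device recurs below. *)
  have : {subset divisors N <= divisors N} by [].
  elim: {1 3 4 5 6 7}(divisors N) => [|n s IH] sub; first by exists 0; congr IZR; rewrite /=; lia.
  rewrite !Zsum_cons Zprod_cons [foldr _ _ _]/=.
  have [k hk] := IH (fun x xs => sub x (mem_behead (s := n :: s) xs)).
  have nN : (n %| N)%N by rewrite dvdn_divisors // sub // mem_head.
  have n0 : (0 < n)%N by apply: dvdn_gt0 nN.
  have nc : (n %| c)%N by apply: dvdn_trans nN Nc.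
  have c1 : (0 < c %/ n)%N by rewrite divn_gt0 // dvdn_leq.
  rewrite hk divn_Z //.
  have det' : a * Z.of_nat d - (b * Z.of_nat n) * Z.of_nat (c %/ n) = 1.
    by rewrite -{1}det -{2}(divnK nc); lia.
  have [m ->] := Psi_mod24 c1 od det'.
  have cn : Z.of_nat (c %/ n) = Z.of_nat (c %/ N) * Z.of_nat (N %/ n).
    by rewrite (_ : c %/ n = c %/ N * (N %/ n))%N; [lia|rewrite muln_divA // divnK].
  have jp := jac_pm1 (Z.of_nat (c %/ n)) d.
  have [t ht] := pm1_powZ (r n) jp.
  have pp : pm1 (Zprod s (fun n => jac (Z.of_nat (c %/ n)) d ^ Z.of_nat (Z.abs_nat (r n)))).
    by apply: Zprod_pm1 => x; apply: pm1_pow; exact: jac_pm1.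
  have qp := pm1_pow (Z.abs_nat (r n)) jp.
  rewrite cn in jp ht qp *.
  move: (jac _ _) (_ ^ _) (Zprod s _) (Zsum s _) (Zsum s _) (Zsum s _) jp ht pp qp {hk}
    => J JP P X Y Z jp ht pp qp.
  have [w hw] : exists w, 6 * (1 - JP * P) = 6 * (1 - JP) + 6 * (1 - P) + 24 * w.
    case: pp => ->; case: qp => ->; by [exists 0|exists (-1)].
  rewrite hw ht; rewrite -mult_IZR -plus_IZR; eexists; congr IZR.
  instantiate (1 := k - t - w + r n * m); ring.
rewrite hk /em; have -> : (/ 24 * IZR (?[E] + 24 * k) = IZR ?E / 24 + IZR k)%R.
  by move=> z; rewrite plus_IZR mult_IZR; field.
by rewrite eR_add eR_int Cmult_1_r.
Qed.

(** * Congruences for the exponents of an eta quotient *)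

Definition wprod (r : nat -> Z) (N : nat) (s : seq nat) : nat :=
  foldr (fun n acc => (N %/ n) ^ Z.abs_nat (r n) * acc)%N 1%N s.

Lemma varpiE r N : varpi r N = wprod r N (divisors N).
Proof. by []. Qed.

(** The nontrivial character modulo 4 of the odd part of n, written additively; [delta] is its value
    at [varpi]. *)
Definition mod4_sign (n : nat) : Z := if (odd_part n %% 4 == 1)%N then 0 else 1.

Lemma delta_sign r N : delta r N = IZR (mod4_sign (varpi r N)).
Proof. by rewrite /delta /mod4_sign /odd_part; case: ifP. Qed.

Lemma divisor_quot_gt0 N n : (0 < N)%N -> (n %| N)%N -> (0 < N %/ n)%N.
Proof. by move=> N0 nN; rewrite divn_gt0; [exact: dvdn_leq|exact: dvdn_gt0 nN]. Qed.

Lemma wprod_gt0 r N (s : seq nat) : (0 < N)%N -> {subset s <= divisors N} -> (0 < wprod r N s)%N.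
Proof.
move=> N0; elim: s => //= n s IH sub.
rewrite muln_gt0 expn_gt0 IH ?andbT; last by move=> x xs; apply: sub; rewrite inE xs orbT.
by rewrite divisor_quot_gt0 // dvdn_divisors // sub // mem_head.
Qed.

Lemma Zsum_dvd (p : Z) (s : seq nat) (r F : nat -> Z) :
  (forall n, n \in s -> (p | F n)) -> (p | Zsum s (fun n => r n * F n)).
Proof.
elim: s => [|n s IH] h; first exact: Z.divide_0_r.
rewrite Zsum_cons; apply: Z.divide_add_r.
  by apply: Z.divide_mul_r; apply: h; rewrite mem_head.
by apply: IH => m ms; apply: h; rewrite inE ms orbT.
Qed.

Lemma mod4_signM u v : (0 < u)%N -> (0 < v)%N ->
  (2 | mod4_sign (u * v) - mod4_sign u - mod4_sign v).
Proof.
move=> u0 v0; rewrite /mod4_sign odd_partM ?muln_gt0 ?u0 // -modnMm.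
have := odd_part_odd u0; have := odd_part_odd v0.
move: (odd_part u) (odd_part v) => p q oq op.
have : [|| p %% 4 == 1 | p %% 4 == 3]%N by lia.
have : [|| q %% 4 == 1 | q %% 4 == 3]%N by lia.
by move=> /orP [] /eqP -> /orP [] /eqP -> /=; [exists 0|exists 0|exists 0|exists (-1)].
Qed.

Lemma mod4_signX u k : (0 < u)%N -> (2 | mod4_sign (u ^ k) - Z.of_nat k * mod4_sign u).
Proof.
move=> u0; elim: k => [|k [m IH]]; first by exists 0; rewrite expn0.
have [j hj] := @mod4_signM u (u ^ k) u0 ltac:(by rewrite expn_gt0 u0).
by exists (j + m); rewrite expnS Nat2Z.inj_succ; lia.
Qed.

Lemma abs_parity z : exists k, Z.of_nat (Z.abs_nat z) = z + 2 * k.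
Proof.
have [h|h] : 0 <= z \/ z <= 0 by lia.
  by exists 0; lia.
by exists (- z); lia.
Qed.

(** Additivity modulo 2, together with the equal parity of |r_n| and r_n. *)
Lemma mod4_sign_wprod r N (s : seq nat) : (0 < N)%N -> {subset s <= divisors N} ->
  (2 | mod4_sign (wprod r N s) - Zsum s (fun n => r n * mod4_sign (N %/ n))).
Proof.
move=> N0; elim: s => [|n s IH] sub; first by exists 0.
have sub' : {subset s <= divisors N} by move=> x xs; apply: sub; rewrite inE xs orbT.
have n0 : (0 < N %/ n)%N by rewrite divisor_quot_gt0 // dvdn_divisors // sub // mem_head.
have [k hk] := IH sub'; rewrite Zsum_cons [wprod _ _ _]/=.
have [j hj] := @mod4_signM ((N %/ n) ^ Z.abs_nat (r n))%N (wprod r N s)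
  ltac:(by rewrite expn_gt0 n0) (wprod_gt0 r N0 sub').
have [i hi] := mod4_signX (Z.abs_nat (r n)) n0.
have [e he] := abs_parity (r n).
exists (k + j + i + e * mod4_sign (N %/ n)).
rewrite -/(wprod r N s) he in hi hj *; lia.
Qed.

Lemma logn_wprod r N (s : seq nat) : (0 < N)%N -> {subset s <= divisors N} ->
  (2 | Z.of_nat (logn 2 (wprod r N s)) - Zsum s (fun n => r n * Z.of_nat (logn 2 (N %/ n)))).
Proof.
move=> N0; elim: s => [|n s IH] sub; first by exists 0; rewrite logn1.
have sub' : {subset s <= divisors N} by move=> x xs; apply: sub; rewrite inE xs orbT.
have n0 : (0 < N %/ n)%N by rewrite divisor_quot_gt0 // dvdn_divisors // sub // mem_head.
have [k hk] := IH sub'; rewrite Zsum_cons [wprod _ _ _]/=.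
rewrite lognM ?expn_gt0 ?n0 ?wprod_gt0 // lognX.
have [e he] := abs_parity (r n).
exists (k + e * Z.of_nat (logn 2 (N %/ n))).
rewrite Nat2Z.inj_add Nat2Z.inj_mul he -/(wprod r N s); lia.
Qed.

(** Twice the number k + delta of [psi]; an integer also for half-integral k. *)
Definition kap (r : nat -> Z) (N : nat) : Z := twok r N + 2 * mod4_sign (varpi r N).

Lemma odd_mod4_sign v : odd v -> (4 | Z.of_nat v - 1 - 2 * mod4_sign v).
Proof.
move=> ov; rewrite /mod4_sign odd_part_id //; case: ifP => h.
  by exists (Z.of_nat (v %/ 4)%N); lia.
by exists (Z.of_nat (v %/ 4)%N); lia.
Qed.

(** An odd v is 1 + 2 [mod4_sign v] modulo 4; take v = N/n, multiply by r_n and sum. *)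
Lemma kap_odd r N : odd N -> (4 | kap r N - yN r N).
Proof.
move=> oN; have N0 : (0 < N)%N by lia.
have [j hj] : (4 | Zsum (divisors N) (fun n => r n * (Z.of_nat (N %/ n) - 1 - 2 * mod4_sign (N %/ n)))).
  apply: Zsum_dvd => n; rewrite -dvdn_divisors // => nN; apply: odd_mod4_sign.
  by apply: odd_dvd oN; rewrite -{2}(divnK nN) dvdn_mulr.
have [k hk] := @mod4_sign_wprod r N (divisors N) N0 (fun x h => h).
exists (k - j); rewrite /kap varpiE /twok /yN.
have e : Zsum (divisors N) (fun n => r n * (Z.of_nat (N %/ n) - 1 - 2 * mod4_sign (N %/ n))) =
  Zsum (divisors N) (fun n => Z.of_nat (N %/ n) * r n) + (-1 * Zsum (divisors N) r +
    -2 * Zsum (divisors N) (fun n => r n * mod4_sign (N %/ n))).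
  by rewrite -!ZsumMl -!ZsumD; apply: eq_Zsum => n _; ring.
lia.
Qed.

Lemma odd_part_double v : odd v -> odd_part (2 * v) = v.
Proof.
by move=> ov; rewrite odd_partM ?(odd_part_id ov) //; [rewrite /odd_part /= mul1n|lia].
Qed.

(** Exactly one of n and N/n is even. In both cases N/n + M n + 1 - 2 [mod4_sign (N/n)] is divisible
    by 4, and n + N/n is odd; multiply by r_n and sum. *)
Lemma kap_2odd r M : odd M ->
  (4 | kap r (2 * M) - yN r (2 * M) - Z.of_nat M * xN r (2 * M) - 2 * twok r (2 * M)) /\
  (2 | twok r (2 * M) - xN r (2 * M) - yN r (2 * M)).
Proof.
move=> oM; set N := (2 * M)%N; have N0 : (0 < N)%N by rewrite /N; lia.
have cases n : (n %| N)%N ->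
   (exists n' v, [/\ n = 2 * n', N %/ n = v, odd n', odd v & v * n' = M])%N
   \/ (exists v, [/\ odd n, N %/ n = 2 * v, odd v & v * n = M])%N.
  move=> nN; have e := divnK nN; move: (N %/ n)%N e => w; rewrite /N => e.
  case on : (odd n); last first.
    left; exists n./2, w; have e' : (w * n./2 = M)%N by nia.
    have : odd (w * n./2) by rewrite e'.
    by rewrite oddM => /andP [ow on']; split=> //; lia.
  right; have ow : ~~ odd w.
    have : odd (w * n) = odd (2 * M) by rewrite e.
    by rewrite !oddM on andbT /= => ->.
  exists w./2; have e' : (w./2 * n = M)%N by nia.
  have : odd (w./2 * n) by rewrite e'.
  by rewrite oddM => /andP [ow' _]; split=> //; lia.
have [j hj] : (4 | Zsum (divisors N) (fun n => r n * (Z.of_nat (N %/ n) + Z.of_nat M * Z.of_nat n + 1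
      - 2 * mod4_sign (N %/ n)))).
  apply: Zsum_dvd => n; rewrite -dvdn_divisors // => /cases [[n' [v [-> -> on ov e]]]|[v [on -> ov e]]].
    have [k hk] := odd_mod4_sign ov.
    have [t ht] : exists t, Z.of_nat M * Z.of_nat n' = 2 * t + 1.
      exists (Z.of_nat (M * n')./2); have : odd (M * n') by rewrite oddM oM. lia.
    by exists (k + t + 1); lia.
  rewrite /mod4_sign odd_part_double //; have [k hk] := odd_mod4_sign ov.
  rewrite /mod4_sign odd_part_id // in hk.
  have [t ht] : exists t, Z.of_nat n * Z.of_nat n = 4 * t + 1.
    exists (Z.of_nat (n./2 * n./2 + n./2)); have -> : Z.of_nat n = 2 * Z.of_nat n./2 + 1 by lia.
    rewrite Nat2Z.inj_add Nat2Z.inj_mul; ring.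
  have -> : Z.of_nat M * Z.of_nat n = Z.of_nat v * (Z.of_nat n * Z.of_nat n) by rewrite -e; lia.
  rewrite ht; move: (if _ then _ else _) hk => e4 hk.
  exists (Z.of_nat v * t + e4 + 3 * k + 1); lia.
have [k hk] := @mod4_sign_wprod r N (divisors N) N0 (fun x h => h).
have e : Zsum (divisors N) (fun n => r n * (Z.of_nat (N %/ n) + Z.of_nat M * Z.of_nat n + 1 - 2 * mod4_sign (N %/ n))) =
  yN r N + (Z.of_nat M * xN r N + (Zsum (divisors N) r +
    -2 * Zsum (divisors N) (fun n => r n * mod4_sign (N %/ n)))).
  by rewrite /yN /xN -!ZsumMl -!ZsumD; apply: eq_Zsum => n _; ring.
have [i hi] : (2 | Zsum (divisors N) (fun n => r n * (1 - Z.of_nat n - Z.of_nat (N %/ n)))).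
  apply: Zsum_dvd => n; rewrite -dvdn_divisors // => /cases [[n' [v [-> -> on ov _]]]|[v [on -> ov _]]].
    by exists (- Z.of_nat v./2 - Z.of_nat n'); lia.
  by exists (- Z.of_nat v - Z.of_nat n./2); lia.
have e' : Zsum (divisors N) (fun n => r n * (1 - Z.of_nat n - Z.of_nat (N %/ n))) =
  twok r N + (-1 * xN r N + -1 * yN r N).
  by rewrite /twok /yN /xN -!ZsumMl -!ZsumD; apply: eq_Zsum => n _; ring.
split; last by exists i; lia.
by exists (k - j); rewrite /kap varpiE /twok; rewrite /twok in e'; lia.
Qed.

(** If v_2(N) = 2, then v_2(N/n) = 1 + n + N/n modulo 2 for every n | N. This decides the parity
    occurring in [delta1]. *)
Lemma logn_4odd r M : odd M ->
  (2 | Z.of_nat (logn 2 (varpi r (4 * M))) - twok r (4 * M) - xN r (4 * M) - yN r (4 * M)).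
Proof.
move=> oM; set N := (4 * M)%N; have N0 : (0 < N)%N by rewrite /N; lia.
have lN : logn 2 N = 2%N.
  by rewrite /N lognM //; [rewrite (lognE 2 M) dvdn2 oM andbF /=|lia].
have [j hj] : (2 | Zsum (divisors N) (fun n => r n * (Z.of_nat (logn 2 (N %/ n)) - 1 - Z.of_nat n - Z.of_nat (N %/ n)))).
  apply: Zsum_dvd => n; rewrite -dvdn_divisors // => nN.
  have n0 : (0 < n)%N by apply: dvdn_gt0 nN.
  have e := divnK nN; have w0 := divisor_quot_gt0 N0 nN; move: (N %/ n)%N e w0 => w e w0.
  have : (logn 2 w + logn 2 n = 2)%N by rewrite -lognM // e.
  have lo m : (0 < m)%N -> (logn 2 m == 0)%N = odd m.
    by move=> m0; rewrite lognE m0 dvdn2 /=; case: (odd m).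
  have := lo w w0; have := lo n n0; move: (logn 2 w) (logn 2 n) => a b hb ha hab.
  have h : [|| (a == 0) && (b == 2), (a == 1) && (b == 1) | (a == 2) && (b == 0)]%N by lia.
  case/or3P: h => /andP [/eqP ea /eqP eb]; rewrite ea eb /= in ha hb.
  - exists (- Z.of_nat n./2 - Z.of_nat w./2 - 1); lia.
  - exists (- Z.of_nat n./2 - Z.of_nat w./2); lia.
  - exists (- Z.of_nat n./2 - Z.of_nat w./2); lia.
have [k hk] := @logn_wprod r N (divisors N) N0 (fun x h => h).
have e : Zsum (divisors N) (fun n => r n * (Z.of_nat (logn 2 (N %/ n)) - 1 - Z.of_nat n - Z.of_nat (N %/ n))) =
  Zsum (divisors N) (fun n => r n * Z.of_nat (logn 2 (N %/ n))) + (-1 * twok r N + (-1 * xN r N + -1 * yN r N)).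
  by rewrite /twok /yN /xN -!ZsumMl -!ZsumD; apply: eq_Zsum => n _; ring.
by exists (k + j); rewrite varpiE; lia.
Qed.

Lemma m_fP r N : exists G : Z, [/\ Z.of_nat (m_f r N) * G = 24, (G | xN r N) & (G | yN r N)].
Proof.
rewrite /m_f -/(yN r N); set G := Z.gcd 24 _.
have G24 : (G | 24) by exact: Z.gcd_divide_l.
have G0 : 0 < G.
  have := Z.gcd_nonneg 24 (Z.gcd (yN r N) (xN r N)); rewrite -/G => h.
  have : G <> 0 by move=> e; move: G24; rewrite e => -[k]; lia.
  lia.
have Gg : (G | Z.gcd (yN r N) (xN r N)) by exact: Z.gcd_divide_r.
exists G; split.
- have GE : Z.of_nat (Z.to_nat G) = G by lia.
  have : (Z.to_nat G %| 24)%N by apply/dvdn_Z; rewrite GE.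
  by move=> /divnK h; rewrite -{2}GE -Nat2Z.inj_mul -[RHS]/(Z.of_nat 24) -{2}h.
- by apply: Z.divide_trans Gg _; exact: Z.gcd_divide_r.
- by apply: Z.divide_trans Gg _; exact: Z.gcd_divide_l.
Qed.

Lemma m_f_dvd24 r N : (m_f r N %| 24)%N.
Proof.
have [G [h _ _]] := m_fP r N; apply/dvdn_Z; exists G.
by change (Z.of_nat 24) with 24; lia.
Qed.

Lemma m_f_x r N : (24 | Z.of_nat (m_f r N) * xN r N).
Proof. by have [G [<- [k ->] _]] := m_fP r N; exists k; ring. Qed.

Lemma m_f_y r N : (24 | Z.of_nat (m_f r N) * yN r N).
Proof. by have [G [<- _ [k ->]]] := m_fP r N; exists k; ring. Qed.

(** The factor 8 of 24 = m_f G then lies entirely in G. *)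
Lemma m_f_odd r N : odd (m_f r N) -> (8 | xN r N) /\ (8 | yN r N).
Proof.
move=> om; have [G [h gx gy]] := m_fP r N.
have h8 : (8 | G).
  apply: (@Z_dvd_mul_cancel 8 (Z.of_nat (m_f r N))); last by rewrite h; exists 3.
  by apply/(coprime_Z 8); rewrite (coprimeXl 3 (m := 2)) // coprime2n.
by split; apply: Z.divide_trans h8 _.
Qed.

(** A divisor of 24 not divisible by 4 is 1, 2, 3 or 6, so the cofactor G is divisible by 4. *)
Lemma m_f_n4 r N : ~~ (4 %| m_f r N)%N -> (4 | yN r N).
Proof.
move=> om; have [G [h gx gy]] := m_fP r N; apply: Z.divide_trans gy.
have := m_f_dvd24 r N; move: (m_f r N) om h => m om h m24.
have m1 : (m <= 24)%N by apply: dvdn_leq.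
have : m \in [:: 1; 2; 3; 6]%N.
  by clear h; move: om m24; do 25 (case: m m1 => [//|m] m1 //).
rewrite !inE => /or4P [] /eqP e; rewrite e in h; [exists 6|exists 3|exists 2|exists 1]; lia.
Qed.

Lemma em_0 : em 0 = RtoC 1.
Proof. exact: (em_24 0). Qed.

Lemma em_12 : em 12 = RtoC (-1).
Proof.
rewrite /em (_ : 12 / 24 = / 2)%R; last by field.
rewrite eR_trig (_ : 2 * PI * / 2 = PI)%R; last by field.
by rewrite cos_PI sin_PI.
Qed.

Lemma pm1_em z : pm1 z -> RtoC (IZR z) = em (6 * (1 - z)).
Proof. by case=> ->; [rewrite em_0|rewrite em_12]. Qed.

Lemma em_neq0 z : em z <> RtoC 0.
Proof.
move=> h; have := em_add z (- z); rewrite Z.add_opp_diag_r em_0 h Cmult_0_l.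
by move=> /RtoC_inj; lra.
Qed.

Lemma em_inv z : Cinv (em z) = em (- z).
Proof.
have h : Cmult (em z) (em (- z)) = RtoC 1 by rewrite -em_add Z.add_opp_diag_r em_0.
by rewrite -[LHS]Cmult_1_r -h Cmult_assoc Cinv_l ?Cmult_1_l //; exact: em_neq0.
Qed.

Lemma em_pow z n : CpowZ (em z) n = em (z * n).
Proof.
have pn k : Cpow_nat (em z) k = em (z * Z.of_nat k).
  elim: k => [|k IH]; first by rewrite Z.mul_0_r em_0.
  by rewrite [Cpow_nat _ _]/= IH -em_add; congr em; lia.
case: n => [|p|p] /=; first by rewrite Z.mul_0_r em_0.
  by rewrite pn positive_nat_Z.
by rewrite pn em_inv positive_nat_Z; congr em; lia.
Qed.

Definition delta1Z (r : nat -> Z) (N l : nat) : Z :=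
  if [&& ~~ odd l, (4 %| N)%N, Z.odd (twok r N) & odd (logn 2 (varpi r N))] then 1 else 0.

(** The exponent of [psi] in units of 1/8, obtained from k + delta = [kap] / 2. *)
Definition psiZ (r : nat -> Z) (N l a b : nat) : Z :=
  if odd l then - kap r N * (Z.of_nat (l %/ a) - 1) + kap r N * (Z.of_nat l - 1) * (Z.of_nat N - 1)
  else if ~~ odd N then - kap r N * (Z.of_nat a - 1) - Z.of_nat N * kap r N * (1 + delta1Z r N l) * Z.of_nat b
  else 0.

Lemma psi_em r N l a b : psi r N l a b = em (3 * psiZ r N l a b).
Proof.
rewrite /psi /psiZ delta_sign.
have kE : (IZR (twok r N) / 2 + IZR (mod4_sign (varpi r N)) = IZR (kap r N) / 2)%R.
  by rewrite /kap plus_IZR mult_IZR; field.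
rewrite kE !INR_IZR_INZ.
have dE : delta1 r N l = IZR (delta1Z r N l) by rewrite /delta1 /delta1Z; case: ifP.
case: ifP => _; [|case: ifP => _]; rewrite ?dE /em; last by rewrite Z.mul_0_r; exact/esym/em_0.
  by congr eR; rewrite !(plus_IZR, minus_IZR, mult_IZR, opp_IZR); field.
by congr eR; rewrite !(plus_IZR, minus_IZR, mult_IZR, opp_IZR); field.
Qed.

(** * The weights of the Hecke operator *)

(** The phase e(-b d x_N / 24) is the half of the exponential in [c_l] that belongs to the weight;
    the half e(b d x_N / (24 l)) arises later from the expansion of f((a t + b) / d). *)
Definition hecke_unit (r : nat -> Z) (N l a b : nat) : C :=
  let d := (l %/ a)%N in
  Cmult (RtoC (IZR (kron (Z.of_nat a) (Z.of_nat (varpi r N)))))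
   (Cmult (Cmult (CpowZ (RtoC (IZR (kron (- Z.of_nat N * Z.of_nat b) (Z.of_nat (gcdn a d))))) (twok r N))
                 (em (- Z.of_nat b * Z.of_nat d * xN r N)))
          (psi r N l a b)).

(** gcd(A, T)^2 = gcd(A^2, A T, T^2) = A gcd(A, T, B), and the last gcd is 1. *)
Lemma sqr_of_coprime_mul (A B T : nat) : coprime A B -> (A * B = T * T)%N -> exists A0, A = (A0 * A0)%N.
Proof.
move=> cop e; exists (gcdn A T).
rewrite muln_gcdr !muln_gcdl -e (mulnC T A) -!muln_gcdr.
have -> : gcdn (gcdn A T) (gcdn T B) = 1%N; last by rewrite muln1.
apply/eqP; rewrite -dvdn1 -(eqP cop) dvdn_gcd.
by rewrite (dvdn_trans (dvdn_gcdl _ _) (dvdn_gcdl _ _)) (dvdn_trans (dvdn_gcdr _ _) (dvdn_gcdr _ _)).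
Qed.

Lemma pm1_1mul u v : pm1 u -> pm1 v -> (4 | (1 - u * v) - (1 - u) - (1 - v)).
Proof. by case=> ->; case=> ->; [exists 0|exists 0|exists 0|exists (-1)]. Qed.

(** Since (s' N)/n = s' (N/n), the product of symbols splits into that of [varpi] and the 2k-th
    power of (s' / t). The identity is additive modulo 4 because signs enter the exponent as 6 (1 -
    J) modulo 24. *)
Lemma jac_wprod_split (r : nat -> Z) (N : nat) (s' t : nat) (s : seq nat) : (0 < N)%N -> odd t ->
  coprime (s' * N) t -> {subset s <= divisors N} ->
  (4 | (1 - Zprod s (fun n => jac (Z.of_nat ((s' * N) %/ n)) t ^ Z.of_nat (Z.abs_nat (r n))))
       - (1 - jac (Z.of_nat (wprod r N s)) t) - Zsum s r * (1 - jac (Z.of_nat s') t))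
  /\ coprime (wprod r N s) t.
Proof.
move=> N0 ot; rewrite coprimeMl => /andP [c1 c2]; elim: s => [|n s IH] sub.
  split; last exact: coprime1n.
  by exists 0; rewrite [wprod _ _ _]/= jac_1.
have sub' : {subset s <= divisors N} by move=> x xs; apply: sub; rewrite inE xs orbT.
have [[k hk] cw] := IH sub'.
have nN : (n %| N)%N by rewrite dvdn_divisors // sub // mem_head.
have cn : coprime (N %/ n) t by apply: coprime_dvdl c2; rewrite -{2}(divnK nN) dvdn_mulr.
have cX e : coprime ((N %/ n) ^ e) t by rewrite coprimeXl.
split; last by rewrite /= coprimeMl cX.
rewrite Zsum_cons Zprod_cons [wprod _ _ _]/= -/(wprod r N s).
rewrite -muln_divA // !Nat2Z.inj_mul.
rewrite !jac_mul //; try by apply/coprime_Z.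
have jX e : jac (Z.of_nat ((N %/ n) ^ e)%N) t = jac (Z.of_nat (N %/ n)) t ^ Z.of_nat e.
  elim: e => [|e IHe]; first by rewrite expn0 jac_1.
  rewrite expnS Nat2Z.inj_mul jac_mul //; try by apply/coprime_Z.
  by rewrite IHe Nat2Z.inj_succ Z.pow_succ_r //; lia.
rewrite jX Z.pow_mul_l.
have p1 := pm1_pow (Z.abs_nat (r n)) (jac_pm1 (Z.of_nat s') t).
have p2 := pm1_pow (Z.abs_nat (r n)) (jac_pm1 (Z.of_nat (N %/ n)) t).
have [m hm] := pm1_powZ (r n) (jac_pm1 (Z.of_nat s') t).
have p3 := jac_pm1 (Z.of_nat (wprod r N s)) t.
have p4 : pm1 (Zprod s (fun n => jac (Z.of_nat ((s' * N) %/ n)) t ^ Z.of_nat (Z.abs_nat (r n)))).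
  by apply: Zprod_pm1 => x; apply: pm1_pow; exact: jac_pm1.
move: (jac (Z.of_nat s') t) (jac (Z.of_nat (N %/ n)) t ^ _) (jac (Z.of_nat s') t ^ _)
  (jac (Z.of_nat (wprod _ _ _)) t) (Zprod s _) p1 p2 p3 p4 hm hk
  => J Y X W P p1 p2 p3 p4 hm hk.
have [i hi] := pm1_1mul (pm1_mul p1 p2) p4; have [j hj] := pm1_1mul p1 p2; have [e he] := pm1_1mul p2 p3.
exists (k + m + i + j - e); lia.
Qed.

Lemma wprod_jac1 (r : nat -> Z) (N T : nat) (s : seq nat) : (0 < N)%N -> odd T ->
  (forall n, (n %| N)%N -> coprime n T /\ jac (Z.of_nat n) T = 1) ->
  {subset s <= divisors N} -> coprime (wprod r N s) T /\ jac (Z.of_nat (wprod r N s)) T = 1.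
Proof.
move=> N0 oT h; elim: s => [|n s IH] sub; first by rewrite /= coprime1n jac_1.
have [cw jw] := IH (fun x xs => sub x (mem_behead (s := n :: s) xs)).
have nN : (n %| N)%N by rewrite dvdn_divisors // sub // mem_head.
have [cn jn] := h (N %/ n)%N ltac:(by rewrite -{2}(divnK nN) dvdn_mulr).
have [cX jX] : coprime ((N %/ n) ^ Z.abs_nat (r n)) T /\ jac (Z.of_nat ((N %/ n) ^ Z.abs_nat (r n))) T = 1.
  elim: (Z.abs_nat (r n)) => [|e [ce je]]; first by rewrite expn0 coprime1n jac_1.
  rewrite expnS coprimeMl cn ce; split=> //.
  by rewrite Nat2Z.inj_mul jac_mul ?jn ?je //; apply/coprime_Z.
rewrite [wprod _ _ _]/= -/(wprod r N s) coprimeMl cX cw; split=> //.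
by rewrite Nat2Z.inj_mul jac_mul ?jX ?jw //; apply/coprime_Z.
Qed.

Lemma wprod_jac1r (r : nat -> Z) (N : nat) (T : Z) (s : seq nat) : odd N ->
  (forall n, (n %| N)%N -> Z.gcd T (Z.of_nat n) = 1 /\ jac T n = 1) ->
  {subset s <= divisors N} ->
  [/\ odd (wprod r N s), Z.gcd T (Z.of_nat (wprod r N s)) = 1 & jac T (wprod r N s) = 1].
Proof.
move=> oN h; have N0 : (0 < N)%N by lia.
elim: s => [|n s IH] sub; first by split=> //; exact: Z.gcd_1_r.
have [ow cw jw] := IH (fun x xs => sub x (mem_behead (s := n :: s) xs)).
have nN : (n %| N)%N by rewrite dvdn_divisors // sub // mem_head.
have mN : (N %/ n %| N)%N by rewrite -{2}(divnK nN) dvdn_mulr.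
have [cn jn] := h (N %/ n)%N mN; have on := odd_dvd mN oN.
have [oX cX jX] : [/\ odd ((N %/ n) ^ Z.abs_nat (r n)), Z.gcd T (Z.of_nat ((N %/ n) ^ Z.abs_nat (r n))) = 1
    & jac T ((N %/ n) ^ Z.abs_nat (r n)) = 1].
  elim: (Z.abs_nat (r n)) => [|e [oe ce je]]; first by split=> //; exact: Z.gcd_1_r.
  have g : Z.gcd T (Z.of_nat (N %/ n * (N %/ n) ^ e)%N) = 1.
    by rewrite Nat2Z.inj_mul Z.gcd_comm; apply: gcd_mul_1; rewrite Z.gcd_comm.
  by rewrite expnS oddM on oe; split=> //; rewrite jac_mulr // jn je.
have g : Z.gcd T (Z.of_nat ((N %/ n) ^ Z.abs_nat (r n) * wprod r N s)%N) = 1.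
  by rewrite Nat2Z.inj_mul Z.gcd_comm; apply: gcd_mul_1; rewrite Z.gcd_comm.
rewrite [wprod _ _ _]/= -/(wprod r N s) oddM oX ow; split=> //.
by rewrite jac_mulr // jX jw.
Qed.

(** An odd number is its own inverse modulo 8. *)
Lemma odd_mul_mod8 (a t : nat) : odd a -> (a * t = 1 %[mod 8])%N -> exists k, Z.of_nat t = Z.of_nat a + 8 * k.
Proof.
move=> oa h; exists (Z.of_nat (t %/ 8)%N - Z.of_nat (a %/ 8)%N).
suff : (t %% 8 = a %% 8)%N by lia.
have : (a %% 8 \in [:: 1; 3; 5; 7])%N by rewrite !inE; lia.
have : (t %% 8 < 8)%N by exact: ltn_pmod.
move: h; rewrite -modnMm; move: (a %% 8)%N (t %% 8)%N => x y h hy; rewrite !inE => /or4P [] /eqP e;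
  rewrite e in h *; by do 8 (case: y h hy => [//|y] h hy).
Qed.

Lemma modn_eq_Z (n k m : nat) : (n = k %[mod m])%N -> exists i, Z.of_nat n = Z.of_nat k + Z.of_nat m * i.
Proof.
move=> h; exists (Z.of_nat (n %/ m) - Z.of_nat (k %/ m)).
rewrite {1}(divn_eq n m) {1}(divn_eq k m) h !Nat2Z.inj_add !Nat2Z.inj_mul; ring.
Qed.

(** The unit group modulo a divisor of 24 has exponent at most 2; checked by enumeration. *)
Lemma sqr_mod24 (d m : nat) : (m %| 24)%N -> coprime d m -> (d * d = 1 %[mod m])%N.
Proof.
move=> m24; have m0 : (0 < m)%N by apply: dvdn_gt0 m24.
rewrite -modnMm -coprime_modl.
have : all (fun m => all (fun e => coprime e m ==> (e * e == 1 %[mod m]))%N (iota 0 m)) (divisors 24) by [].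
move=> /allP /(_ m); rewrite -dvdn_divisors // => /(_ m24) /allP /(_ (d %% m)%N).
by rewrite mem_iota ltn_pmod // => /(_ isT) /implyP h /h /eqP.
Qed.

Lemma wprod_coprime (r : nat -> Z) (N t : nat) (s : seq nat) : (0 < N)%N -> coprime N t ->
  {subset s <= divisors N} -> coprime (wprod r N s) t.
Proof.
move=> N0 cN; elim: s => [|n s IH] sub; first exact: coprime1n.
rewrite /= coprimeMl IH ?andbT; last by move=> x xs; apply: sub; rewrite inE xs orbT.
have nN : (n %| N)%N by rewrite dvdn_divisors // sub // mem_head.
by rewrite coprimeXl //; apply: coprime_dvdl cN; rewrite -{2}(divnK nN) dvdn_mulr.
Qed.

Lemma sgn4_mod4 (a w : nat) : odd a -> odd (odd_part w) ->
  (8 | 2 * (1 - sgn4 a (odd_part w)) - 2 * mod4_sign w * (Z.of_nat a - 1)).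
Proof.
move=> oa ow; rewrite /sgn4 /mod4_sign.
have ea : Z.of_nat a = 4 * Z.of_nat (a %/ 4)%N + Z.of_nat (a %% 4)%N by lia.
have v3 : (odd_part w %% 4 == 3)%N = ~~ (odd_part w %% 4 == 1)%N by lia.
rewrite v3; move: (Z.of_nat (a %/ 4)%N) ea => A ea.
case h1 : (a %% 4 == 3)%N; case: (odd_part w %% 4 == 1)%N; cbv beta iota delta [andb negb].
- by exists 0; lia.
- by exists (- A); lia.
- by exists 0; lia.
- by exists (- A); lia.
Qed.

Lemma pm1_pair J S : pm1 J -> pm1 S -> (8 | 2 * (1 - J) + 2 * (1 - J * S) - 2 * (1 - S)).
Proof. by case=> ->; case=> ->; [exists 0|exists 0|exists 1|exists 0]. Qed.

Lemma pm1_even J : pm1 J -> (2 | 1 - J).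
Proof. by case=> ->; [exists 0|exists 1]. Qed.

Lemma odd_sqr8 (a : nat) : odd a -> exists i, Z.of_nat a * Z.of_nat a = 8 * i + 1.
Proof.
move=> oa; have [t [ht|ht]] := Zcases2 (Z.of_nat a./2).
  exists (2 * t * t + t); have -> : Z.of_nat a = 2 * (2 * t) + 1 by lia.
  ring.
exists (2 * t * t + 3 * t + 1); have -> : Z.of_nat a = 2 * (2 * t + 1) + 1 by lia.
ring.
Qed.

(** * The weight of (a b; 0 d) and the multiplier of its representative (a q; s t) *)

Section WeightIdentity.
Variables (r : nat -> Z) (N l a b d u q s t : nat).
Hypotheses (N0 : (0 < N)%N) (a0 : (0 < a)%N) (lE : l = (a * d)%N) (lm : (l = 1 %[mod m_f r N])%N)
  (lsq : Z.odd (twok r N) = true -> exists T, l = (T * T)%N)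
  (aN : coprime a N) (abd : gcdn (gcdn a b) d = 1%N) (l0 : (0 < l)%N)
  (qE : q = (b + d * u)%N) (det : (a * t = 1 + s * q)%N) (ot : odd t) (s0 : (0 < s)%N)
  (sM : (N * m_f r N %| s)%N) (s64 : odd a -> (64 * N %| s)%N).

Let m := m_f r N.
Let x := xN r N.
Let y := yN r N.
Let tk := twok r N.
Let g := gcdn a d.

Lemma weight_dE : (l %/ a = d)%N.
Proof. by rewrite lE mulKn. Qed.

Lemma weight_sN : (N %| s)%N.
Proof. exact: dvdn_trans (dvdn_mulr _ (dvdnn N)) sM. Qed.

Lemma weight_det : Z.of_nat a * Z.of_nat t = 1 + Z.of_nat s * Z.of_nat q.
Proof. by have := f_equal Z.of_nat det; rewrite Nat2Z.inj_add !Nat2Z.inj_mul. Qed.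

Lemma weight_m : exists i, Z.of_nat a * Z.of_nat d = 1 + Z.of_nat m * i.
Proof. by have [i hi] := modn_eq_Z lm; exists i; rewrite lE Nat2Z.inj_mul in hi. Qed.

(** Modulo m_f one has a d = l = 1 and a t = 1, hence t = d; as d^2 = 1 as well, q t = (b + d u) d =
    b d + u. The factor x_N lifts this to a congruence modulo 24. *)
Lemma weight_x : (24 | Z.of_nat u * x - Z.of_nat q * Z.of_nat t * x + Z.of_nat b * Z.of_nat d * x).
Proof.
have [k hk] : exists k, Z.of_nat u - Z.of_nat q * Z.of_nat t + Z.of_nat b * Z.of_nat d = Z.of_nat m * k.
  have [i hi] := weight_m.
  have [j hj] : exists j, Z.of_nat s = Z.of_nat m * j.
    have /dvdnP [j ->] := sM; exists (Z.of_nat j * Z.of_nat N); rewrite -/m !Nat2Z.inj_mul; ring.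
  have [e he] : exists e, Z.of_nat (d * d) = Z.of_nat 1 + Z.of_nat m * e.
    apply: modn_eq_Z; apply: sqr_mod24; first exact: m_f_dvd24.
    apply/coprime_Z/Zgcd_1_rel_prime/bezout_rel_prime.
    by apply: (Bezout_intro _ _ _ (Z.of_nat a) (- i)); rewrite hi; ring.
  have dt := weight_det.
  have tE : Z.of_nat t = Z.of_nat d + Z.of_nat m * (Z.of_nat d * j * Z.of_nat q - i * Z.of_nat t).
    rewrite {1}(_ : Z.of_nat t = (Z.of_nat a * Z.of_nat t) * Z.of_nat d
       - (Z.of_nat a * Z.of_nat d - 1) * Z.of_nat t); last by ring.
    by rewrite dt hi hj; ring.
  rewrite tE qE Nat2Z.inj_add Nat2Z.inj_mul.
  rewrite Nat2Z.inj_mul in he.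
  move: (Z.of_nat d * j * _ - _) => w.
  exists (- (e * Z.of_nat u) - (Z.of_nat b + Z.of_nat d * Z.of_nat u) * w).
  have -> : (Z.of_nat b + Z.of_nat d * Z.of_nat u) * (Z.of_nat d + Z.of_nat m * w) =
     Z.of_nat b * Z.of_nat d + (Z.of_nat d * Z.of_nat d) * Z.of_nat u
     + (Z.of_nat b + Z.of_nat d * Z.of_nat u) * Z.of_nat m * w by ring.
  by rewrite he; ring.
have -> : Z.of_nat u * x - Z.of_nat q * Z.of_nat t * x + Z.of_nat b * Z.of_nat d * x
  = (Z.of_nat u - Z.of_nat q * Z.of_nat t + Z.of_nat b * Z.of_nat d) * x by ring.
rewrite hk; have [w hw] := m_f_x r N; exists (w * k).
rewrite -/m -/x in hw; rewrite (Z.mul_comm _ k) -Z.mul_assoc hw; ring.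
Qed.

Lemma weight_y z : (24 | Z.of_nat (s %/ N) * y * z).
Proof.
have /dvdnP [j sE] := sM.
have -> : (s %/ N = j * m)%N by rewrite sE mulnC -mulnA mulKn // mulnC.
have [w hw] := m_f_y r N; exists (w * Z.of_nat j * z).
rewrite -/m -/y in hw; rewrite Nat2Z.inj_mul -!Z.mul_assoc (Z.mul_assoc (Z.of_nat m)) hw; ring.
Qed.

Lemma weight_st : coprime s t.
Proof.
apply/coprime_Z/Zgcd_1_rel_prime/bezout_rel_prime.
by apply: (Bezout_intro _ _ _ (- Z.of_nat q) (Z.of_nat a)); rewrite weight_det; ring.
Qed.

Lemma weight_sa : coprime s a.
Proof.
apply/coprime_Z/Zgcd_1_rel_prime/bezout_rel_prime.
by apply: (Bezout_intro _ _ _ (- Z.of_nat q) (Z.of_nat t)); rewrite (Z.mul_comm (Z.of_nat t)) weight_det; ring.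
Qed.

(* Everything except the x- and y-parts of the exponent, divided by 3. *)
Lemma weight_reduce :
  (8 | tk * (Z.of_nat t - 1) + 2 * (1 - jac (Z.of_nat (varpi r N)) t)
       + 2 * tk * (1 - jac (Z.of_nat (s %/ N)) t)
       + 2 * (1 - kron (Z.of_nat a) (Z.of_nat (varpi r N)))
       + 2 * tk * (1 - kron (- Z.of_nat N * Z.of_nat b) (Z.of_nat g)) + psiZ r N l a b) ->
  em (Z.of_nat u * x) =
  Cmult (eta_char r N (Z.of_nat a) (Z.of_nat q) (Z.of_nat s) (Z.of_nat t) true) (hecke_unit r N l a b).
Proof.
move=> [k hk].
rewrite eta_char_val //; [|exact: weight_sN|by rewrite weight_det; ring].
have sE : ((s %/ N) * N = s)%N by rewrite divnK // weight_sN.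
have [[i hi] cw] := @jac_wprod_split r N (s %/ N) t (divisors N) N0 ot
  ltac:(by rewrite sE; exact: weight_st) (fun x h => h).
rewrite sE in hi.
have n0 : (0 < varpi r N)%N by apply: wprod_gt0.
have caw : coprime a (varpi r N) by rewrite coprime_sym; apply: wprod_coprime => //; rewrite coprime_sym.
have p1 : pm1 (kron (Z.of_nat a) (Z.of_nat (varpi r N))) by apply: kron_pm1 => //; apply/coprime_Z.
have g0 : (0 < g)%N by rewrite gcdn_gt0 a0.
have gNb : Z.gcd (- Z.of_nat N * Z.of_nat b) (Z.of_nat g) = 1.
  apply: gcd_mul_1.
    rewrite Z.gcd_opp_l; apply/coprime_Z; rewrite coprime_sym.
    exact: coprime_dvdl (dvdn_gcdl _ _) aN.
  by apply/coprime_Z; rewrite /coprime /g (gcdnC b) -gcdnA (gcdnC d) gcdnA abd.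
have p2 := kron_pm1 g0 gNb.
rewrite /hecke_unit weight_dE -/g -/tk !pm1_em // em_pow psi_em -!em_add.
have [v hv] := weight_x; have [w hw] := weight_y (Z.of_nat a * (1 - Z.of_nat t * Z.of_nat t) - Z.of_nat t).
apply: em_mod; rewrite varpiE -/tk -/x -/y in hk hv hw *.
rewrite -/(twok r N) -/tk in hi.
move: hk hv hw hi; clear.
move: (Zprod _ _) (kron _ _) (kron _ _) (psiZ _ _ _ _ _) (jac _ _) (jac _ _) (Z.of_nat (s %/ N) * y * _).
move=> P K1 K2 Q J1 J2 Y hk hv hw hi.
by exists (v - w - i - k); lia.
Qed.

Lemma weight_at8 : odd a -> (a * t = 1 %[mod 8])%N.
Proof.
move=> oa; rewrite det; have /dvdnP [k ->] := s64 oa.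
by rewrite (_ : 1 + k * (64 * N) * q = 1 + k * (8 * N) * q * 8)%N ?modnMDr //; clear; lia.
Qed.

(** As 64 N divides s, a t = 1 modulo 8 n for each n | N, so every (n / a t) is 1 by
    [jac_top_period], and with it ([varpi] / a t). *)
Lemma weight_jac_varpi : odd a ->
  jac (Z.of_nat (varpi r N)) t = jac (Z.of_nat (varpi r N)) a.
Proof.
move=> oa; have oT : odd (a * t) by rewrite oddM oa.
have [cw jw] : coprime (wprod r N (divisors N)) (a * t) /\ jac (Z.of_nat (wprod r N (divisors N))) (a * t) = 1.
  apply: wprod_jac1 => // n nN; have n0 : (0 < n)%N by apply: dvdn_gt0 nN.
  have cn : coprime n (a * t).
    by apply: coprime_dvdl (dvdn_trans nN weight_sN) _; rewrite coprimeMr weight_sa weight_st.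
  split=> //; apply: jac_top_period => //; first by apply/coprime_Z.
  have /dvdnP [k sE] := s64 oa; have /dvdnP [j NE] := nN.
  exists (k * 8 * j * q)%N; rewrite det sE NE; clear; lia.
rewrite -varpiE in cw jw; move/coprime_Z in cw.
have := jw; rewrite jac_mulr //.
have := jac_pm1 (Z.of_nat (varpi r N)) t; have := jac_pm1 (Z.of_nat (varpi r N)) a.
by case=> ->; case=> ->.
Qed.

(* For half-integral weight l is a square, so that a and gcd(a, d) agree up to a square. *)
Lemma weight_half : odd a -> Z.odd tk = true ->
  jac (Z.of_nat (s %/ N)) t = kron (- Z.of_nat N * Z.of_nat b) (Z.of_nat g).
Proof.
move=> oa otk; have oT : odd (a * t) by rewrite oddM oa.
have /dvdnP [k sE] := s64 oa.
have s'E : (s %/ N = 64 * k)%N by rewrite sE mulnA mulnK // mulnC.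
have csT : coprime s (a * t) by rewrite coprimeMr weight_sa weight_st.
have cs'T : coprime (s %/ N) (a * t) by apply: coprime_dvdl csT; rewrite -{2}(divnK weight_sN) dvdn_mulr.
have k0 : (0 < k)%N by have := s0; rewrite sE; case: (k).
have j1 : jac (Z.of_nat (s %/ N)) (a * t) = 1.
  have c8 : Z.gcd (Z.of_nat 8) (Z.of_nat (a * t)) = 1.
    by apply/coprime_Z; rewrite (coprimeXl 3 (m := 2)) // coprime2n.
  have ck : Z.gcd (Z.of_nat k) (Z.of_nat (a * t)) = 1.
    by apply/coprime_Z; apply: coprime_dvdl cs'T; rewrite s'E dvdn_mull.
  (* Origin of the constant 64: its root 8 drops out of the symbol as a square, and a t = 1 modulo 8
     k still holds. *)
  rewrite s'E (_ : Z.of_nat (64 * k) = (Z.of_nat 8 * Z.of_nat 8) * Z.of_nat k); last by clear; lia.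
  rewrite jac_mul //; last exact: gcd_mul_1.
  rewrite jac_sq // Z.mul_1_l; apply: jac_top_period => //.
  by exists (8 * N * q)%N; rewrite det sE; clear; lia.
move/coprime_Z in cs'T; have := j1; rewrite jac_mulr //.
have e1 : jac (Z.of_nat (s %/ N)) a = jac (Z.of_nat (s %/ N)) g.
  have gA : (g %| a)%N by exact: dvdn_gcdl.
  have gD : (g %| d)%N by exact: dvdn_gcdr.
  have g0 : (0 < g)%N by rewrite gcdn_gt0 a0.
  have cAD : coprime (a %/ g) (d %/ g).
    by rewrite /coprime -(eqn_pmul2r g0) muln_gcdl !divnK // mul1n.
  have [T TE] := lsq otk.
  have gT : (g %| T)%N.
    rewrite -(dvdn_pexp2r _ _ (isT : (0 < 2)%N)) !expnS !expn0 !muln1 -TE lE.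
    exact: dvdn_mul.
  have [A0 AE] : exists A0, (a %/ g = A0 * A0)%N.
    apply: (sqr_of_coprime_mul (T := (T %/ g)%N) cAD).
    have gg : (0 < g * g)%N by rewrite muln_gt0 g0.
    by apply/eqP; rewrite -(eqn_pmul2r gg) (mulnACA (a %/ g)) (mulnACA (T %/ g)) !divnK // -TE lE eqxx.
  have aE : a = (g * (A0 * A0))%N by rewrite -AE mulnC divnK.
  have og : odd g by exact: odd_dvd gA oa.
  have oA : odd A0 by move: oa; rewrite aE !oddM => /andP [_ /andP []].
  have gs : Z.gcd (Z.of_nat (s %/ N)) (Z.of_nat (g * (A0 * A0))) = 1.
    rewrite -aE; apply/coprime_Z; apply: coprime_dvdl weight_sa; rewrite -{2}(divnK weight_sN); exact: dvdn_mulr.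
  have gs2 := gs; rewrite Nat2Z.inj_mul in gs2.
  rewrite {1}aE jac_mulr ?oddM ?oA // jac_mulr //; last exact: gcd_mul_r gs2.
  by rewrite (pm1_sq (jac_pm1 _ _)) Z.mul_1_r.
rewrite e1.
have og : odd g by exact: odd_dvd (dvdn_gcdl _ _) oa.
have gNb : Z.gcd (- Z.of_nat N * Z.of_nat b) (Z.of_nat g) = 1.
  apply: gcd_mul_1.
    rewrite Z.gcd_opp_l; apply/coprime_Z; rewrite coprime_sym.
    exact: coprime_dvdl (dvdn_gcdl _ _) aN.
  by apply/coprime_Z; rewrite /coprime /g (gcdnC b) -gcdnA (gcdnC d) gcdnA abd.
rewrite kron_jac //.
have gs : Z.gcd (Z.of_nat (s %/ N)) (Z.of_nat g) = 1.
  apply/coprime_Z; apply: coprime_dvdr (dvdn_gcdl _ _) _.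
  by apply: coprime_dvdl weight_sa; rewrite -{2}(divnK weight_sN); exact: dvdn_mulr.
(* Modulo g, which divides a and d, the determinant equation a t = 1 + s (b + d u) reads s b =
   -1. *)
have : jac (Z.of_nat (s %/ N) * (- Z.of_nat N * Z.of_nat b)) g = 1.
  have /dvdnP [A aE] : (g %| a)%N by exact: dvdn_gcdl.
  have /dvdnP [D dE] : (g %| d)%N by exact: dvdn_gcdr.
  have sN : Z.of_nat s = Z.of_nat (s %/ N) * Z.of_nat N by rewrite -{1}(divnK weight_sN) Nat2Z.inj_mul.
  have dt := weight_det.
  have -> : Z.of_nat (s %/ N) * (- Z.of_nat N * Z.of_nat b) =
    1 + Z.of_nat g * (Z.of_nat s * Z.of_nat D * Z.of_nat u - Z.of_nat A * Z.of_nat t).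
    have aE' := f_equal Z.of_nat aE; have dE' := f_equal Z.of_nat dE; have qE' := f_equal Z.of_nat qE.
    rewrite Nat2Z.inj_mul in aE'; rewrite Nat2Z.inj_mul in dE'; rewrite Nat2Z.inj_add Nat2Z.inj_mul in qE'.
    have -> : Z.of_nat (s %/ N) * (- Z.of_nat N * Z.of_nat b) = - (Z.of_nat s * Z.of_nat b) by rewrite sN; ring.
    rewrite qE' in dt; move: aE' dE' dt; clear; move: (Z.of_nat d) (Z.of_nat a) => d1 a1 -> -> h.
    lia.
  by rewrite jac_mod ?jac_1 // gcdn_gt0 a0.
rewrite jac_mul //.
have := jac_pm1 (Z.of_nat (s %/ N)) t; have := jac_pm1 (Z.of_nat (s %/ N)) g.
have := jac_pm1 (- Z.of_nat N * Z.of_nat b) g.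
by case=> ->; case=> ->; case=> ->.
Qed.

Lemma kap_even : Z.odd tk = false -> exists k, kap r N = 2 * k.
Proof.
move=> h; have [k hk] : Z.Even tk by apply/Z.even_spec; rewrite -Z.negb_odd h.
by exists (k + mod4_sign (varpi r N)); rewrite /kap -/tk hk; ring.
Qed.

Lemma even_l_odd_m : ~~ odd l -> odd m.
Proof.
move=> el; have [i hi] := modn_eq_Z lm.
case om : (odd m) => //; have mE : Z.of_nat m = 2 * Z.of_nat m./2 by move: om; clear; lia.
rewrite -/m mE in hi; have lE' : Z.of_nat l = 2 * Z.of_nat l./2 by move: el; clear; lia.
by move: hi; rewrite lE'; clear; move: (Z.of_nat l./2) (Z.of_nat m./2) => A B; change (Z.of_nat 1) with 1; nia.
Qed.

(** The congruence modulo 8 that [psi] is designed for. If l is odd it concerns a - d + (l - 1)(N -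
    1). If l is even, m_f is odd, so 8 divides x_N and y_N, and the congruences for [kap] and
    [delta1] settle the cases by v_2(N). *)
Lemma weight_psi : odd a -> (8 | kap r N * (Z.of_nat a - 1) + psiZ r N l a b).
Proof.
move=> oa; rewrite /psiZ weight_dE.
have [i ai] := odd_sqr8 oa.
case ol : (odd l).
  have od : odd d by move: ol; rewrite lE oddM => /andP [].
  have lZ : Z.of_nat l = Z.of_nat a * Z.of_nat d by rewrite lE Nat2Z.inj_mul.
  (* From a^2 = 1 modulo 8 one gets d = l a, so a - d is -(l - 1) a modulo 8. *)
  have ad k : Z.of_nat l = k + 1 -> Z.of_nat a - Z.of_nat d = - k * Z.of_nat a + 8 * i * Z.of_nat d.
    move=> h; have : Z.of_nat d * (Z.of_nat a * Z.of_nat a) = Z.of_nat a * (k + 1) by rewrite -h lZ; ring.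
    rewrite ai; clear; move: (Z.of_nat a) (Z.of_nat d) => A D; lia.
  have -> : kap r N * (Z.of_nat a - 1) + (- kap r N * (Z.of_nat d - 1) + kap r N * (Z.of_nat l - 1) * (Z.of_nat N - 1))
    = kap r N * ((Z.of_nat a - Z.of_nat d) + (Z.of_nat l - 1) * (Z.of_nat N - 1)) by ring.
  case otk : (Z.odd tk).
    have [T TE] := lsq otk.
    have oT : odd T by move: ol; rewrite TE oddM => /andP [].
    have [j hj] := odd_sqr8 oT.
    have l8 : Z.of_nat l = 8 * j + 1 by rewrite TE Nat2Z.inj_mul hj.
    rewrite (ad _ l8) l8; apply: Z.divide_mul_r.
    by exists (- j * Z.of_nat a + i * Z.of_nat d + j * (Z.of_nat N - 1)); ring.
  have [k kE] := kap_even otk; rewrite kE.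
  have aE : Z.of_nat a = 2 * Z.of_nat a./2 + 1 by move: oa; clear; lia.
  have dE : Z.of_nat d = 2 * Z.of_nat d./2 + 1 by move: od; clear; lia.
  case oN : (odd N); last first.
    have NE : Z.of_nat N = 2 * Z.of_nat N./2 by move: oN; clear; lia.
    rewrite lZ NE aE dE; move: (Z.of_nat a./2) (Z.of_nat d./2) (Z.of_nat N./2) => A D n.
    by exists (k * (- D - A * D + n * (2 * A * D + A + D))); ring.
  have NE : Z.of_nat N = 2 * Z.of_nat N./2 + 1 by move: oN; clear; lia.
  (* N odd, integral weight: either l = 1 modulo 4, or 4 divides y_N and therefore [kap]. *)
  case m4 : (4 %| m_f r N)%N.
    have [j hj] := modn_eq_Z lm; have /dvdnP [e mE] := m4.
    have l4 : Z.of_nat l = 4 * (Z.of_nat e * j) + 1 by rewrite hj mE Nat2Z.inj_mul; change (Z.of_nat 1) with 1; ring.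
    rewrite (ad _ l4) l4 NE; move: (Z.of_nat a) (Z.of_nat d) (Z.of_nat N./2) (Z.of_nat e * j) => A D n w.
    by exists (k * (- w * A + 2 * i * D + w * 2 * n)); ring.
  have [f hf] : (4 | yN r N) by apply: m_f_n4; rewrite m4.
  have [e he] := kap_odd r oN; rewrite kE hf in he.
  have -> : 2 * k = 4 * (e + f) by move: he; clear; lia.
  rewrite lZ NE aE dE; move: (Z.of_nat a./2) (Z.of_nat d./2) (Z.of_nat N./2) => A D n.
  by exists ((e + f) * (A - D + (2 * A * D + A + D) * 2 * n)); ring.
have om : odd m by apply: even_l_odd_m; rewrite ol.
have [x8 y8] := m_f_odd om; rewrite -/x -/y in x8 y8.
case oN : (odd N); cbv beta iota delta [negb].
  have [k hk] := kap_odd r oN; case: y8 => e he; rewrite -/y he in hk.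
  have aE : Z.of_nat a = 2 * Z.of_nat a./2 + 1 by move: oa; clear; lia.
  exists ((k + 2 * e) * Z.of_nat a./2); rewrite aE (_ : kap r N = 4 * (k + 2 * e)); first by ring.
  by move: hk; clear; lia.
have -> : kap r N * (Z.of_nat a - 1) + (- kap r N * (Z.of_nat a - 1) - Z.of_nat N * kap r N * (1 + delta1Z r N l) * Z.of_nat b)
  = (Z.of_nat N * kap r N * (1 + delta1Z r N l)) * (- Z.of_nat b) by ring.
apply: Z.divide_mul_l.
case: x8 => x1 hx; case: y8 => y1 hy.
(* l and N even, in four cases: v_2(N) = 1; 4 | N with integral weight; 8 | N; and v_2(N) = 2 with
   half-integral weight. *)
case o2 : (odd N./2).
  have NE : N = (2 * N./2)%N by move: oN; clear; lia.
  have [[k hk] [j hj]] := kap_2odd r o2; rewrite -NE -/x -/y -/tk hx hy in hk hj.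
  have NZ : Z.of_nat N = 2 * Z.of_nat N./2 by move: oN; clear; lia.
  rewrite NZ (_ : kap r N = 4 * (k + j + 2 * Z.of_nat N./2 * x1 + 4 * x1 + 2 * y1 + 4 * y1 )); last first.
    by move: hk hj; clear; move: (kap r N) (Z.of_nat N./2) => K n; lia.
  by exists (Z.of_nat N./2 * (k + j + 2 * Z.of_nat N./2 * x1 + 4 * x1 + 2 * y1 + 4 * y1) * (1 + delta1Z r N l)); ring.
have N4 : N = (4 * N./2./2)%N by move: oN o2; clear; lia.
have N4Z : Z.of_nat N = 4 * Z.of_nat N./2./2 by move: oN o2; clear; lia.
case otk : (Z.odd tk); last first.
  have [k ->] := kap_even otk; rewrite N4Z.
  by exists (Z.of_nat N./2./2 * k * (1 + delta1Z r N l)); ring.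
case o4 : (odd N./2./2); last first.
  rewrite (_ : Z.of_nat N = 8 * Z.of_nat N./2./2./2); last by move: oN o2 o4; clear; lia.
  by exists (Z.of_nat N./2./2./2 * kap r N * (1 + delta1Z r N l)); ring.
have [k hk] := logn_4odd r o4; rewrite -N4 -/x -/y -/tk hx hy in hk.
have lo : odd (logn 2 (varpi r N)).
  have [w hw] : Z.Odd tk by apply/Z.odd_spec.
  rewrite odd_Z_of_nat; apply/Z.odd_spec; exists (k + w + 4 * x1 + 4 * y1).
  by move: hk hw; clear; lia.
(* In the last case N contributes only a factor 4; [delta1] = 1 supplies the missing factor 2. *)
have -> : delta1Z r N l = 1.
  by rewrite /delta1Z -/tk otk lo ol (_ : (4 %| N)%N = true) //; rewrite N4 dvdn_mulr.
by rewrite N4Z; exists (Z.of_nat N./2./2 * kap r N); ring.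
Qed.

(** For odd a, t = a modulo 8 and reciprocity turns the symbol (a / [varpi]) into ([varpi] / a)
    times a sign, which is the source of delta. For even a, the number l is even, N is odd, the
    weight is integral and [psi] is 1, and the symbols with denominator [varpi] are compared
    directly. *)
Lemma weight_identity :
  em (Z.of_nat u * x) =
  Cmult (eta_char r N (Z.of_nat a) (Z.of_nat q) (Z.of_nat s) (Z.of_nat t) true) (hecke_unit r N l a b).
Proof.
apply: weight_reduce.
have n0 : (0 < varpi r N)%N by apply: wprod_gt0.
have cwN t' : coprime N t' -> coprime (varpi r N) t' by move=> h; apply: wprod_coprime.
have caw : coprime a (varpi r N) by rewrite coprime_sym; apply: cwN; rewrite coprime_sym.
have g0 : (0 < g)%N by rewrite gcdn_gt0 a0.
have gNb : Z.gcd (- Z.of_nat N * Z.of_nat b) (Z.of_nat g) = 1.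
  apply: gcd_mul_1.
    rewrite Z.gcd_opp_l; apply/coprime_Z; rewrite coprime_sym.
    exact: coprime_dvdl (dvdn_gcdl _ _) aN.
  by apply/coprime_Z; rewrite /coprime /g (gcdnC b) -gcdnA (gcdnC d) gcdnA abd.
have p2 := kron_pm1 g0 gNb.
have p1 := jac_pm1 (Z.of_nat (s %/ N)) t.
have tkpart : Z.odd tk = false ->
  (8 | 2 * tk * (1 - jac (Z.of_nat (s %/ N)) t) + 2 * tk * (1 - kron (- Z.of_nat N * Z.of_nat b) (Z.of_nat g))).
  move=> h; have [k ->] : Z.Even tk by apply/Z.even_spec; rewrite -Z.negb_odd h.
  have [e ->] := pm1_even p1; have [f ->] := pm1_even p2.
  by exists (k * (e + f)); ring.
case oa : (odd a).
  have tkp : (8 | 2 * tk * (1 - jac (Z.of_nat (s %/ N)) t) + 2 * tk * (1 - kron (- Z.of_nat N * Z.of_nat b) (Z.of_nat g))).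
    case otk : (Z.odd tk); last exact: tkpart.
    rewrite weight_half //; have [f ->] := pm1_even p2; exists (tk * f); ring.
  rewrite weight_jac_varpi // kron_recip //.
  have [e he] := pm1_pair (jac_pm1 (Z.of_nat (varpi r N)) a) (sgn4_pm1 a (odd_part (varpi r N))).
  have [f hf] := sgn4_mod4 oa (odd_part_odd n0).
  have [h hh] := odd_mul_mod8 oa (weight_at8 oa).
  have [w hw] := weight_psi oa.
  case: tkp => v hv; rewrite hh; rewrite /kap -/tk in hw.
  exists (v + w + e + f + tk * h).
  move: he hf hw hv; clear.
  move: (jac _ _) (jac _ _) (sgn4 _ _) (mod4_sign _) (kron _ _) (psiZ _ _ _ _ _) => J1 J2 S M K Q he hf hw hv.
  lia.
have el : ~~ odd l by rewrite lE oddM oa.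
have om := even_l_odd_m el.
have oN : odd N.
  move: aN; case oN: (odd N) => //; rewrite /coprime => /eqP h.
  have : (2 %| gcdn a N)%N by rewrite dvdn_gcd !dvdn2 oa oN.
  by rewrite h.
have [x8 [e y8]] := m_f_odd om; rewrite -/y in y8.
have [k hk] := kap_odd r oN; rewrite -/y y8 in hk.
have otk : Z.odd tk = false.
  apply/negbTE; rewrite Z.negb_odd; apply/Z.even_spec.
  exists (2 * k + 4 * e - mod4_sign (varpi r N)); move: hk; rewrite /kap -/tk; clear; lia.
have -> : psiZ r N l a b = 0 by rewrite /psiZ (negbTE el) oN.
(* Now [varpi] is odd, and a t = 1 modulo N gives (a t / [varpi]) = 1. *)
have [ow gw jw] := @wprod_jac1r r N (Z.of_nat (a * t)) (divisors N) oN
  ltac:(move=> n nN; have [j hj] : exists j, Z.of_nat (a * t) = 1 + Z.of_nat n * j;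
    [have /dvdnP [i si] := dvdn_trans nN weight_sN; exists (Z.of_nat i * Z.of_nat q);
     rewrite det si Nat2Z.inj_add !Nat2Z.inj_mul; ring
    |rewrite hj gcd_shift Z.gcd_1_l jac_mod ?jac_1 //; [exact: odd_dvd nN oN|exact: dvdn_gt0 nN]]) (fun x h => h).
rewrite -varpiE Nat2Z.inj_mul in ow gw jw.
have cwt : coprime (varpi r N) t by apply: cwN; exact: coprime_dvdl weight_sN weight_st.
have ga : Z.gcd (Z.of_nat a) (Z.of_nat (varpi r N)) = 1 by apply/coprime_Z.
have gt : Z.gcd (Z.of_nat t) (Z.of_nat (varpi r N)) = 1 by apply/coprime_Z; rewrite coprime_sym.
rewrite kron_jac // (@jac_recip (varpi r N) t) //; last by apply/coprime_Z.
move: jw; rewrite jac_mul // => jw.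
have -> : jac (Z.of_nat t) (varpi r N) = jac (Z.of_nat a) (varpi r N).
  have := jac_pm1 (Z.of_nat a) (varpi r N); have := jac_pm1 (Z.of_nat t) (varpi r N).
  by move: jw; move: (jac _ _) (jac _ _) => J1 J2 h; case=> e1; case=> e2; rewrite e1 e2 in h *.
have [i hi] := pm1_pair (jac_pm1 (Z.of_nat a) (varpi r N)) (sgn4_pm1 (varpi r N) t).
have [f hf] := sgn4_mod4 ot (odd_part_odd n0).
have sC : sgn4 t (odd_part (varpi r N)) = sgn4 (varpi r N) t by rewrite odd_part_id // /sgn4 andbC.
rewrite sC in hf.
have [w hw] := tkpart otk.
have tE : Z.of_nat t = 2 * Z.of_nat t./2 + 1 by move: ot; clear; lia.
exists (w + i + f + (k + 2 * e) * Z.of_nat t./2).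
have kE : kap r N = 4 * (k + 2 * e) by move: hk; clear; lia.
move: hi hf hw; have -> : tk = 4 * (k + 2 * e) - 2 * mod4_sign (varpi r N) by rewrite -kE /kap -/tk; ring.
rewrite tE; clear; move: (jac _ _) (jac _ _) (sgn4 _ _) (mod4_sign _) (kron _ _) (Z.of_nat t./2) => J1 J2 S M K T hi hf hw.
lia.
Qed.
End WeightIdentity.

(** * Transversals of Gamma0(N) modulo the subgroup with upper right entry divisible by l *)

Record mat := Mat { ma : Z; mb : Z; mc : Z; md : Z }.

Definition mmul (g h : mat) : mat :=
  Mat (ma g * ma h + mb g * mc h) (ma g * mb h + mb g * md h)
      (mc g * ma h + md g * mc h) (mc g * mb h + md g * md h).
Definition minv (g : mat) : mat := Mat (md g) (- mb g) (- mc g) (ma g).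
Definition mdet (g : mat) : Z := ma g * md g - mb g * mc g.

Definition gam0 (N : nat) (g : mat) : Prop := mdet g = 1 /\ (Z.of_nat N | mc g).

(* [g h^-1] has upper right entry divisible by [l]. *)
Definition coset_eqb (l : nat) (g h : mat) : bool :=
  (mb g * ma h - ma g * mb h) mod Z.of_nat l =? 0.

Lemma coset_eqP l g h : (0 < l)%N ->
  reflect (Z.of_nat l | mb g * ma h - ma g * mb h) (coset_eqb l g h).
Proof.
move=> l0; apply: (iffP idP).
  by move=> /Z.eqb_spec e; apply/Z.mod_divide; lia.
by move=> h1; apply/Z.eqb_spec/Z.mod_divide => //; lia.
Qed.

Lemma coset_eq_sym l g h : (0 < l)%N -> coset_eqb l g h = coset_eqb l h g.
Proof.
move=> l0; apply/coset_eqP/coset_eqP => //.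
  by rewrite -Z.divide_opp_r; have -> : - (mb g * ma h - ma g * mb h) = mb h * ma g - ma h * mb g by ring.
by rewrite -Z.divide_opp_r; have -> : - (mb h * ma g - ma h * mb g) = mb g * ma h - ma g * mb h by ring.
Qed.

Lemma coset_eq_mulr l g h k : mdet k = 1 -> coset_eqb l (mmul g k) (mmul h k) = coset_eqb l g h.
Proof.
move=> d; rewrite /coset_eqb /=; congr (_ mod _ =? 0).
have -> : (ma g * mb k + mb g * md k) * (ma h * ma k + mb h * mc k) -
  (ma g * ma k + mb g * mc k) * (ma h * mb k + mb h * md k) =
  (mb g * ma h - ma g * mb h) * mdet k by rewrite /mdet; ring.
by rewrite d Z.mul_1_r.
Qed.

Lemma mmulVr g h : mdet h = 1 -> mmul (mmul g (minv h)) h = g.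
Proof.
rewrite /mdet; case: g => a b c d; rewrite /mmul /minv /= => e; congr Mat.
- have -> : (a * md h + b * - mc h) * ma h + (a * - mb h + b * ma h) * mc h = a * (ma h * md h - mb h * mc h) by ring.
  by rewrite e Z.mul_1_r.
- have -> : (a * md h + b * - mc h) * mb h + (a * - mb h + b * ma h) * md h = b * (ma h * md h - mb h * mc h) by ring.
  by rewrite e Z.mul_1_r.
- have -> : (c * md h + d * - mc h) * ma h + (c * - mb h + d * ma h) * mc h = c * (ma h * md h - mb h * mc h) by ring.
  by rewrite e Z.mul_1_r.
- have -> : (c * md h + d * - mc h) * mb h + (c * - mb h + d * ma h) * md h = d * (ma h * md h - mb h * mc h) by ring.
  by rewrite e Z.mul_1_r.
Qed.

Lemma mdet_mul g h : mdet (mmul g h) = mdet g * mdet h.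
Proof. by rewrite /mdet /=; ring. Qed.

Lemma gam0_mul N g h : gam0 N g -> gam0 N h -> gam0 N (mmul g h).
Proof.
move=> [d1 c1] [d2 c2]; split; first by rewrite mdet_mul d1 d2.
by apply: Z.divide_add_r; [apply: Z.divide_mul_l|apply: Z.divide_mul_r].
Qed.

Lemma gam0_inv N g : gam0 N g -> gam0 N (minv g).
Proof.
move=> [d1 c1]; split; last by rewrite /=; apply/Z.divide_opp_r.
by rewrite -d1 /mdet /=; ring.
Qed.

Definition transversal (N l : nat) (s : seq mat) : Prop :=
  List.Forall (gam0 N) s /\ forall g, gam0 N g -> count (coset_eqb l g) s = 1%N.

Lemma Csum_cat A (s1 s2 : seq A) F : Csum (s1 ++ s2) F = Cplus (Csum s1 F) (Csum s2 F).
Proof. by elim: s1 => [|x s1 IH] /=; rewrite ?Cplus_0_l // IH Cplus_assoc. Qed.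

Lemma CsumD A (s : seq A) F G : Csum s (fun x => Cplus (F x) (G x)) = Cplus (Csum s F) (Csum s G).
Proof. by elim: s => [|x s IH] /=; [rewrite Cplus_0_l|rewrite IH; ring]. Qed.

Lemma CsumMl A (s : seq A) F c : Csum s (fun x => Cmult c (F x)) = Cmult c (Csum s F).
Proof. by elim: s => [|x s IH] /=; [rewrite Cmult_0_r|rewrite IH; ring]. Qed.

Lemma Csum_map A B (h : B -> A) (t : seq B) F : Csum (map h t) F = Csum t (fun y => F (h y)).
Proof. by elim: t => //= y t ->. Qed.

Lemma Csum_0 A (s : seq A) : Csum s (fun => RtoC 0) = RtoC 0.
Proof. by elim: s => //= x s ->; rewrite Cplus_0_l. Qed.

Lemma Csum_exchange A B (s : seq A) (t : seq B) (F : A -> B -> C) :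
  Csum s (fun x => Csum t (F x)) = Csum t (fun y => Csum s (fun x => F x y)).
Proof.
elim: s => /= [|x s IH]; first by rewrite Csum_0.
by rewrite IH -CsumD.
Qed.

Lemma eq_Csum A (s : seq A) (P : A -> Prop) F G : List.Forall P s -> (forall x, P x -> F x = G x) ->
  Csum s F = Csum s G.
Proof. by move=> h e; elim: h => //= x t px _ ->; rewrite e. Qed.

Lemma eq_Csum_in (A : eqType) (s : seq A) F G : (forall x, x \in s -> F x = G x) ->
  Csum s F = Csum s G.
Proof.
elim: s => //= x s IH h; rewrite h ?mem_head // IH // => y ys.
by apply: h; rewrite inE ys orbT.
Qed.

Lemma Csum_count A (s : seq A) (P : pred A) c :
  Csum s (fun x => if P x then c else RtoC 0) = Cmult (RtoC (INR (count P s))) c.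
Proof.
elim: s => [|x s IH]; first by rewrite /= Cmult_0_l.
rewrite /= IH plus_INR RtoC_plus; case: (P x) => /=; ring.
Qed.

(* Double counting over pairs of representatives of the same coset. *)
Lemma transversal_sum N l s s' (F : mat -> C) : (0 < l)%N -> transversal N l s -> transversal N l s' ->
  (forall g h, gam0 N g -> gam0 N h -> coset_eqb l g h -> F g = F h) -> Csum s F = Csum s' F.
Proof.
move=> l0 [gs cs] [gs' cs'] hF.
transitivity (Csum s (fun g => Csum s' (fun h => if coset_eqb l g h then F g else RtoC 0))).
  by apply: (eq_Csum gs) => g gg; rewrite Csum_count cs' // Cmult_1_l.
rewrite Csum_exchange; apply: (eq_Csum gs') => h gh.
rewrite -[RHS]Cmult_1_l -[RtoC 1]/(RtoC (INR 1)) -(cs h gh) -Csum_count.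
apply: (eq_Csum gs) => g gg; rewrite (coset_eq_sym h) //.
by case: ifP => // e; apply: hF.
Qed.

Lemma Forall_map A B (h : A -> B) (P : B -> Prop) (Q : A -> Prop) s :
  List.Forall Q s -> (forall x, Q x -> P (h x)) -> List.Forall P (map h s).
Proof. by move=> hs hQ; elim: hs => //= x t qx _ IH; constructor; [exact: hQ|]. Qed.

Lemma eq_count_Forall A (s : seq A) (P : A -> Prop) (p q : pred A) : List.Forall P s ->
  (forall x, P x -> p x = q x) -> count p s = count q s.
Proof. by move=> h e; elim: h => //= x t px _ ->; rewrite e. Qed.

(** The relation [coset_eqb] is invariant under right translation, so cosets are permuted. *)
Lemma transversal_mulr N l s k : gam0 N k -> transversal N l s -> transversal N l (map (fun g => mmul g k) s).
Proof.
move=> gk [gs cs]; split; first by apply: Forall_map gs _ => g gg; exact: gam0_mul.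
move=> g gg; rewrite count_map -(cs (mmul g (minv k))); last by apply: gam0_mul => //; exact: gam0_inv.
apply: eq_count => h; rewrite /= -[in LHS](@mmulVr g k) ?coset_eq_mulr //; by case: gk.
Qed.

(* Conjugation of Gamma0(N l) by diag(1, l). *)
Definition conj_down (l : nat) (g : mat) : mat := Mat (ma g) (mb g * Z.of_nat l) (mc g / Z.of_nat l) (md g).

Lemma mmul_row l g h : coset_eqb l g h = ((mb (mmul g (minv h))) mod Z.of_nat l =? 0).
Proof. by rewrite /coset_eqb /=; congr (_ mod _ =? 0); ring. Qed.

Lemma gam0_weak N M g : (N %| M)%N -> gam0 M g -> gam0 N g.
Proof. by move=> /dvdn_Z h [d c]; split=> //; exact: Z.divide_trans h c. Qed.

Lemma count_allpairs A B (f : A -> B -> mat) (p : pred mat) (s : seq A) (t : seq B) :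
  count p [seq f x y | x <- s, y <- t] = sumn (map (fun x => count (fun y => p (f x y)) t) s).
Proof. by elim: s => //= x s IH; rewrite count_cat IH count_map. Qed.

(** If g is in the coset of conj(h) k modulo l1 l2, then g k^-1 has upper right entry divisible by
    l2, which fixes k; conjugating g k^-1 back by diag(1, l2) gives an element of Gamma0(N) whose
    coset modulo l1 fixes h. *)
Lemma transversal_mul N l1 l2 s1 s2 : (0 < N)%N -> (0 < l1)%N -> (0 < l2)%N -> coprime l1 l2 ->
  transversal N l1 s1 -> List.Forall (gam0 (N * l2)) s1 -> transversal N l2 s2 ->
  transversal N (l1 * l2) [seq mmul (conj_down l2 h) g | g <- s2, h <- s1].
Proof.
move=> N0 l10 l20 cop [g1 c1] g1' [g2 c2]; split.
  elim: g2 => //= g s gg _ IH; apply/List.Forall_app; split=> //.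
  apply: Forall_map g1' _ => h gh; apply: gam0_mul => //.
  have [d [k hk]] := gh; rewrite Nat2Z.inj_mul in hk.
  have ck : mc h / Z.of_nat l2 = k * Z.of_nat N.
    by rewrite hk Z.mul_assoc Z.div_mul; lia.
  split; last by exists k.
  by rewrite -d /mdet /= ck hk; ring.
move=> g gg; rewrite count_allpairs.
rewrite -(c2 g gg).
have key k : gam0 N k -> count (fun h => coset_eqb (l1 * l2) g (mmul (conj_down l2 h) k)) s1 = coset_eqb l2 g k :> nat.
  move=> gk; have dk : mdet k = 1 by case: gk.
  pose e := mmul g (minv k).
  have ge : gam0 N e by apply: gam0_mul => //; exact: gam0_inv.
  have gE : g = mmul e k by rewrite mmulVr.
  have -> : coset_eqb l2 g k = (mb e mod Z.of_nat l2 =? 0) by rewrite mmul_row.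
  clearbody e.
  have l12 : (0 < l1 * l2)%N by rewrite muln_gt0 l10.
  have cE h : coset_eqb (l1 * l2) g (mmul (conj_down l2 h) k) =
     ((mb e * ma h - ma e * mb h * Z.of_nat l2) mod Z.of_nat (l1 * l2) =? 0).
    by rewrite gE coset_eq_mulr // /coset_eqb /=; congr (_ mod _ =? 0); ring.
  case: Z.eqb_spec => hb.
    have [beta bE] : (Z.of_nat l2 | mb e) by apply/Z.mod_divide => //; lia.
    pose e' := Mat (ma e) beta (mc e * Z.of_nat l2) (md e).
    have ge' : gam0 N e'.
      have [de ce] := ge; split; last by apply: Z.divide_mul_l.
      by rewrite -de /mdet /= bE; ring.
    rewrite -[RHS](c1 e' ge'); apply: eq_count => h; rewrite cE bE.
    have -> : beta * Z.of_nat l2 * ma h - ma e * mb h * Z.of_nat l2 =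
       Z.of_nat l2 * (mb e' * ma h - ma e' * mb h) by rewrite /=; ring.
    apply/idP/coset_eqP => //.
      move=> /Z.eqb_spec /Z.mod_divide hd; have [i hi] := hd ltac:(lia).
      exists i; apply: (Z.mul_reg_l _ _ (Z.of_nat l2)); first lia.
      by rewrite hi Nat2Z.inj_mul; ring.
    move=> [i ->]; apply/Z.eqb_spec/Z.mod_divide; first lia.
    by exists i; rewrite Nat2Z.inj_mul; ring.
  (* No h matches here: l2 divides the lower left entry of h, so [ma h] is prime to l2, and
     divisibility of [mb e * ma h] by l2 would pass to [mb e]. *)
  rewrite (@eq_count_Forall _ s1 (gam0 (N * l2)) _ pred0 g1') ?count_pred0 // => h [dh [i ci]].
  rewrite cE; apply/negbTE/negP => /Z.eqb_spec /Z.mod_divide hd.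
  have [j hj] := hd ltac:(lia); apply: hb; apply/Z.mod_divide; first lia.
  apply: (@Z_dvd_mul_cancel _ (ma h)).
    apply/Zgcd_1_rel_prime/bezout_rel_prime.
    apply: (Bezout_intro _ _ _ (- mb h * i * Z.of_nat N) (md h)).
    by rewrite -dh /mdet ci Nat2Z.inj_mul; ring.
  exists (j * Z.of_nat l1 + ma e * mb h).
  by rewrite Z.mul_comm; rewrite Nat2Z.inj_mul in hj; lia.
elim: g2 => //= k s gk _ IH; by rewrite key // IH.
Qed.

Definition hecke_index (N l : nat) : seq (nat * nat) :=
  [seq (a, b) | a <- [seq a <- divisors l | coprime a N],
                b <- [seq b <- iota 0 (l %/ a) | gcdn (gcdn a b) (l %/ a) == 1%N]].

Lemma hecke_indexP N l a b : (0 < l)%N ->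
  reflect [/\ (a %| l)%N, coprime a N, (b < l %/ a)%N & gcdn (gcdn a b) (l %/ a) = 1%N]
    ((a, b) \in hecke_index N l).
Proof.
move=> l0; apply: (iffP (@allpairsPdep _ _ _ _ _ _ _)).
  move=> [a' [b' [ha hb [-> ->]]]]; move: ha hb; rewrite !mem_filter mem_iota -dvdn_divisors //.
  by move=> /andP [h1 h2] /andP [/eqP h3 h4].
move=> [h1 h2 h3 h4]; exists a, b; rewrite !mem_filter mem_iota -dvdn_divisors // h1 h2 h4.
by split.
Qed.

Lemma hecke_index_uniq N l : uniq (hecke_index N l).
Proof.
apply: allpairs_uniq_dep.
- by apply: filter_uniq; exact: divisors_uniq.
- by move=> a _; apply: filter_uniq; exact: iota_uniq.
- by move=> [a b] [a' b'] _ _ /= [-> ->].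
Qed.

Lemma Csum_hecke_index N l (F : nat -> nat -> C) :
  Csum (hecke_index N l) (fun p => F p.1 p.2) =
  Csum [seq a <- divisors l | coprime a N] (fun a =>
    Csum [seq b <- iota 0 (l %/ a) | gcdn (gcdn a b) (l %/ a) == 1%N] (fun b => F a b)).
Proof.
rewrite /hecke_index; elim: [seq a <- divisors l | coprime a N] => //= a s IH.
by rewrite Csum_cat IH Csum_map.
Qed.

(** Take u to be the part of a prime to b. A prime p | a dividing b divides neither d nor u; a prime
    p | a not dividing b divides u. The case b = 0, where gcd(a, d) = 1, is covered by u = 1. *)
Lemma coprime_translate (a b d : nat) : (0 < a)%N -> (0 < d)%N -> gcdn (gcdn a b) d = 1%N ->
  exists u, (0 < b + d * u)%N /\ coprime a (b + d * u).
Proof.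
move=> a0 d0 abd; case: (posnP b) => [b0|b0].
  exists 1%N; rewrite b0 muln1 add0n d0; split=> //.
  by rewrite /coprime -abd b0 gcdn0.
exists (a`_(\pi(b)^'))%N; split; first by rewrite addn_gt0 b0.
rewrite /coprime; apply/eqP/eqP; apply/negPn/negP => h.
have g0 : (0 < gcdn a (b + d * a`_(\pi(b)^')))%N by rewrite gcdn_gt0 a0.
have := pdiv_prime (n := gcdn a (b + d * a`_(\pi(b)^'))); set p := pdiv _ => pp.
have {}pp : prime p by apply: pp; lia.
have := pdiv_dvd (gcdn a (b + d * a`_(\pi(b)^'))); rewrite -/p dvdn_gcd => /andP [pa pq].
case pb : (p %| b)%N.
  have : (p %| d * a`_(\pi(b)^'))%N by rewrite -(dvdn_addr _ pb).
  rewrite Euclid_dvdM // => /orP [pd|pu].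
    have : (p %| gcdn (gcdn a b) d)%N by rewrite !dvdn_gcd pa pb pd.
    by rewrite abd dvdn1 => /eqP p1; rewrite p1 in pp.
  have := pnatP _ (part_gt0 _ a) (part_pnat (\pi(b)^') a) p pp pu.
  by rewrite !inE mem_primes pp b0 pb.
move: pq; rewrite dvdn_addl ?pb //; apply: dvdn_mull.
have : (p %| a`_(\pi(b)^') * a`_(\pi(b)))%N by rewrite mulnC partnC.
rewrite Euclid_dvdM // => /orP [//|pu].
have := pnatP _ (part_gt0 _ a) (part_pnat (\pi(b)) a) p pp pu.
by rewrite !inE mem_primes pp b0 pb.
Qed.

(** Bezout for a and M q leaves a free parameter j. It makes s positive, and t odd when a is even (M
    q is odd then); for odd a, t is odd because M is even. *)
Lemma rep_exists (a b d M : nat) : (0 < a)%N -> (0 < d)%N -> gcdn (gcdn a b) d = 1%N -> (0 < M)%N ->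
  coprime a M -> (odd a -> ~~ odd M) ->
  exists u s t, [/\ a * t = 1 + s * (b + d * u), (0 < s), odd t & M %| s]%N.
Proof.
move=> a0 d0 abd M0 cM oM; have [u [q0 cq]] := coprime_translate a0 d0 abd.
exists u; move: (b + d * u)%N q0 cq => q q0 cq {b d d0 abd u}.
have cMq : coprime a (M * q) by rewrite coprimeMr cM.
have [t0 [k0 e0]] : exists t0 k0, (a * t0 = 1 + M * q * k0)%N.
  have [k0 _] := Bezoutl (M * q) a0; rewrite (eqP cMq) => /dvdnP [t0 e].
  by exists t0, k0; rewrite mulnC -e mulnC.
have st j : (a * (t0 + M * q * j) = 1 + M * (k0 + a * j) * q)%N by rewrite mulnDr e0; lia.
case oa : (odd a).
  exists (M * (k0 + a * 1))%N, (t0 + M * q * 1)%N; rewrite st; split=> //.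
  - by rewrite muln_gt0 M0; lia.
  - have : odd (a * (t0 + M * q * 1)) by rewrite st oddD !oddM (negbTE (oM oa)).
    by rewrite oddM => /andP [].
  - exact: dvdn_mulr.
have oMq : odd (M * q) by rewrite -coprime2n; apply: coprime_dvdl cMq; rewrite dvdn2 oa.
pose j := if odd t0 then 2%N else 1%N.
exists (M * (k0 + a * j))%N, (t0 + M * q * j)%N; rewrite st; split=> //.
- by rewrite muln_gt0 M0 addn_gt0 muln_gt0 a0 /j; case: ifP; rewrite orbT.
- by rewrite oddD oddM oMq /j; case: ifP.
- exact: dvdn_mulr.
Qed.

(* The coset representative attached to the triangular matrix (a b; 0 d). *)
Definition is_rep (r : nat -> Z) (N l L a b : nat) (g : mat) : Prop :=
  exists u s t : nat,
    [/\ g = Mat (Z.of_nat a) (Z.of_nat (b + l %/ a * u)) (Z.of_nat s) (Z.of_nat t),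
        (a * t = 1 + s * (b + l %/ a * u))%N, (0 < s)%N /\ odd t,
        (N * m_f r N * L %| s)%N & odd a -> (64 * N %| s)%N].

Lemma m_f_gt0 r N : (0 < m_f r N)%N.
Proof. by apply: dvdn_gt0 (m_f_dvd24 r N). Qed.

Lemma is_rep_exists r N l L a b : (0 < N)%N -> in_Lf r N l -> (0 < L)%N -> coprime l L ->
  (a, b) \in hecke_index N l -> exists g, is_rep r N l L a b g.
Proof.
move=> N0 [l0 [lm _]] L0 cop /(hecke_indexP _ _ _ l0) [al aN bd abd].
have a0 : (0 < a)%N by apply: dvdn_gt0 al.
have d0 : (0 < l %/ a)%N by apply: leq_ltn_trans bd.
have am : coprime a (m_f r N).
  have [i hi] := modn_eq_Z lm; apply/coprime_Z/Zgcd_1_rel_prime/bezout_rel_prime.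
  apply: (Bezout_intro _ _ _ (Z.of_nat (l %/ a)) (- i)).
  by rewrite -{1}(divnK al) Nat2Z.inj_mul in hi; rewrite hi; change (Z.of_nat 1) with 1; ring.
have aL : coprime a L by apply: coprime_dvdl al cop.
(* All divisibility required of s, gathered in one modulus prime to a; this is why 64 is included
   only for odd a. *)
pose M := ((if odd a then 64 else 1) * (N * m_f r N * L))%N.
have M0 : (0 < M)%N by rewrite /M !muln_gt0 N0 L0 m_f_gt0; case: (odd a).
have cM : coprime a M.
  rewrite /M !coprimeMr aN am aL !andbT; case oa : (odd a); last exact: coprimen1.
  by rewrite (coprimeXr 6 (n := 2)) // coprimen2.
have [u [s [t [e s0 ot Ms]]]] := @rep_exists a b (l %/ a) M a0 d0 abd M0 cM
  ltac:(by move=> oa; rewrite /M oa oddM).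
exists (Mat (Z.of_nat a) (Z.of_nat (b + l %/ a * u)) (Z.of_nat s) (Z.of_nat t)), u, s, t; split=> //.
  by apply: dvdn_trans Ms; rewrite /M dvdn_mull.
by move=> oa; apply: dvdn_trans Ms; rewrite /M oa dvdn_pmul2l // -mulnA dvdn_mulr.
Qed.

Lemma is_rep_gam0 r N l L a b g : is_rep r N l L a b g -> gam0 (N * L) g.
Proof.
move=> [u [s [t [-> e _ Ns _]]]]; split.
  have := f_equal Z.of_nat e; rewrite Nat2Z.inj_add !Nat2Z.inj_mul /mdet [ma _]/= [mb _]/= [mc _]/= [md _]/= => ->.
  change (Z.of_nat 1) with 1; ring.
by apply/dvdn_Z; apply: dvdn_trans Ns; rewrite mulnAC dvdn_mulr.
Qed.

(** A coset is read off from the first row of g: a is gcd([ma g], l), and b solves ([ma g] / a) b =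
    [mb g] modulo d. *)
Lemma rep_coset r N l L a b g h : (0 < N)%N -> (0 < l)%N -> gam0 N g -> (a, b) \in hecke_index N l ->
  is_rep r N l L a b h ->
  coset_eqb l g h = ((Z.gcd (ma g) (Z.of_nat l) =? Z.of_nat a) &&
    ((ma g / Z.of_nat a * Z.of_nat b - mb g) mod Z.of_nat (l %/ a) =? 0)).
Proof.
move=> N0 l0 [dg cg] /(hecke_indexP _ _ _ l0) [al aN bd abd] [u [s [t [-> e _ _ _]]]].
set d := (l %/ a)%N; have a0 : (0 < a)%N by apply: dvdn_gt0 al.
have d0 : (0 < d)%N by apply: leq_ltn_trans bd.
have lE : Z.of_nat l = Z.of_nat a * Z.of_nat d by rewrite -{1}(divnK al) Nat2Z.inj_mul Z.mul_comm.
have A0 : Z.of_nat a <> 0 by lia.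
have D0 : Z.of_nat d <> 0 by lia.
have gpq : Z.gcd (ma g) (mb g) = 1.
  by apply/Zgcd_1_rel_prime/bezout_rel_prime/(Bezout_intro _ _ _ (md g) (- mc g)); rewrite -dg /mdet; ring.
have gaq : Z.gcd (Z.of_nat a) (Z.of_nat (b + d * u)) = 1.
  apply/Zgcd_1_rel_prime/bezout_rel_prime/(Bezout_intro _ _ _ (Z.of_nat t) (- Z.of_nat s)).
  have := f_equal Z.of_nat e; rewrite Nat2Z.inj_add !Nat2Z.inj_mul -/d (Z.mul_comm (Z.of_nat t)) => ->.
  change (Z.of_nat 1) with 1; ring.
apply/coset_eqP/andP => //; rewrite [ma (Mat _ _ _ _)]/= [mb (Mat _ _ _ _)]/= -/d.
- rewrite lE => -[k hk].
  have [P hP] : (Z.of_nat a | ma g).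
    apply: (@Z_dvd_mul_cancel _ (Z.of_nat (b + d * u))) => //.
    by exists (mb g - k * Z.of_nat d); lia.
  have hq : mb g = P * Z.of_nat (b + d * u) + k * Z.of_nat d.
    apply: (Z.mul_reg_l _ _ (Z.of_nat a)) => //; rewrite hP in hk; lia.
  have gPd : Z.gcd P (Z.of_nat d) = 1.
    apply/Zgcd_1_rel_prime/bezout_rel_prime.
    have /Zgcd_1_rel_prime /rel_prime_bezout [x y hxy] := gpq.
    apply: (Bezout_intro _ _ _ (x * Z.of_nat a + y * Z.of_nat (b + d * u)) (y * k)).
    by rewrite -hxy hP hq; ring.
  split; apply/Z.eqb_spec.
    by rewrite hP (Z.mul_comm P) Z.gcd_mul_mono_l_nonneg ?gPd; lia.
  apply/Z.mod_divide => //; rewrite hP Z.div_mul // hq.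
  exists (- P * Z.of_nat u - k); rewrite Nat2Z.inj_add Nat2Z.inj_mul; ring.
- move=> [/Z.eqb_spec hg /Z.eqb_spec /Z.mod_divide hd]; have [k hk] := hd D0.
  have [P hP] : (Z.of_nat a | ma g) by rewrite -hg; exact: Z.gcd_divide_l.
  rewrite hP Z.div_mul // in hk; rewrite hP lE.
  exists (- k - P * Z.of_nat u); rewrite Nat2Z.inj_add Nat2Z.inj_mul.
  have -> : mb g = P * Z.of_nat b - k * Z.of_nat d by lia.
  ring.
Qed.

Lemma count_unique (T : eqType) (s : seq T) (p : pred T) x : uniq s -> x \in s -> p x ->
  (forall y, y \in s -> p y -> y = x) -> count p s = 1%N.
Proof.
move=> us xs px hu; have <- : count_mem x s = 1%N by rewrite count_uniq_mem // xs.
apply: eq_in_count => y ys /=; apply/idP/eqP => [|->//]; exact: hu.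
Qed.

(** Given g, put a = gcd([ma g], l) and P = [ma g] / a. Then P is invertible modulo d = l/a, so
    exactly one b in [0, d) satisfies the criterion of [rep_coset]. *)
Lemma rep_transversal r N l L (ga : nat * nat -> mat) : (0 < N)%N -> (0 < l)%N ->
  (forall p, p \in hecke_index N l -> is_rep r N l L p.1 p.2 (ga p)) ->
  transversal N l (map ga (hecke_index N l)).
Proof.
move=> N0 l0 hga.
have allP : forall s : seq (nat * nat), {subset s <= hecke_index N l} -> List.Forall (gam0 N) (map ga s).
  elim=> //= p s IH sub; constructor; last by apply: IH => x xs; apply: sub; rewrite inE xs orbT.
  apply: (@gam0_weak N (N * L)); first exact: dvdn_mulr.
  by apply: is_rep_gam0 (hga _ (sub _ (mem_head _ _))).
split; first exact: allP.
move=> g gg; rewrite count_map; have [dg [cN hcN]] := gg.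
pose a := Z.to_nat (Z.gcd (ma g) (Z.of_nat l)).
have aE : Z.of_nat a = Z.gcd (ma g) (Z.of_nat l) by rewrite Z2Nat.id //; exact: Z.gcd_nonneg.
have al : (a %| l)%N by apply/dvdn_Z; rewrite aE; exact: Z.gcd_divide_r.
have a0 : (0 < a)%N by apply: dvdn_gt0 al.
set d := (l %/ a)%N.
have d0 : (0 < d)%N by rewrite /d divn_gt0 // dvdn_leq.
have lE : Z.of_nat l = Z.of_nat a * Z.of_nat d by rewrite -{1}(divnK al) Nat2Z.inj_mul Z.mul_comm.
have [P hP] : (Z.of_nat a | ma g) by rewrite aE; exact: Z.gcd_divide_l.
have gPd : Z.gcd P (Z.of_nat d) = 1.
  apply: (Z.mul_reg_l _ _ (Z.of_nat a)); first lia.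
  by rewrite -Z.gcd_mul_mono_l_nonneg ?(Z.mul_comm _ P) -?hP -?lE ?aE; lia.
have [x y hxy] := rel_prime_bezout _ _ (proj1 (Zgcd_1_rel_prime _ _) gPd).
(* Here x is an inverse of P modulo d. *)
pose b := Z.to_nat ((x * mb g) mod Z.of_nat d).
have bb := Z.mod_pos_bound (x * mb g) (Z.of_nat d) ltac:(lia).
have [k hk] : exists k, Z.of_nat b = x * mb g + Z.of_nat d * k.
  exists (- ((x * mb g) / Z.of_nat d)); rewrite Z2Nat.id; last by case: bb.
  by rewrite Z.mod_eq; lia.
have bd : (b < d)%N by rewrite /b; move: bb; move: (_ mod _) => w; lia.
have hq : mb g = P * Z.of_nat b + Z.of_nat d * (y * mb g - P * k).
  rewrite hk; have -> : P * (x * mb g + Z.of_nat d * k) + Z.of_nat d * (y * mb g - P * k)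
    = (x * P + y * Z.of_nat d) * mb g by ring.
  by rewrite hxy Z.mul_1_l.
have inI : (a, b) \in hecke_index N l.
  apply/hecke_indexP => //; split=> //.
    apply/coprime_Z/Zgcd_1_rel_prime/bezout_rel_prime/(Bezout_intro _ _ _ (P * md g) (- mb g * cN)).
    by rewrite -dg /mdet hP hcN; ring.
  have pr : rel_prime (ma g) (mb g).
    by apply: bezout_rel_prime; apply: (Bezout_intro _ _ _ (md g) (- mc g)); rewrite -dg /mdet; ring.
  set w := gcdn _ _; have w1 : (Z.of_nat w | 1).
    have wa : (Z.of_nat w | Z.of_nat a) by apply/dvdn_Z; apply: dvdn_trans (dvdn_gcdl _ _) (dvdn_gcdl _ _).
    have wb : (Z.of_nat w | Z.of_nat b) by apply/dvdn_Z; apply: dvdn_trans (dvdn_gcdl _ _) (dvdn_gcdr _ _).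
    have wd : (Z.of_nat w | Z.of_nat d) by apply/dvdn_Z; exact: dvdn_gcdr.
    case: pr => _ _ hw; apply: hw; first by rewrite hP; apply: Z.divide_mul_r.
    by rewrite hq; apply: Z.divide_add_r; [apply: Z.divide_mul_r|apply: Z.divide_mul_l].
  by move/Z.divide_1_r_nonneg: w1 => h; have := h ltac:(lia); lia.
apply: (count_unique (x := (a, b))) => //; first exact: hecke_index_uniq.
  rewrite /= (rep_coset N0 l0 gg inI (hga _ inI)) aE Z.eqb_refl /=.
  apply/Z.eqb_spec/Z.mod_divide; first lia.
  rewrite -aE hP Z.div_mul; last lia.
  by exists (- (y * mb g - P * k)); rewrite {1}hq -/d; ring.
move=> [a' b'] inI' /=; rewrite (rep_coset N0 l0 gg inI' (hga _ inI')) => /andP [/Z.eqb_spec ha /Z.eqb_spec hb].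
have aa : a' = a by lia.
rewrite aa in inI' hb *; congr pair.
move/Z.mod_divide: hb; rewrite hP Z.div_mul; last lia.
move=> h; have [j hj] := h ltac:(lia).
have /(hecke_indexP _ _ _ l0) [_ _ bd' _] := inI'.
have [i hi] : (Z.of_nat d | Z.of_nat b' - Z.of_nat b).
  apply: (@Z_dvd_mul_cancel _ P); first by rewrite Z.gcd_comm.
  by exists (j + (y * mb g - P * k)); rewrite -/d in hj; lia.
rewrite -/d in bd'; have : i = 0 by nia.
lia.
Qed.

(** * Square roots, powers and the action on the upper half plane *)

Lemma C_ext (z w : C) : fst z = fst w -> snd z = snd w -> z = w.
Proof. by case: z; case: w => a b c d /= -> ->. Qed.

Lemma Cpow_nat_neq0 z n : z <> RtoC 0 -> Cpow_nat z n <> RtoC 0.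
Proof. by move=> z0; elim: n => [|n IH] /=; [exact: C1_nz|exact: Cmult_neq_0]. Qed.

Lemma Cinv_neq0 z : z <> RtoC 0 -> Cinv z <> RtoC 0.
Proof.
move=> z0 h; have := Cinv_r z z0; rewrite h Cmult_0_r => e.
by apply: C1_nz.
Qed.

Lemma CpowZ_neq0 z n : z <> RtoC 0 -> CpowZ z n <> RtoC 0.
Proof.
move=> z0; case: n => [|p|p] /=; [exact: C1_nz|exact: Cpow_nat_neq0|].
by apply: Cinv_neq0; exact: Cpow_nat_neq0.
Qed.

Lemma CinvK z : z <> RtoC 0 -> Cinv (Cinv z) = z.
Proof. by move=> z0; field. Qed.

Lemma CpowZ_opp z n : z <> RtoC 0 -> CpowZ z (- n) = Cinv (CpowZ z n).
Proof.
move=> z0; case: n => [|p|p] //=; first by field; exact: C1_nz.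
by rewrite CinvK //; exact: Cpow_nat_neq0.
Qed.

Lemma CpowZ_mul z w n : z <> RtoC 0 -> w <> RtoC 0 -> CpowZ (Cmult z w) n = Cmult (CpowZ z n) (CpowZ w n).
Proof.
move=> z0 w0; have pm k : Cpow_nat (Cmult z w) k = Cmult (Cpow_nat z k) (Cpow_nat w k).
  by elim: k => [|k IH] /=; [rewrite Cmult_1_l|rewrite IH; ring].
case: n => [|p|p] /=; first by rewrite Cmult_1_l.
  exact: pm.
by rewrite pm; field; split; exact: Cpow_nat_neq0.
Qed.

Lemma CpowZ_sqrt (a : R) (n : Z) : (0 < a)%R -> CpowZ (RtoC (sqrt a)) n = RtoC (Rpower a (IZR n / 2)).
Proof.
move=> a0; have s0 := sqrt_lt_R0 _ a0.
have pn k : Cpow_nat (RtoC (sqrt a)) k = RtoC (Rpower a (INR k / 2)).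
  elim: k => [|k IH].
    by rewrite /= (_ : 0 / 2 = 0)%R ?Rpower_O //; field.
  rewrite [Cpow_nat _ _]/= IH -RtoC_mult -{1}(Rpower_sqrt a a0) -Rpower_plus S_INR.
  by congr RtoC; congr Rpower; field.
case: n => [|p|p].
- by rewrite [CpowZ _ _]/= (_ : IZR 0 / 2 = 0)%R ?Rpower_O //; field.
- by rewrite [CpowZ _ _]/= pn INR_IZR_INZ positive_nat_Z.
rewrite [CpowZ _ _]/= pn INR_IZR_INZ positive_nat_Z -Pos2Z.opp_pos opp_IZR.
rewrite (_ : - IZR (Z.pos p) / 2 = - (IZR (Z.pos p) / 2))%R; last by field.
by rewrite Rpower_Ropp RtoC_inv //; apply: Rgt_not_eq; exact: exp_pos.
Qed.

Lemma Cmod_sqr (x y : R) : (Cmod (x, y) * Cmod (x, y) = x * x + y * y)%R.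
Proof. by rewrite /Cmod sqrt_sqrt /=; [ring|nra]. Qed.

Lemma csqrt_sqr z : Cmult (csqrt z) (csqrt z) = z.
Proof.
case: z => x y; rewrite /csqrt [fst (x, y)]/= [snd (x, y)]/=.
have m0 := Cmod_ge_0 (x, y); have mm := Cmod_sqr x y.
set m := Cmod (x, y) in m0 mm *.
have h1 : (0 <= (m + x) / 2)%R by nra.
have h2 : (0 <= (m - x) / 2)%R by nra.
have s1 := sqrt_sqrt _ h1; have s2 := sqrt_sqrt _ h2.
have p1 := sqrt_pos ((m + x) / 2); have p2 := sqrt_pos ((m - x) / 2).
set A := sqrt ((m + x) / 2) in s1 p1 *; set B := sqrt ((m - x) / 2) in s2 p2 *.
have ab : ((2 * (A * B)) * (2 * (A * B)) = y * y)%R.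
  transitivity (4 * (A * A) * (B * B))%R; first by ring.
  by rewrite s1 s2; lra.
have ab0 : (0 <= 2 * (A * B))%R by nra.
by case: Rle_dec => hy; apply: C_ext; rewrite /=; nra.
Qed.

(** Of two opposite square roots only one lies in the right half plane completed by the nonnegative
    imaginary axis, so identities for [csqrt] may be checked by squaring. *)
Lemma csqrt_unique (v z : C) : Cmult v v = z -> (0 < fst v \/ (fst v = 0 /\ 0 <= snd v))%R -> csqrt z = v.
Proof.
case: v => p q <- /= hv; rewrite /csqrt /Cmult /=.
have -> : Cmod (p * p - q * q, p * q + q * p)%R = (p * p + q * q)%R.
  rewrite /Cmod /= (_ : _ + _ = (p * p + q * q) * (p * p + q * q))%R; last by ring.
  by rewrite sqrt_square //; nra.
have -> : ((p * p + q * q + (p * p - q * q)) / 2 = p * p)%R by field.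
have -> : ((p * p + q * q - (p * p - q * q)) / 2 = q * q)%R by field.
rewrite sqrt_square; last by lra.
congr pair; case: Rle_dec => h /=.
  have q0 : (0 <= q)%R by case: hv => [hp|[]//]; nra.
  by rewrite sqrt_square //; ring.
have q0 : (q <= 0)%R by case: hv => [hp|[hp hq]]; [nra|rewrite hp in h; lra].
rewrite (_ : q * q = (- q) * (- q))%R; last by ring.
by rewrite sqrt_square; [ring|lra].
Qed.

Lemma csqrt_half z : (0 < fst (csqrt z) \/ (fst (csqrt z) = 0 /\ 0 <= snd (csqrt z)))%R.
Proof.
case: z => x y; rewrite /csqrt [fst (x, y)]/= [snd (x, y)]/= /=.
have m0 := Cmod_ge_0 (x, y); have mm := Cmod_sqr x y.
set m := Cmod (x, y) in m0 mm *.
have h1 : (0 <= (m + x) / 2)%R by nra.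
case: (Rle_lt_or_eq_dec _ _ (sqrt_pos ((m + x) / 2))) => h; first by left.
right; split=> //; have e : ((m + x) / 2 = 0)%R by apply: sqrt_eq_0.
have y0 : (y = 0)%R by nra.
case: Rle_dec => hy /=; last by lra.
by have := sqrt_pos ((m - x) / 2); lra.
Qed.

Lemma csqrt_neq0 z : z <> RtoC 0 -> csqrt z <> RtoC 0.
Proof. by move=> z0 h; apply: z0; rewrite -(csqrt_sqr z) h Cmult_0_l. Qed.

Lemma csqrt_scale (a : R) z : (0 < a)%R -> csqrt (Cmult (RtoC a) z) = Cmult (RtoC (sqrt a)) (csqrt z).
Proof.
move=> a0; have s0 := sqrt_lt_R0 _ a0; apply: csqrt_unique.
  have -> : Cmult (Cmult (RtoC (sqrt a)) (csqrt z)) (Cmult (RtoC (sqrt a)) (csqrt z))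
     = Cmult (Cmult (RtoC (sqrt a)) (RtoC (sqrt a))) (Cmult (csqrt z) (csqrt z)) by ring.
  by rewrite csqrt_sqr -RtoC_mult sqrt_sqrt; [|lra].
have := csqrt_half z; case: (csqrt z) => p q /=; rewrite !Rmult_0_l Rminus_0_r Rplus_0_r.
case=> [h|[h1 h2]]; [left|right]; first by nra.
by rewrite h1 Rmult_0_r; split=> //; nra.
Qed.

Lemma csqrt_1 : csqrt (RtoC 1) = RtoC 1.
Proof. by apply: csqrt_unique; [rewrite Cmult_1_l|left; rewrite /=; lra]. Qed.

Definition den (g : mat) (t : C) : C := Cplus (Cmult (RtoC (IZR (mc g))) t) (RtoC (IZR (md g))).
Definition numer (g : mat) (t : C) : C := Cplus (Cmult (RtoC (IZR (ma g))) t) (RtoC (IZR (mb g))).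
Definition act (g : mat) (t : C) : C := mobius (ma g) (mb g) (mc g) (md g) t.

Lemma actE g t : act g t = Cdiv (numer g t) (den g t).
Proof. by []. Qed.

Lemma den_neq0 g t : mdet g <> 0 -> Hp t -> den g t <> RtoC 0.
Proof.
case: t => x y; rewrite /Hp /= => dg y0 h.
have /= h1 := f_equal fst h; have /= h2 := f_equal snd h.
have c0 : IZR (mc g) = 0%R by nra.
have d0 : IZR (md g) = 0%R by rewrite c0 in h1; lra.
by apply: dg; rewrite /mdet (eq_IZR _ _ c0) (eq_IZR _ _ d0); ring.
Qed.

Lemma Im_act g t : mdet g <> 0 -> Hp t ->
  (snd (act g t) = IZR (mdet g) * snd t / (Cmod (den g t) * Cmod (den g t)))%R.
Proof.
move=> dg ht; have dn := den_neq0 dg ht.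
rewrite actE /Cdiv /Cinv /=; case: t ht dn => x y ht dn.
have e := Cmod_sqr (fst (den g (x, y))) (snd (den g (x, y))); rewrite -surjective_pairing in e.
have m0 : (0 < Cmod (den g (x, y)))%R by apply/Cmod_gt_0.
rewrite !Rmult_1_r e; move: e m0.
rewrite /den /numer /mdet minus_IZR !mult_IZR /=; move: (Cmod _) => M e m0.
by field; nra.
Qed.

Lemma Hp_act g t : 0 < mdet g -> Hp t -> Hp (act g t).
Proof.
move=> dg ht; rewrite /Hp Im_act //; last lia.
have m0 : (0 < Cmod (den g t))%R by apply/Cmod_gt_0; apply: den_neq0 => //; lia.
have d0 : (0 < IZR (mdet g))%R by apply: IZR_lt.
rewrite /Hp in ht; apply: Rdiv_lt_0_compat; nra.
Qed.

Lemma den_mul g h t : mdet h <> 0 -> Hp t -> den (mmul g h) t = Cmult (den g (act h t)) (den h t).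
Proof.
move=> dh ht; have dn := den_neq0 dh ht; rewrite actE /den /numer /= in dn *.
rewrite !plus_IZR !mult_IZR !RtoC_plus !RtoC_mult; field => //.
Qed.

Lemma act_mul g h t : 0 < mdet g -> 0 < mdet h -> Hp t -> act (mmul g h) t = act g (act h t).
Proof.
move=> dg dh ht; have hh := Hp_act dh ht.
have dn : den h t <> RtoC 0 by apply: den_neq0 => //; lia.
have dn2 : den g (act h t) <> RtoC 0 by apply: den_neq0 => //; lia.
rewrite [act _ t]actE [RHS]actE den_mul //; last lia.
have -> : numer (mmul g h) t = Cmult (numer g (act h t)) (den h t).
  rewrite actE /den /numer /= in dn *.
  rewrite !plus_IZR !mult_IZR !RtoC_plus !RtoC_mult; field => //.
by field; split.
Qed.

(** * The quotients f(g t / l) / f(g t) *)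

Lemma eta_char_T r N (j : Z) : (0 < N)%N -> eta_char r N 1 j 0 1 true = em (j * xN r N).
Proof.
move=> N0; rewrite /eta_char.
have -> : CpowZ (sgnC true) (- twok r N) = RtoC 1.
  have p1 n : Cpow_nat (RtoC 1) n = RtoC 1 by elim: n => //= n ->; rewrite Cmult_1_l.
  rewrite /sgnC /CpowZ; case: (- _) => //= p; rewrite p1 //.
  by apply: injective_projections => /=; field.
rewrite Cmult_1_l /em; congr eR.
rewrite (_ : foldr _ _ _ = IZR (j * xN r N)); first by field.
rewrite /xN; elim: (divisors N) => [|n s IH]; first by rewrite Z.mul_0_r.
rewrite Zsum_cons [foldr _ _ _]/= IH Zdiv_0_l /Psi /= -mult_IZR -plus_IZR; congr IZR; ring.
Qed.

Definition over_l (l : nat) (t : C) : C := Cdiv t (RtoC (INR l)).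

Definition tri_act (a b d : nat) (t : C) : C :=
  Cdiv (Cplus (Cmult (RtoC (INR a)) t) (RtoC (INR b))) (RtoC (INR d)).

Lemma RtoC_neq0 x : (x <> 0)%R -> RtoC x <> RtoC 0.
Proof. by move=> h /RtoC_inj. Qed.

Lemma INR_neq0 n : (0 < n)%N -> RtoC (INR n) <> RtoC 0.
Proof. by move=> n0; apply: RtoC_neq0; have := lt_0_INR n ltac:(lia); lra. Qed.

Lemma Hp_tri a b d t : (0 < a)%N -> (0 < d)%N -> Hp t -> Hp (tri_act a b d t).
Proof.
move=> a0 d0 ht; have := @Hp_act (Mat (Z.of_nat a) (Z.of_nat b) 0 (Z.of_nat d)) t.
rewrite /mdet; cbn [ma mb mc md]; rewrite Z.mul_0_r Z.sub_0_r => /(_ ltac:(lia) ht).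
rewrite /act /mobius /tri_act; cbn [ma mb mc md]; rewrite -!INR_IZR_INZ.
by rewrite (_ : Cplus (Cmult (RtoC 0) t) (RtoC (INR d)) = RtoC (INR d)); last ring.
Qed.

Lemma Hp_over l t : (0 < l)%N -> Hp t -> Hp (over_l l t).
Proof.
move=> l0 ht; have := Hp_tri 0 (isT : (0 < 1)%N) l0 ht.
by rewrite /tri_act /= Cmult_1_l Cplus_0_r.
Qed.

Lemma Hp_shift t (x : R) : Hp t -> Hp (Cplus t (RtoC x)).
Proof. by rewrite /Hp /= Rplus_0_r. Qed.

Lemma eq_Csum_pair (s : seq (nat * nat)) (F G : nat * nat -> C) :
  (forall a b : nat, (a, b) \in s -> F (a, b) = G (a, b)) -> Csum s F = Csum s G.
Proof.
elim: s => //= -[a b] s IH h; rewrite h ?mem_head // IH // => a' b' ys.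
by apply: h; rewrite inE ys orbT.
Qed.

Section HeckeOperator.
Variables (r : nat -> Z) (N : nat) (f : C -> C).
Hypotheses (N0 : (0 < N)%N) (fnz : forall t, Hp t -> f t <> RtoC 0)
  (ftr : transforms N (twok r N) (eta_char r N) f).

Lemma f_act g t : gam0 N g -> Hp t -> f (act g t) =
  Cmult (Cmult (eta_char r N (ma g) (mb g) (mc g) (md g) true) (CpowZ (csqrt (den g t)) (twok r N))) (f t).
Proof.
move=> [dg cg] ht; have := ftr true dg cg ht.
have dn : csqrt (den g t) <> RtoC 0 by apply: csqrt_neq0; apply: den_neq0 => //; rewrite dg.
rewrite /slash -/(den g t) -/(act g t) /sgnC Cmult_1_l CpowZ_opp // => e.
have pn := @CpowZ_neq0 _ (twok r N) dn.
rewrite -[LHS]Cmult_1_l -(Cinv_r _ pn) -Cmult_assoc e; ring.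
Qed.

Lemma f_shift (j : Z) t : Hp t -> f (Cplus t (RtoC (IZR j))) = Cmult (em (j * xN r N)) (f t).
Proof.
move=> ht; have g1 : gam0 N (Mat 1 j 0 1).
  by split; [rewrite /mdet; cbn [ma mb mc md]; ring|exact: Z.divide_0_r].
have := f_act g1 ht; rewrite eta_char_T //.
have -> : den (Mat 1 j 0 1) t = RtoC 1 by rewrite /den /=; ring.
have -> : act (Mat 1 j 0 1) t = Cplus t (RtoC (IZR j)).
  by rewrite /act /mobius /= (_ : Cplus (Cmult (RtoC 0) t) (RtoC 1) = RtoC 1); [field|ring].
rewrite csqrt_1 => ->; congr (Cmult _ _).
have -> : CpowZ (RtoC 1) (twok r N) = RtoC 1.
  have p1 n : Cpow_nat (RtoC 1) n = RtoC 1 by elim: n => //= n ->; rewrite Cmult_1_l.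
  rewrite /CpowZ; case: (twok r N) => //= p; rewrite p1 //.
  by apply: injective_projections => /=; field.
by rewrite Cmult_1_r.
Qed.

Variable l : nat.
Hypothesis lL : in_Lf r N l.

Lemma l_gt0 : (0 < l)%N.
Proof. by case: lL. Qed.

Lemma l_minus1_x : (24 | (Z.of_nat l - 1) * xN r N).
Proof.
case: lL => _ [/modn_eq_Z [i ->] _]; have [k hk] := m_f_x r N.
by exists (i * k); rewrite -Z.mul_assoc -hk; ring.
Qed.

Lemma l_minus1_y : (24 | (Z.of_nat l - 1) * yN r N).
Proof.
case: lL => _ [/modn_eq_Z [i ->] _]; have [k hk] := m_f_y r N.
by exists (i * k); rewrite -Z.mul_assoc -hk; ring.
Qed.

Lemma em_lx j : em (j * Z.of_nat l * xN r N) = em (j * xN r N).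
Proof.
apply: em_mod; have [k hk] := l_minus1_x; exists (j * k).
have -> : j * Z.of_nat l * xN r N - j * xN r N = j * ((Z.of_nat l - 1) * xN r N) by ring.
by rewrite hk; ring.
Qed.

(** Conjugation by diag(1, l) moves a factor l from the upper right to the lower left entry. As l =
    1 modulo m_f, the parts with x_N and y_N do not change modulo 24. The symbols change by (l /
    d)^(2k), which is 1 because 2k is even or l is a square. *)
Lemma eta_char_conj (a b : Z) (c d : nat) : (0 < c)%N -> (N %| c)%N -> odd d ->
  a * Z.of_nat d - b * Z.of_nat l * Z.of_nat c = 1 ->
  eta_char r N a b (Z.of_nat (c * l)) (Z.of_nat d) true =
  eta_char r N a (b * Z.of_nat l) (Z.of_nat c) (Z.of_nat d) true.
Proof.
move=> c0 Nc od det; have l0 := l_gt0.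
rewrite !eta_char_val //; last first.
- by rewrite Nat2Z.inj_mul -det; ring.
- exact: dvdn_mulr.
- by rewrite muln_gt0 c0.
have cE : ((c %/ N) * N = c)%N by rewrite divnK.
have clE : ((c %/ N * l) * N = c * l)%N by rewrite mulnAC cE.
have gl : Z.gcd (Z.of_nat l) (Z.of_nat d) = 1.
  by apply/Zgcd_1_rel_prime/bezout_rel_prime/(Bezout_intro _ _ _ (- b * Z.of_nat c) a); rewrite -det; ring.
have gc : Z.gcd (Z.of_nat c) (Z.of_nat d) = 1.
  by apply/Zgcd_1_rel_prime/bezout_rel_prime/(Bezout_intro _ _ _ (- b * Z.of_nat l) a); rewrite -det; ring.
have cd : coprime c d by apply/coprime_Z.
have ld : coprime l d by apply/coprime_Z.
have gs : Z.gcd (Z.of_nat (c %/ N)) (Z.of_nat d) = 1.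
  by apply/coprime_Z; apply: coprime_dvdl cd; rewrite -{2}cE dvdn_mulr.
have [[i hi] _] := @jac_wprod_split r N (c %/ N) d (divisors N) N0 od
  ltac:(by rewrite cE) (fun x h => h).
have [[j hj] _] := @jac_wprod_split r N (c %/ N * l) d (divisors N) N0 od
  ltac:(by rewrite clE coprimeMl cd ld) (fun x h => h).
rewrite cE in hi; rewrite clE in hj.
have clN : ((c * l) %/ N = c %/ N * l)%N by rewrite -clE mulnK.
rewrite clN; rewrite Nat2Z.inj_mul jac_mul // in hj; rewrite Nat2Z.inj_mul.
have [k hk] : (4 | Zsum (divisors N) r * (1 - jac (Z.of_nat l) d)).
  have [e he] := pm1_even (jac_pm1 (Z.of_nat l) d).
  case otk : (Z.odd (twok r N)).
    case: lL => _ [_ /(_ otk) [t lt]]; exists 0; rewrite lt Nat2Z.inj_mul jac_sq //.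
      by rewrite Z.sub_diag Z.mul_0_r.
    by move: gl; rewrite lt Nat2Z.inj_mul Z.gcd_comm => /gcd_mul_l; rewrite Z.gcd_comm.
  have [w hw] : Z.Even (twok r N) by apply/Z.even_spec; rewrite -Z.negb_odd otk.
  by exists (w * e); rewrite -/(twok r N) hw he; ring.
have [v hv] := l_minus1_x; have [w hw] := l_minus1_y.
apply: em_mod; move: (Zprod _ _) (Zprod _ _) hi hj => P1 P2 hi hj.
have p3 := jac_pm1 (Z.of_nat (c %/ N)) d.
move: (jac (Z.of_nat l) d) (jac (Z.of_nat (c %/ N)) d) (jac (Z.of_nat (wprod _ _ _)) d) p3 hi hj hk
  => Jl Js Jw p3 hi hj hk.
exists (Z.of_nat (c %/ N) * (a * (1 - Z.of_nat d * Z.of_nat d) - Z.of_nat d) * w - b * Z.of_nat d * v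
        + j - i + Js * k).
have e1 : P2 - P1 = 4 * j - 4 * i + Js * (4 * k).
  have -> : 4 * k = Zsum (divisors N) r * (1 - Jl) by lia.
  lia.
have e2 : Z.of_nat (c %/ N) * Z.of_nat l * yN r N = Z.of_nat (c %/ N) * yN r N + Z.of_nat (c %/ N) * (w * 24).
  by rewrite -hw; ring.
have e3 : b * Z.of_nat l * Z.of_nat d * xN r N = b * Z.of_nat d * xN r N + b * Z.of_nat d * (v * 24).
  by rewrite -hv; ring.
rewrite e2 e3; lia.
Qed.

(** The conjugated matrix (a b; c l d) sends t/l to (g t)/l with the same automorphy factor as g at
    t, and by [eta_char_conj] with the same multiplier. *)
Lemma quot_inv_pos (a b : Z) (c d : nat) t : (0 < c)%N -> (N %| c)%N -> odd d ->
  a * Z.of_nat d - b * Z.of_nat l * Z.of_nat c = 1 -> Hp t ->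
  let g := Mat a (b * Z.of_nat l) (Z.of_nat c) (Z.of_nat d) in
  Cmult (f (over_l l (act g t))) (f t) = Cmult (f (over_l l t)) (f (act g t)).
Proof.
move=> c0 Nc od det ht g; have l0 := l_gt0.
pose g' := Mat a b (Z.of_nat (c * l)) (Z.of_nat d).
have gg : gam0 N g by split; [exact: det|apply/dvdn_Z].
have gg' : gam0 N g'.
  split; last by apply/dvdn_Z; exact: dvdn_mulr.
  by rewrite -det /mdet /= Nat2Z.inj_mul; ring.
have dE : den g' (over_l l t) = den g t.
  rewrite /den /over_l /= Nat2Z.inj_mul mult_IZR -INR_IZR_INZ -(INR_IZR_INZ l) RtoC_mult.
  by field; exact: INR_neq0 l_gt0.
have aE : act g' (over_l l t) = over_l l (act g t).
  rewrite !actE dE /numer /over_l /= mult_IZR -(INR_IZR_INZ l) RtoC_mult; field; split; last exact: INR_neq0 l_gt0.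
  by apply: den_neq0 => //; case: gg => ->.
rewrite -aE (f_act gg' (Hp_over l_gt0 ht)) (f_act gg ht) dE /= eta_char_conj //; ring.
Qed.

Lemma odd_pos_shift (d : Z) (c : nat) : (0 < c)%N -> (~~ odd c -> Z.odd d) ->
  exists j, 0 < d + Z.of_nat c * j /\ Z.odd (d + Z.of_nat c * j).
Proof.
move=> c0 h; have [e [he oe]] : exists e, (e = 0 \/ e = 1) /\ Z.odd (d + Z.of_nat c * e).
  case od : (Z.odd d); first by exists 0; rewrite Z.mul_0_r Z.add_0_r; split=> //; left.
  exists 1; split; first by right.
  rewrite Z.odd_add od Z.odd_mul -odd_Z_of_nat; case oc : (odd c) => //.
  by move: h; rewrite oc od => /(_ isT).
exists (2 * Z.abs d + e); split.
  have d0 : e = 0 -> d <> 0 by move=> e0 d0; move: oe; rewrite e0 d0 Z.mul_0_r.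
  nia.
have -> : d + Z.of_nat c * (2 * Z.abs d + e) = d + Z.of_nat c * e + 2 * (Z.of_nat c * Z.abs d) by ring.
by rewrite Z.odd_add Z.odd_mul oe.
Qed.

(* By translations and a change of sign we may assume that c > 0 and that d is odd and positive. *)
Lemma quot_inv g t : gam0 N g -> (Z.of_nat l | mb g) -> Hp t ->
  Cmult (f (over_l l (act g t))) (f t) = Cmult (f (over_l l t)) (f (act g t)).
Proof.
have l0 := l_gt0.
have pos : forall g t, gam0 N g -> (Z.of_nat l | mb g) -> Hp t -> 0 < mc g ->
  Cmult (f (over_l l (act g t))) (f t) = Cmult (f (over_l l t)) (f (act g t)).
  move=> {}g {}t gg [b hb] ht cp; case: gg => det [k hk].
  pose c := Z.to_nat (mc g); have cE : Z.of_nat c = mc g by rewrite Z2Nat.id; lia.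
  have c0 : (0 < c)%N by lia.
  have Nc : (N %| c)%N by apply/dvdn_Z; rewrite cE; exists k.
  (* Replacing t by t - l j adds c l j to d and keeps the upper right entry divisible by l. If c l
     is even, d is already odd by the determinant. *)
  have [||j [dp od]] := @odd_pos_shift (md g) (c * l).
  - by rewrite muln_gt0 c0.
  - move=> ecl; apply/negPn/negP => ed; have : Z.odd (mdet g) = true by rewrite det.
    rewrite /mdet hb -cE Z.odd_sub !Z.odd_mul (negbTE ed) andbF /= -!odd_Z_of_nat -andbA -oddM (mulnC l).
    by rewrite (negbTE ecl) andbF.
  pose d := Z.to_nat (md g + Z.of_nat (c * l) * j).
  have dE : Z.of_nat d = md g + Z.of_nat (c * l) * j by rewrite Z2Nat.id; lia.
  have odd_d : odd d by rewrite odd_Z_of_nat dE.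
  have det' : ma g * Z.of_nat d - (b + ma g * j) * Z.of_nat l * Z.of_nat c = 1.
    by rewrite -det /mdet hb -cE dE Nat2Z.inj_mul; ring.
  set lj := (- (Z.of_nat l * j)).
  pose t' := Cplus t (RtoC (IZR lj)).
  have ht' : Hp t' by exact: Hp_shift.
  have := quot_inv_pos c0 Nc odd_d det' ht'; cbv zeta.
  set g' := Mat _ _ _ _.
  have gE : act g' t' = act g t.
    have nE : numer g' t' = numer g t.
      rewrite /numer /t' /g' /lj /= !(opp_IZR, mult_IZR, plus_IZR) hb mult_IZR.
      by rewrite !(RtoC_plus, RtoC_mult, RtoC_opp); ring.
    have dnE : den g' t' = den g t.
      rewrite /den /t' /g' /lj /= dE -cE Nat2Z.inj_mul !(opp_IZR, mult_IZR, plus_IZR).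
      by rewrite !(RtoC_plus, RtoC_mult, RtoC_opp); ring.
    by rewrite !actE nE dnE.
  rewrite gE => e.
  have e1 : f t' = Cmult (em (- j * xN r N)) (f t).
    rewrite f_shift // /lj (_ : - (Z.of_nat l * j) = - j * Z.of_nat l); last by ring.
    by rewrite em_lx.
  have e2 : f (over_l l t') = Cmult (em (- j * xN r N)) (f (over_l l t)).
    rewrite -(f_shift _ (Hp_over l_gt0 ht)); congr f; rewrite /over_l /t' /lj opp_IZR mult_IZR -INR_IZR_INZ.
    by rewrite !(RtoC_opp, RtoC_mult, opp_IZR); field; exact: INR_neq0 l_gt0.
  rewrite e1 e2 in e; have n0 := @em_neq0 (- j * xN r N).
  have {}e : Cmult (em (- j * xN r N)) (Cmult (f (over_l l (act g t))) (f t)) =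
     Cmult (em (- j * xN r N)) (Cmult (f (over_l l t)) (f (act g t))).
    by transitivity (Cmult (f (over_l l (act g t))) (Cmult (em (- j * xN r N)) (f t))); [ring|rewrite e; ring].
  by rewrite -[LHS]Cmult_1_l -(Cinv_l _ n0) -Cmult_assoc e Cmult_assoc Cinv_l // Cmult_1_l.
move=> gg hb ht; case: (Z.lt_trichotomy (mc g) 0) => [cn|[c0|cp]]; last exact: pos.
  pose g' := Mat (- ma g) (- mb g) (- mc g) (- md g).
  have gg' : gam0 N g'.
    case: gg => det dc; split; last by apply/Z.divide_opp_r.
    by rewrite -det /mdet /=; ring.
  have gE : act g' t = act g t.
    rewrite !actE /numer /den /g' /= !opp_IZR !RtoC_opp.
    have dn : den g t <> RtoC 0 by apply: den_neq0 => //; case: gg => ->.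
    rewrite /den in dn; field; split=> // h; apply: dn.
    rewrite (_ : Cplus (Cmult (RtoC (IZR (mc g))) t) (RtoC (IZR (md g))) =
      Copp (Cplus (Cmult (Copp (RtoC (IZR (mc g)))) t) (Copp (RtoC (IZR (md g)))))); last by ring.
    by rewrite h; ring.
  rewrite -gE; apply: pos => //; [by rewrite /=; apply/Z.divide_opp_r|by rewrite /=; lia].
(* For c = 0 the action is a translation by a multiple of l, and [em_lx] compares the two
   multipliers. *)
case: gg => det _; rewrite /mdet c0 Z.mul_0_r Z.sub_0_r in det.
case: hb => b hb.
have gE : act g t = Cplus t (RtoC (IZR (mb g * md g))).
  rewrite actE /numer /den c0.
  have [[ea ed]|[ea ed]] : (ma g = 1 /\ md g = 1) \/ (ma g = -1 /\ md g = -1).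
    by case: (Z.mul_eq_1 _ _ det) => ea; rewrite ea in det; [left|right]; lia.
  - rewrite ea ed Z.mul_1_r (_ : Cplus (Cmult (RtoC 0) t) (RtoC 1) = RtoC 1); [field|ring].
  - rewrite ea ed mult_IZR RtoC_mult (_ : Cplus (Cmult (RtoC 0) t) (RtoC (-1)) = RtoC (-1)); last by ring.
    have n1 : RtoC (-1) <> RtoC 0 by move/RtoC_inj; lra.
    have -> : RtoC (-1) = Copp (RtoC 1) by rewrite -RtoC_opp.
    by field; rewrite -RtoC_opp.
have -> : over_l l (act g t) = Cplus (over_l l t) (RtoC (IZR (b * md g))).
  rewrite gE /over_l hb !mult_IZR -INR_IZR_INZ !RtoC_mult.
  by field; exact: INR_neq0 l_gt0.
rewrite gE !f_shift //; last exact: Hp_over l_gt0 _.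
have -> : em (mb g * md g * xN r N) = em (b * md g * xN r N).
  by rewrite hb (_ : b * Z.of_nat l * md g = b * md g * Z.of_nat l) ?em_lx //; ring.
ring.
Qed.

Definition hecke_weight (a b : nat) : C :=
  Cmult (RtoC (Rpower (INR a) (IZR (twok r N) / 2))) (hecke_unit r N l a b).

(* diag(1, l) g = (1 0; s d 1) (a q; 0 d) with q = b + d u. *)
Lemma rep_value L (a b : nat) g t : (a, b) \in hecke_index N l -> is_rep r N l L a b g -> Hp t ->
  Cmult (f (over_l l (act g t))) (f t) =
  Cmult (Cmult (hecke_weight a b) (f (tri_act a b (l %/ a) t))) (f (act g t)).
Proof.
move=> inI rep ht; have l0 := l_gt0; have gg := is_rep_gam0 rep.
have {}gg : gam0 N g by apply: gam0_weak gg; exact: dvdn_mulr.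
case: rep gg => u [s [t1 [-> det [s0 ot] Ms s64]]] gg.
have /(hecke_indexP _ _ _ l0) [al aN bd abd] := inI.
have a0 : (0 < a)%N by apply: dvdn_gt0 al.
set d := (l %/ a)%N in det bd abd gg *; have d0 : (0 < d)%N by apply: leq_ltn_trans bd.
have lE : l = (a * d)%N by rewrite mulnC divnK.
set q := (b + d * u)%N in det gg *.
have Nms : (N * m_f r N %| s)%N by apply: dvdn_trans Ms; exact: dvdn_mulr.
have Ns : (N %| s)%N by apply: dvdn_trans Nms; exact: dvdn_mulr.
have wid := @weight_identity r N l a b d u q s t1 N0 a0 lE (proj1 (proj2 lL)) (proj2 (proj2 lL)) aN abd
   erefl det ot s0 Nms s64.
clear g; set g := Mat _ _ _ _ in gg *.
have dg : den g t <> RtoC 0 by apply: den_neq0 => //; case: gg => ->.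
pose g1 := Mat 1 0 (Z.of_nat (s * d)) (Z.of_nat 1).
have det1 : 1 * Z.of_nat 1 - 0 * Z.of_nat (s * d) = 1 by [].
have gg1 : gam0 N g1 by split=> //; apply/dvdn_Z; exact: dvdn_mulr.
have hw := Hp_tri q a0 d0 ht.
have A0 := INR_neq0 a0; have D0 := INR_neq0 d0.
have detC : Cplus (RtoC 1) (Cmult (RtoC (INR s)) (RtoC (INR q))) = Cmult (RtoC (INR a)) (RtoC (INR t1)).
  by rewrite -!RtoC_mult -RtoC_plus; congr RtoC; rewrite -!mult_INR -[1%R]/(INR 1) -plus_INR; congr INR.
have lC : RtoC (INR l) = Cmult (RtoC (INR a)) (RtoC (INR d)) by rewrite -RtoC_mult -mult_INR; congr (RtoC (INR _)).
have den1 : den g1 (tri_act a q d t) = Cmult (RtoC (INR a)) (den g t).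
  rewrite /den /g1 /g /tri_act; cbn [ma mb mc md]; rewrite -!INR_IZR_INZ mult_INR RtoC_mult [INR 1]/=.
  transitivity (Cplus (Cmult (Cmult (RtoC (INR s)) (RtoC (INR a))) t)
     (Cplus (RtoC 1) (Cmult (RtoC (INR s)) (RtoC (INR q))))); first by field.
  rewrite detC; ring.
have act1 : act g1 (tri_act a q d t) = over_l l (act g t).
  rewrite !actE den1 /over_l lC /numer /g1 /tri_act; cbn [ma mb mc md]; rewrite -!INR_IZR_INZ.
  by field; split=> //; split.
have f1 := f_act gg1 hw; rewrite act1 den1 in f1.
(* For (1 0; s d 1) the part with x_N vanishes, the symbols have denominator 1, and m_f | s/N
   removes the part with y_N. *)
have chi1 : eta_char r N (ma g1) (mb g1) (mc g1) (md g1) true = RtoC 1.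
  rewrite eta_char_val //; [|by rewrite muln_gt0 s0|exact: dvdn_mulr].
  rewrite -(em_24 0); apply: em_mod.
  have -> : Zprod (divisors N) (fun n => jac (Z.of_nat ((s * d) %/ n)) 1 ^ Z.of_nat (Z.abs_nat (r n))) = 1.
    by elim: (divisors N) => // n p IH; rewrite Zprod_cons IH jac1 Z.pow_1_l //; exact: Nat2Z.is_nonneg.
  have [k hk] := weight_y N0 Nms (- Z.of_nat d).
  exists k; rewrite -hk; change (Z.of_nat 1) with 1.
  by rewrite /g1 (mulnC s) -muln_divA // Nat2Z.inj_mul; cbn [ma mb mc md]; ring.
rewrite chi1 Cmult_1_l in f1.
have den0 : RtoC (sqrt (INR a)) <> RtoC 0.
  by apply: RtoC_neq0; have := sqrt_lt_R0 (INR a) (lt_0_INR a ltac:(lia)); lra.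
rewrite csqrt_scale in f1; last by apply: lt_0_INR; lia.
rewrite CpowZ_mul // in f1; last exact: csqrt_neq0.
rewrite CpowZ_sqrt in f1; last by apply: lt_0_INR; lia.
(* Passing from q to b is a translation by u; its factor em(u x_N) is the left side of
   [weight_identity]. *)
have sh : tri_act a q d t = Cplus (tri_act a b d t) (RtoC (IZR (Z.of_nat u))).
  rewrite /tri_act /q -INR_IZR_INZ plus_INR mult_INR !RtoC_plus RtoC_mult; field => //.
rewrite sh f_shift in f1; last exact: Hp_tri.
rewrite f1 (f_act gg ht) wid /hecke_weight.
rewrite -[eta_char r N (Z.of_nat a) _ _ _ _]/(eta_char r N (ma g) (mb g) (mc g) (md g) true); ring.
Qed.

Definition hecke_sum (t : C) : C :=
  Csum (hecke_index N l) (fun p => Cmult (hecke_weight p.1 p.2) (f (tri_act p.1 p.2 (l %/ p.1) t))).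

Definition quot (g : mat) (t : C) : C := Cdiv (f (over_l l (act g t))) (f (act g t)).

(** Write g = k h with l dividing the upper right entry of k, and apply [quot_inv] to k at the point
    h t. *)
Lemma quot_coset g h t : gam0 N g -> gam0 N h -> coset_eqb l g h -> Hp t -> quot g t = quot h t.
Proof.
move=> gg gh /(coset_eqP _ _ l_gt0) e ht; have [dg _] := gg; have [dh _] := gh.
pose k := mmul g (minv h).
have gk : gam0 N k by apply: gam0_mul => //; exact: gam0_inv.
have lk : (Z.of_nat l | mb k) by move: e; congr Z.divide; rewrite /=; ring.
have gE : g = mmul k h by rewrite mmulVr.
have dk : mdet k = 1 by case: gk.
have hht : Hp (act h t) by apply: Hp_act => //; lia.
have aE : act g t = act k (act h t) by rewrite gE act_mul //; lia.
have := quot_inv gk lk hht; rewrite /quot aE => q.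
have n1 := fnz hht; have n2 : f (act k (act h t)) <> RtoC 0 by apply/fnz/Hp_act => //; lia.
have -> : Cdiv (f (over_l l (act k (act h t)))) (f (act k (act h t))) =
  Cdiv (Cmult (f (over_l l (act k (act h t)))) (f (act h t))) (Cmult (f (act k (act h t))) (f (act h t))) by field; split.
by rewrite q; field; split.
Qed.

Lemma hecke_sum_quot L (ga : nat * nat -> mat) t : (forall p, p \in hecke_index N l -> is_rep r N l L p.1 p.2 (ga p)) -> Hp t ->
  hecke_sum t = Cmult (Csum (map ga (hecke_index N l)) (fun g => quot g t)) (f t).
Proof.
move=> hga ht; rewrite Csum_map Cmult_comm -CsumMl; apply: eq_Csum_pair => a b inI /=.
have rep := hga _ inI; have e := rep_value inI rep ht.
have gg : gam0 N (ga (a, b)) by apply: gam0_weak (is_rep_gam0 rep); exact: dvdn_mulr.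
have n2 : f (act (ga (a, b)) t) <> RtoC 0 by apply/fnz/Hp_act => //; case: gg => ->.
rewrite /quot.
move: (act (ga (a, b)) t) e n2 => z e n2.
transitivity (Cdiv (Cmult (f (over_l l z)) (f t)) (f z)); last by field.
by rewrite e; field.
Qed.

Lemma quot_sum_inv s k t : transversal N l s -> gam0 N k -> Hp t ->
  Csum s (fun g => quot g (act k t)) = Csum s (fun g => quot g t).
Proof.
move=> ts gk ht.
transitivity (Csum (map (fun g => mmul g k) s) (fun g => quot g t)).
  rewrite Csum_map; apply: (eq_Csum (proj1 ts)) => g [dg _]; rewrite /quot act_mul //; first lia.
  by case: gk => ->.
apply: (transversal_sum l_gt0 _ ts); first exact: transversal_mulr.
by move=> g h gg gh e; apply: quot_coset.
Qed.

Lemma reps_exist L : (0 < L)%N -> coprime l L -> exists ga : nat * nat -> mat,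
  forall p, p \in hecke_index N l -> is_rep r N l L p.1 p.2 (ga p).
Proof.
move=> L0 cL.
apply: (functional_choice (fun p g => p \in hecke_index N l -> is_rep r N l L p.1 p.2 g)) => -[a b].
case inI : ((a, b) \in hecke_index N l); last by exists (Mat 0 0 0 0).
by have [g hg] := is_rep_exists N0 lL L0 cL inI; exists g.
Qed.

(** The Hecke sum is f times the sum of quotients over a transversal, and right translation makes
    that sum invariant under Gamma0(N). *)
Lemma hecke_sum_transforms : transforms N (twok r N) (eta_char r N) hecke_sum.
Proof.
have l0 := l_gt0.
have [ga hga] := reps_exist (isT : (0 < 1)%N) (coprimen1 _).
have tr := rep_transversal N0 l0 hga.
move=> a b c d eps det Nc t ht.
have gg : gam0 N (Mat a b c d) by split.
have ha : Hp (mobius a b c d t) by apply: (@Hp_act (Mat a b c d)) => //; rewrite /mdet /= det.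
have := ftr eps det Nc ht; rewrite /slash (hecke_sum_quot hga ha) (hecke_sum_quot hga ht).
have -> := quot_sum_inv tr gg ht.
set S := Csum _ _.
move=> e; transitivity (Cmult S
  (Cmult (CpowZ (Cmult (sgnC eps) (csqrt (Cplus (Cmult (RtoC (IZR c)) t) (RtoC (IZR d))))) (- twok r N))
   (f (mobius a b c d t)))); first by ring.
by rewrite e; ring.
Qed.
End HeckeOperator.

(** * The Hecke sum for a product of coprime numbers *)

Section HeckeMultiplicative.
Variables (r : nat -> Z) (N : nat) (f : C -> C).
Hypotheses (N0 : (0 < N)%N) (fnz : forall t, Hp t -> f t <> RtoC 0)
  (ftr : transforms N (twok r N) (eta_char r N) f).
Variables l1 l2 : nat.
Hypotheses (L1 : in_Lf r N l1) (L2 : in_Lf r N l2) (cop : coprime l1 l2).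

Lemma in_Lf_mul : in_Lf r N (l1 * l2).
Proof.
case: L1 => p1 [m1 s1]; case: L2 => p2 [m2 s2]; split; first by rewrite muln_gt0 p1.
split; first by rewrite -modnMm m1 m2 modnMm.
move=> h; have [t1 ->] := s1 h; have [t2 ->] := s2 h; exists (t1 * t2)%N; exact: mulnACA.
Qed.

Lemma conj_down_gam0 h : gam0 (N * l2) h -> gam0 N (conj_down l2 h) /\ (Z.of_nat l2 | mb (conj_down l2 h)).
Proof.
have l20 := l_gt0 L2; move=> [dh [k hk]]; rewrite Nat2Z.inj_mul in hk.
have ck : mc h / Z.of_nat l2 = k * Z.of_nat N by rewrite hk Z.mul_assoc Z.div_mul; lia.
split; last by exists (mb h).
split; last by exists k.
by rewrite -dh /mdet /= ck hk; ring.
Qed.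

(** The matrix identity diag(1, l2) conj(h) = h diag(1, l2), applied to a point. *)
Lemma over_conj h z : gam0 (N * l2) h -> Hp z -> over_l l2 (act (conj_down l2 h) z) = act h (over_l l2 z).
Proof.
move=> gh hz; have l20 := l_gt0 L2; have L0 := INR_neq0 l20.
have [[dk _] _] := conj_down_gam0 gh.
have dn : den (conj_down l2 h) z <> RtoC 0 by apply: den_neq0 => //; rewrite dk.
have dE : den h (over_l l2 z) = den (conj_down l2 h) z.
  case: gh => _ [k hk]; rewrite Nat2Z.inj_mul in hk.
  have ck : mc h / Z.of_nat l2 = k * Z.of_nat N by rewrite hk Z.mul_assoc Z.div_mul; lia.
  rewrite /den /conj_down /over_l; cbn [ma mb mc md]; rewrite ck hk !mult_IZR -(INR_IZR_INZ l2) !RtoC_mult.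
  by field.
rewrite !actE dE /numer /over_l /conj_down; cbn [ma mb mc md].
rewrite mult_IZR -(INR_IZR_INZ l2) !RtoC_mult.
move: (den _ z) dn => D dn; by field; split.
Qed.

(** Insert f(h(g t / l2)), which by [over_conj] is f at conj(h) g t / l2. Its quotient by f(conj(h)
    g t) equals f(g t / l2) / f(g t) by [quot_inv]. *)
Lemma quot_mul g h t : gam0 N g -> gam0 (N * l2) h -> Hp t ->
  quot f (l1 * l2) (mmul (conj_down l2 h) g) t = Cmult (quot f l1 h (over_l l2 (act g t))) (quot f l2 g t).
Proof.
move=> gg gh ht; have l20 := l_gt0 L2; have l10 := l_gt0 L1.
have [gk lk] := conj_down_gam0 gh.
have [dg _] := gg; have [dk _] := gk; have [dh _] := gh.
have hz : Hp (act g t) by apply: Hp_act => //; rewrite dg.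
rewrite /quot act_mul //; [|by rewrite dk|by rewrite dg].
have := quot_inv N0 ftr L2 gk lk hz; rewrite over_conj //.
move: (act g t) hz => z hz e.
have hz2 : Hp (over_l l2 z) by apply: Hp_over.
have -> : over_l (l1 * l2) (act (conj_down l2 h) z) = over_l l1 (act h (over_l l2 z)).
  rewrite -over_conj // /over_l mult_INR RtoC_mult; field; split; exact: INR_neq0.
have n1 := fnz hz; have n2 : f (act h (over_l l2 z)) <> RtoC 0 by apply/fnz/Hp_act => //; rewrite dh.
have n3 : f (act (conj_down l2 h) z) <> RtoC 0 by apply/fnz/Hp_act => //; rewrite dk.
move: (f (over_l l1 _)) (f (act h _)) (f (over_l l2 z)) (f (act _ z)) (f z) n1 n2 n3 e => A B D E F n1 n2 n3 e.
transitivity (Cdiv (Cmult A (Cmult D E)) (Cmult (Cmult B F) E)); last by field; split=> //; split.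
by rewrite -e; field; split=> //; split.
Qed.

Lemma Csum_allpairs (A B T : Type) (F : A -> B -> T) (G : T -> C) s t :
  Csum [seq F x y | x <- s, y <- t] G = Csum s (fun x => Csum t (fun y => G (F x y))).
Proof. by elim: s => //= x s IH; rewrite Csum_cat IH Csum_map. Qed.

(** The eigenvalue equation says that the sum of quotients over a transversal for l1 is the constant
    C1 at every point; so the inner sum, taken at g t / l2, does not depend on g and the double sum
    factors. *)
Lemma hecke_sum_mul C1 C2 : (forall t, Hp t -> hecke_sum r N f l1 t = Cmult C1 (f t)) ->
  (forall t, Hp t -> hecke_sum r N f l2 t = Cmult C2 (f t)) ->
  forall t, Hp t -> hecke_sum r N f (l1 * l2) t = Cmult (Cmult C1 C2) (f t).
Proof.
move=> h1 h2 t ht; have l20 := l_gt0 L2; have l10 := l_gt0 L1; have L12 := in_Lf_mul.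
(* Lower left entries divisible by l2 keep the conjugates by diag(1, l2) integral. *)
have [g1 hg1] := reps_exist N0 L1 l20 cop.
have [g2 hg2] := reps_exist N0 L2 (isT : (0 < 1)%N) (coprimen1 _).
have [g3 hg3] := reps_exist N0 L12 (isT : (0 < 1)%N) (coprimen1 _).
have t1 := rep_transversal N0 l10 hg1; have t2 := rep_transversal N0 l20 hg2.
have t3 := rep_transversal N0 (l_gt0 L12) hg3.
have fa : List.Forall (gam0 (N * l2)) (map g1 (hecke_index N l1)).
  have : {subset hecke_index N l1 <= hecke_index N l1} by [].
  elim: {1 3}(hecke_index N l1) => //= p s IH sub; constructor.
    by apply: is_rep_gam0 (hg1 _ (sub _ (mem_head _ _))).
  by apply: IH => x xs; apply: sub; rewrite inE xs orbT.
have t4 := transversal_mul N0 l10 l20 cop t1 fa t2.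
have q1 z : Hp z -> Csum (map g1 (hecke_index N l1)) (fun g => quot f l1 g z) = C1.
  move=> hz; have := h1 z hz; rewrite (hecke_sum_quot N0 fnz ftr L1 hg1 hz) => e.
  by rewrite -[LHS]Cmult_1_r -(Cinv_r _ (fnz hz)) Cmult_assoc e; field; exact: fnz.
have q2 z : Hp z -> Csum (map g2 (hecke_index N l2)) (fun g => quot f l2 g z) = C2.
  move=> hz; have := h2 z hz; rewrite (hecke_sum_quot N0 fnz ftr L2 hg2 hz) => e.
  by rewrite -[LHS]Cmult_1_r -(Cinv_r _ (fnz hz)) Cmult_assoc e; field; exact: fnz.
rewrite (hecke_sum_quot N0 fnz ftr L12 hg3 ht); congr (Cmult _ _).
rewrite (transversal_sum (l_gt0 L12) t3 t4); last by move=> g h gg gh e; apply: (quot_coset N0 fnz ftr L12).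
rewrite Csum_allpairs -(q2 t ht) -CsumMl; apply: (eq_Csum (proj1 t2)) => g gg.
have hz : Hp (over_l l2 (act g t)) by apply: Hp_over => //; apply: Hp_act => //; case: gg => ->.
rewrite -(q1 _ hz) Cmult_comm -CsumMl; apply: (eq_Csum fa) => h gh.
by rewrite quot_mul // Cmult_comm.
Qed.
End HeckeMultiplicative.

Local Open Scope R_scope.

(** * Complex series *)

Notation is_seriesC := (@is_series C_AbsRing C_NormedModule).

Lemma sum_n_fst (a : nat -> C) n : fst (@sum_n C_AbelianMonoid a n) = sum_n (fun k => fst (a k)) n.
Proof. by elim: n => [|n IH]; rewrite ?sum_O // !sum_Sn -IH. Qed.

Lemma sum_n_snd (a : nat -> C) n : snd (@sum_n C_AbelianMonoid a n) = sum_n (fun k => snd (a k)) n.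
Proof. by elim: n => [|n IH]; rewrite ?sum_O // !sum_Sn -IH. Qed.

Lemma seriesC_split (a : nat -> C) s : is_seriesC a s <->
  is_series (fun k => fst (a k)) (fst s) /\ is_series (fun k => snd (a k)) (snd s).
Proof.
split.
  move=> h; split; apply/filterlim_locally => eps.
    have [n hn] := (proj1 (filterlim_locally _ _) h eps); exists n => m hm.
    by rewrite -sum_n_fst; exact: (proj1 (hn m hm)).
  have [n hn] := (proj1 (filterlim_locally _ _) h eps); exists n => m hm.
  by rewrite -sum_n_snd; exact: (proj2 (hn m hm)).
move=> [h1 h2]; apply/filterlim_locally => eps.
have [n1 hn1] := (proj1 (filterlim_locally _ _) h1 eps).
have [n2 hn2] := (proj1 (filterlim_locally _ _) h2 eps).
exists (n1 + n2)%N => m hm; split.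
  by have := hn1 m ltac:(lia); rewrite -sum_n_fst.
by have := hn2 m ltac:(lia); rewrite -sum_n_snd.
Qed.

Lemma seriesC_unique (a : nat -> C) s t : is_seriesC a s -> is_seriesC a t -> s = t.
Proof.
move=> /seriesC_split [h1 h2] /seriesC_split [h3 h4]; apply: C_ext.
  by rewrite -(is_series_unique _ _ h1) -(is_series_unique _ _ h3).
by rewrite -(is_series_unique _ _ h2) -(is_series_unique _ _ h4).
Qed.

Lemma seriesC_ext (a b : nat -> C) s : (forall n, a n = b n) -> is_seriesC a s -> is_seriesC b s.
Proof. by move=> e; apply: is_series_ext. Qed.

Lemma seriesC_plus (a b : nat -> C) s t : is_seriesC a s -> is_seriesC b t ->
  is_seriesC (fun n => Cplus (a n) (b n)) (Cplus s t).
Proof. exact: is_series_plus. Qed.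

Lemma seriesC_scal (a : nat -> C) s c : is_seriesC a s -> is_seriesC (fun n => Cmult c (a n)) (Cmult c s).
Proof. exact: (@is_series_scal C_AbsRing C_NormedModule). Qed.

Lemma sum_n_Csum (a : nat -> C) n : @sum_n C_AbelianMonoid a n = Csum (iota 0 n.+1) a.
Proof.
elim: n => [|n IH]; first by rewrite sum_O /= Cplus_0_r.
by rewrite sum_Sn IH (iota_rcons 0 n.+1) Csum_cat /= Cplus_0_r.
Qed.

Lemma seriesC_lim (a : nat -> C) s : is_seriesC a s <->
  filterlim (fun n => Csum (iota 0 n) a) eventually (@locally C_UniformSpace s).
Proof.
split=> h; apply/filterlim_locally => eps.
  have [n hn] := proj1 (filterlim_locally _ _) h eps; exists n.+1 => m hm.
  have := hn m.-1 ltac:(lia); rewrite sum_n_Csum (_ : m.-1.+1 = m) //; lia.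
have [n hn] := proj1 (filterlim_locally _ _) h eps; exists n => m hm.
by rewrite sum_n_Csum; apply: hn; lia.
Qed.

Lemma ee_add z w : ee (Cplus z w) = Cmult (ee z) (ee w).
Proof.
rewrite /ee /cexp /Cmult /Cplus /=.
rewrite !Rmult_0_l !Rminus_0_l !Rplus_0_l (_ : - (2 * PI * (z.2 + w.2)) = - (2 * PI * z.2) + - (2 * PI * w.2))%R; last ring.
rewrite (Rmult_plus_distr_l (2 * PI) z.1 w.1) exp_plus cos_plus sin_plus.
by congr pair; ring.
Qed.

Lemma ee_eR x : ee (RtoC x) = eR x.
Proof. by []. Qed.

Lemma ee_0 : ee (RtoC 0) = RtoC 1.
Proof. exact: eR_0. Qed.

Lemma ee_neq0 z : ee z <> RtoC 0.
Proof.
move=> h; have := ee_add z (Copp z); rewrite Cplus_opp_r ee_0 h Cmult_0_l.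
by move/RtoC_inj; lra.
Qed.

(** For the fractional part y, 1 - 2 sin(pi y)^2 = 1 forces sin(pi y) = 0, which excludes 0 < y <
    1. *)
Lemma eR_eq1 x : eR x = RtoC 1 -> exists z : Z, x = IZR z.
Proof.
move=> h; pose z := (up x - 1)%Z; exists z.
have [h1 h2] := archimed x.
have zE : IZR z = (IZR (up x) - 1)%R by rewrite minus_IZR.
set y := (x - IZR z)%R; have y0 : (0 <= y < 1)%R by rewrite /y zE; lra.
have hy : eR y = RtoC 1.
  have : eR x = Cmult (eR y) (eR (IZR z)) by rewrite -eR_add /y; congr eR; ring.
  by rewrite h eR_int Cmult_1_r.
case: (Rle_lt_or_eq_dec 0 y (proj1 y0)) => [yp|]; last by rewrite /y; lra.
have e : cos (2 * (PI * y)) = 1 by rewrite -Rmult_assoc; have := f_equal fst hy; rewrite eR_trig.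
rewrite cos_2a_sin in e.
have s0 : (0 < sin (PI * y))%R by apply: sin_gt_0; have := PI_RGT_0; nra.
nra.
Qed.

Lemma ee_shift (q : R) t (x : R) : ee (Cmult (RtoC q) (Cplus t (RtoC x))) = Cmult (eR (q * x)) (ee (Cmult (RtoC q) t)).
Proof. by rewrite Cmult_plus_distr_l ee_add -RtoC_mult Cmult_comm. Qed.

(** Every nonzero real x with |x| < 1 is a value of q^(1/h): the imaginary part is read off from log
    |x|, and the real part is 0 or h/2 according to the sign. This reduces q-series to real power
    series. *)
Lemma ee_real_point (h x : R) : (0 < h)%R -> (x <> 0)%R -> (Rabs x < 1)%R ->
  exists2 t, Hp t & forall m : nat, ee (Cmult (RtoC (INR m / h)) t) = RtoC (x ^ m).
Proof.
move=> h0 x0 x1; have ax0 := Rabs_pos_lt _ x0.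
pose y := (- ln (Rabs x) / (2 * PI))%R.
have pi0 := PI_RGT_0.
have y0 : (0 < y)%R.
  apply: Rdiv_lt_0_compat; last lra.
  have := ln_increasing _ _ ax0 x1; rewrite ln_1; lra.
have ey : (exp (- (2 * PI * y)) = Rabs x)%R.
  by rewrite (_ : - (2 * PI * y) = ln (Rabs x))%R ?exp_ln //; rewrite /y; field; lra.
pose th := (if Rle_dec 0 x then 0 else / 2)%R.
exists (h * th, h * y)%R; first by rewrite /Hp /=; nra.
move=> m; have -> : Cmult (RtoC (INR m / h)) (h * th, h * y)%R = (INR m * th, INR m * y)%R.
  by apply: C_ext; rewrite /=; field; lra.
have E1 : ee (th, y) = RtoC x.
  rewrite /ee /cexp /= !Rmult_0_l Rplus_0_l Rminus_0_l ey /th; case: Rle_dec => hx /=.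
    rewrite !Rmult_0_r cos_0 sin_0 Rabs_pos_eq //.
    by apply: C_ext; rewrite /=; ring.
  rewrite (_ : 2 * PI * / 2 = PI)%R; last by field.
  rewrite cos_PI sin_PI Rabs_left; last lra.
  by apply: C_ext; rewrite /=; ring.
elim: m => [|m IH].
  rewrite (_ : (INR 0 * th, INR 0 * y)%R = RtoC 0) ?ee_0 //.
  by apply: C_ext; rewrite /=; ring.
rewrite (_ : (INR m.+1 * th, INR m.+1 * y)%R = Cplus (th, y) (INR m * th, INR m * y)%R); last first.
  by apply: C_ext; rewrite S_INR /=; ring.
by rewrite ee_add IH E1 -RtoC_mult.
Qed.

(** The value x = 0 is not taken by q^(1/h), so the vanishing at 0 has to be recovered by
    continuity. *)
Lemma pseries_zero (a : nat -> R) :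
  (forall x, x <> 0 -> Rabs x < 1 -> is_series (fun m => a m * x ^ m) 0)%R -> forall m, a m = 0%R.
Proof.
move=> h.
have ps x : (x <> 0 -> Rabs x < 1 -> is_pseries a x 0)%R.
  move=> x0 x1; apply/is_pseries_R; exact: h.
have half : (/ 2 <> 0 /\ Rabs (/ 2) < 1)%R by rewrite Rabs_pos_eq; lra.
have rad : Rbar_lt 0 (CV_radius a).
  apply: Rbar_not_le_lt => hr.
  have hlt : Rbar_lt (CV_radius a) (Rabs (/ 2)).
    by apply: Rbar_le_lt_trans hr _; rewrite /= Rabs_pos_eq; lra.
  have := CV_disk_outside a (/ 2)%R hlt; apply.
  have hs := h _ (proj1 half) (proj2 half).
  exact: (ex_series_lim_0 (fun m => a m * (/ 2) ^ m)%R (ex_intro _ _ hs)).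
have val x : (x <> 0 -> Rabs x < 1 -> PSeries a x = 0)%R.
  by move=> x0 x1; apply: is_pseries_unique; exact: ps.
have a00 : PSeries a 0 = 0%R.
  have ct := PSeries_continuity a 0 ltac:(by rewrite Rabs_R0).
  apply: NNPP => n0.
  have [alp [al0 hal]] := ct (Rabs (PSeries a 0)) (Rabs_pos_lt _ n0).
  pose x := (Rmin alp 1 / 2)%R.
  have m1 := Rmin_l alp 1; have m2 := Rmin_r alp 1.
  have m3 : (0 < Rmin alp 1)%R by apply: Rmin_pos; lra.
  have x0 : (0 < x)%R by rewrite /x; lra.
  have := hal x; rewrite /dist /= /R_dist => /(_ _).
  rewrite (val x); [|lra|by rewrite Rabs_pos_eq /x; lra].
  rewrite Rminus_0_l Rabs_Ropp => hh.
  have : (Rabs (PSeries a 0) < Rabs (PSeries a 0))%R; last lra.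
  apply: hh; split; first by split=> //; lra.
  by rewrite Rminus_0_r Rabs_pos_eq /x; lra.
move=> m; apply: (PSeries_ext_recip a (fun=> 0%R) m rad); first by rewrite CV_radius_const_0.
exists (mkposreal 1 Rlt_0_1) => x /=; rewrite /ball /= /AbsRing_ball /= /abs /minus /plus /opp /= => hx.
rewrite PSeries_const_0; case: (Req_dec x 0) => [->//|x0]; apply: val => //.
by rewrite (_ : x + - 0 = x)%R in hx; [|ring].
Qed.

Lemma qseries_zero (A : nat -> C) (h : R) : (0 < h)%R ->
  (forall t, Hp t -> is_seriesC (fun m => Cmult (A m) (ee (Cmult (RtoC (INR m / h)) t))) (RtoC 0)) ->
  forall m, A m = RtoC 0.
Proof.
move=> h0 hA.
have key x : (x <> 0 -> Rabs x < 1 -> is_seriesC (fun m => Cmult (A m) (RtoC (x ^ m))) (RtoC 0))%R.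
  move=> x0 x1; have [t ht e] := ee_real_point h0 x0 x1.
  by apply: seriesC_ext (hA t ht) => m; rewrite e.
move=> m; apply: C_ext; rewrite [RHS]/=.
  apply: (@pseries_zero (fun m => fst (A m))) => x x0 x1.
  have /seriesC_split [hs _] := key x x0 x1.
  by apply: is_series_ext hs => k; rewrite /=; ring.
apply: (@pseries_zero (fun m => snd (A m))) => x x0 x1.
have /seriesC_split [_ hs] := key x x0 x1.
by apply: is_series_ext hs => k; rewrite /=; ring.
Qed.

(** * Expansions with exponents in (1/H) N *)

(** In [cusp_expansion] the width and the shift are existential; with a prescribed denominator H,
    expansions can be added. *)
Definition qexp (strict : bool) (H : R) (G : C -> C) : Prop :=
  exists2 B : nat -> C,
    forall t, Hp t -> is_seriesC (fun n => Cmult (B n) (ee (Cmult (RtoC (INR n / H)) t))) (G t)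
  & strict -> B 0%N = RtoC 0.

Lemma qexp_plus st H G1 G2 : qexp st H G1 -> qexp st H G2 -> qexp st H (fun t => Cplus (G1 t) (G2 t)).
Proof.
move=> [B1 h1 s1] [B2 h2 s2]; exists (fun n => Cplus (B1 n) (B2 n)).
  move=> t ht; apply: seriesC_ext (seriesC_plus (h1 t ht) (h2 t ht)) => n; ring.
by move=> hs; rewrite s1 // s2 // Cplus_0_l.
Qed.

Lemma qexp_scal st H G c : qexp st H G -> qexp st H (fun t => Cmult c (G t)).
Proof.
move=> [B h s]; exists (fun n => Cmult c (B n)).
  move=> t ht; apply: seriesC_ext (@seriesC_scal _ _ c (h t ht)) => n; ring.
by move=> hs; rewrite s // Cmult_0_r.
Qed.

Lemma qexp_ext st H G1 G2 : (forall t, Hp t -> G1 t = G2 t) -> qexp st H G1 -> qexp st H G2.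
Proof. by move=> e [B h s]; exists B => // t ht; rewrite -e //; exact: h. Qed.

Lemma qexp_0 st H : qexp st H (fun=> RtoC 0).
Proof.
exists (fun=> RtoC 0) => // t ht; apply/seriesC_lim/filterlim_locally => eps; exists 0%N => n _.
rewrite (_ : Csum _ _ = RtoC 0); first exact: ball_center.
by elim: (iota 0 n) => //= x s ->; rewrite Cmult_0_l Cplus_0_l.
Qed.

Lemma qexp_cusp st H G : (0 < H) -> qexp st H G -> cusp_expansion st G.
Proof.
move=> H0 [B h s]; exists H, 0, B; split=> //; split.
  by move=> t ht; apply: seriesC_ext (h t ht) => n; rewrite Rplus_0_r.
move=> m hm; rewrite Rplus_0_r; case: st s => s; last exact: pos_INR.
by case: m hm => [|m] hm; [case: hm; exact: s|rewrite S_INR; have := pos_INR m; lra].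
Qed.

Lemma Csum_single (s : seq nat) (P : pred nat) (k : nat) (c : C) : uniq s -> k \in s ->
  (forall n, n \in s -> P n = (n == k)) -> Csum s (fun n => if P n then c else RtoC 0) = c.
Proof.
move=> us ks hP; rewrite Csum_count (_ : count P s = 1%N) ?Cmult_1_l //.
rewrite -[RHS](_ : count_mem k s = 1%N); first by apply: eq_in_count => n ns; rewrite hP.
by rewrite count_uniq_mem // ks.
Qed.

Definition cnt_le (x : R) : nat := Z.to_nat (up x).

Lemma cnt_leP (x : R) (m : nat) : (m < cnt_le x)%N <-> (INR m <= x).
Proof.
rewrite /cnt_le; have [h1 h2] := archimed x; rewrite INR_IZR_INZ; split=> h.
  have : (Z.of_nat m <= up x - 1)%Z by lia.
  by move=> /IZR_le; rewrite minus_IZR; lra.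
have : (IZR (Z.of_nat m) < IZR (up x)) by lra.
by move=> /lt_IZR; lia.
Qed.

(** The map from m to n is injective, so B n has at most one nonzero term; as it is also increasing,
    the partial sum of the new series up to K is the partial sum of the old one up to c K. *)
Lemma reindex_series (A : nat -> C) (h kap H : R) (G : C -> C) : 0 < h -> 0 < H ->
  (forall t, Hp t -> is_seriesC (fun m => Cmult (A m) (ee (Cmult (RtoC ((INR m + kap) / h)) t))) (G t)) ->
  (forall m, A m <> RtoC 0 -> exists n : nat, (INR m + kap) / h * H = INR n) ->
  exists B : nat -> C,
  [/\ forall t, Hp t -> is_seriesC (fun n => Cmult (B n) (ee (Cmult (RtoC (INR n / H)) t))) (G t),
      forall m n, (INR m + kap) / h * H = INR n -> B n = A m &
      forall n, (forall m, (INR m + kap) / h * H = INR n -> A m = RtoC 0) -> B n = RtoC 0].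
Proof.
move=> h0 H0 hA hn.
pose c (K : nat) := cnt_le (INR K * h / H - kap).
have cP K m : (m < c K)%N <-> ((INR m + kap) / h * H <= INR K).
  rewrite cnt_leP; have e : INR K * h / H - kap - INR m = (INR K - (INR m + kap) / h * H) * (h / H).
    by field; lra.
  have hH : 0 < h / H by apply: Rdiv_lt_0_compat.
  split=> hh; first by apply: Rnot_lt_le => h1; nra.
  by nra.
pose ind (m n : nat) : bool := if Req_EM_T ((INR m + kap) / h * H) (INR n) then true else false.
have indP m n : reflect ((INR m + kap) / h * H = INR n) (ind m n).
  by rewrite /ind; case: Req_EM_T => e; constructor.
pose B (n : nat) := Csum (iota 0 (c n)) (fun m => if ind m n then A m else RtoC 0).
have inj m m' : (INR m + kap) / h * H = (INR m' + kap) / h * H -> m = m'.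
  move=> e; apply: INR_eq; apply: (Rplus_eq_reg_r kap).
  apply: (Rmult_eq_reg_r (H / h)); last by apply: Rgt_not_eq; apply: Rdiv_lt_0_compat.
  by move: e; rewrite /Rdiv => e; rewrite (Rmult_comm H) -!Rmult_assoc.
exists B; split; last first.
- move=> n hz; rewrite /B -[RHS](Csum_0 (iota 0 (c n))); apply: eq_Csum_in => m _.
  by case: ifP => // /indP /hz.
- move=> m n e; rewrite /B -[RHS](@Csum_single (iota 0 (c n)) (pred1 m) m (A m)) ?iota_uniq //.
    apply: eq_Csum_in => m' _ /=; case: (m' =P m) => [->|ne]; first by case: ifP => // /indP.
    by case: ifP => // /indP e'; case: ne; apply: inj; rewrite e e'.
  by rewrite mem_iota /=; apply/cP; rewrite e; lra.
move=> t ht; apply/seriesC_lim.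
pose a (m : nat) := Cmult (A m) (ee (Cmult (RtoC ((INR m + kap) / h)) t)).
have part K : Csum (iota 0 K.+1) (fun n => Cmult (B n) (ee (Cmult (RtoC (INR n / H)) t))) = Csum (iota 0 (c K)) a.
  transitivity (Csum (iota 0 K.+1) (fun n => Csum (iota 0 (c K)) (fun m => if ind m n then a m else RtoC 0))).
    apply: eq_Csum_in => n; rewrite mem_iota => /andP [_ nK].
    rewrite Cmult_comm /B -CsumMl.
    have cc : (c n <= c K)%N.
      rewrite leqNgt; apply/negP => hlt; have := proj1 (cP n (c K)) hlt => h1.
      have : ((INR (c K) + kap) / h * H <= INR K).
        by apply: Rle_trans h1 _; apply: le_INR; lia.
      by move=> /cP; rewrite ltnn.
    rewrite -(subnKC cc) iotaD Csum_cat.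
    rewrite [X in Cplus _ X](_ : _ = RtoC 0) ?Cplus_0_r; last first.
      rewrite -[RHS](Csum_0 (iota (0 + c n) (c K - c n))); apply: eq_Csum_in => m; rewrite mem_iota => hm.
      case: ifP => // /indP e; have : (m < c n)%N by apply/cP; rewrite e; lra.
      lia.
    apply: eq_Csum_in => m _; case: ifP => [/indP e|_]; last by rewrite Cmult_0_r.
    rewrite /a Cmult_comm; congr (Cmult _ (ee (Cmult (RtoC _) t))).
    by rewrite -e; field; lra.
  rewrite Csum_exchange; apply: eq_Csum_in => m; rewrite mem_iota => /andP [_ mc].
  case: (Ceq_dec (A m) (RtoC 0)) => [z|nz].
    rewrite /a z Cmult_0_l -[RHS](Csum_0 (iota 0 K.+1)); apply: eq_Csum_in => n _; by case: ifP.
  have [n en] := hn m nz; have := proj1 (cP K m) mc; rewrite en => nK.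
  apply: (@Csum_single _ _ n); first exact: iota_uniq.
    by rewrite mem_iota; have := INR_le _ _ nK; lia.
  move=> n' _; apply/indP/eqP; rewrite en; first by move/INR_eq.
  by move=> ->.
have lim : filterlim (fun n => Csum (iota 0 n) a) eventually (@locally C_UniformSpace (G t)).
  by apply/seriesC_lim; exact: hA.
apply/filterlim_locally => eps.
have [M hM] := proj1 (filterlim_locally _ _) lim eps.
pose K0 := Z.to_nat (up ((INR M + kap) / h * H)).
exists K0.+1 => n hK; have -> : n = n.-1.+1 by lia.
rewrite part; apply: hM.
suff : (M < c n.-1)%N by lia.
apply/cP; apply: Rle_trans (_ : INR K0 <= _); last by apply: le_INR; lia.
have [h1 _] := archimed ((INR M + kap) / h * H).
apply: Rle_trans (Rlt_le _ _ (Rgt_lt _ _ h1)) _; rewrite /K0 (INR_IZR_INZ (Z.to_nat _)).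
by apply: IZR_le; lia.
Qed.

Lemma reindex_qexp (st : bool) (A : nat -> C) (h kap H : R) (G : C -> C) : 0 < h -> 0 < H ->
  (forall t, Hp t -> is_seriesC (fun m => Cmult (A m) (ee (Cmult (RtoC ((INR m + kap) / h)) t))) (G t)) ->
  (forall m, A m <> RtoC 0 -> exists2 n : nat, (INR m + kap) / h * H = INR n & st -> (0 < n)%N) ->
  qexp st H G.
Proof.
move=> h0 H0 hA hn.
have [m nz|B [hB _ z]] := reindex_series h0 H0 hA; first by have [n e _] := hn m nz; exists n.
exists B => // s; apply: z => m e; apply: NNPP => nz; have [n en np] := hn m nz.
by rewrite en in e; have := INR_eq n 0 e; have := np s; lia.
Qed.

(** Comparing coefficients in G(t + H) = G(t) gives A_m (e(H (m + kap)/h) - 1) = 0, so each exponent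
    that occurs is an integral multiple of 1/H. *)
Lemma cusp_periodic st G (H : R) : 0 < H -> cusp_expansion st G ->
  (forall t, Hp t -> G (Cplus t (RtoC H)) = G t) -> qexp st H G.
Proof.
move=> H0 [h [kap [A [h0 [hA hs]]]]] per.
apply: (reindex_qexp h0 H0 hA) => m nz.
pose D m := Cmult (A m) (Cminus (eR ((INR m + kap) / h * H)) (RtoC 1)).
have D0 : D m = RtoC 0.
  apply: (qseries_zero h0) => t ht.
  have h1 := hA _ (Hp_shift H ht); rewrite per // in h1.
  have h2 := seriesC_plus h1 (@seriesC_scal _ _ (RtoC (-1)) (hA t ht)).
  (* Multiplication by e(-kap t / h) removes the shift, as [qseries_zero] expects exponents m/h. *)
  have h3 := @seriesC_scal _ _ (ee (Cmult (RtoC (- kap / h)) t)) h2.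
  have m1 : RtoC (-1) = Copp (RtoC 1) by rewrite -RtoC_opp.
  have e0 : Cmult (ee (Cmult (RtoC (- kap / h)) t)) (Cplus (G t) (Cmult (RtoC (-1)) (G t))) = RtoC 0.
    by rewrite m1; ring.
  rewrite e0 in h3.
  apply: seriesC_ext h3 => n; rewrite ee_shift /D.
  have -> : ee (Cmult (RtoC (INR n / h)) t) =
     Cmult (ee (Cmult (RtoC (- kap / h)) t)) (ee (Cmult (RtoC ((INR n + kap) / h)) t)).
    rewrite -ee_add -Cmult_plus_distr_r -RtoC_plus; congr (ee (Cmult (RtoC _) t)); field; lra.
  by rewrite m1; ring.
have z1 : eR ((INR m + kap) / h * H) = RtoC 1.
  have : Cminus (eR ((INR m + kap) / h * H)) (RtoC 1) = RtoC 0.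
    apply: NNPP => n0; have := Cmult_neq_0 _ _ nz n0; exact.
  move: (eR _) => w e; have -> : w = Cplus (Cminus w (RtoC 1)) (RtoC 1) by ring.
  by rewrite e Cplus_0_l.
have [z zE] := eR_eq1 z1; rewrite zE.
have hm := hs m nz.
have pos : 0 <= (INR m + kap) / h * H.
  by apply: Rmult_le_pos; [apply: Rdiv_le_0_compat => //; case: st hm {hs}; lra|lra].
have zp : (0 <= z)%Z by apply: le_IZR; rewrite -zE.
exists (Z.to_nat z); first by rewrite INR_IZR_INZ Z2Nat.id.
move=> s; rewrite s in hm; have : 0 < IZR z.
  by rewrite -zE; apply: Rmult_lt_0_compat => //; apply: Rdiv_lt_0_compat.
by move=> /lt_IZR; lia.
Qed.

(** * The q-expansion of an eta quotient *)

Definition limC (u : nat -> C) (l : C) : Prop :=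
  is_lim_seq (fun n => fst (u n)) (fst l) /\ is_lim_seq (fun n => snd (u n)) (snd l).

Lemma limCP u l : limC u l <-> filterlim u eventually (@locally C_UniformSpace l).
Proof.
split.
  move=> [h1 h2]; apply/filterlim_locally => eps.
  have [n1 hn1] := proj1 (filterlim_locally _ _) h1 eps.
  have [n2 hn2] := proj1 (filterlim_locally _ _) h2 eps.
  by exists (n1 + n2)%N => m hm; split; [apply: hn1|apply: hn2]; lia.
move=> h; split; apply/filterlim_locally => eps; have [n hn] := proj1 (filterlim_locally _ _) h eps;
  exists n => m hm; by case: (hn m hm).
Qed.

Lemma limC_mul u v l k : limC u l -> limC v k -> limC (fun n => Cmult (u n) (v n)) (Cmult l k).
Proof.
move=> [u1 u2] [v1 v2]; split=> /=.
  by apply: is_lim_seq_minus'; apply: is_lim_seq_mult'.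
by apply: is_lim_seq_plus'; apply: is_lim_seq_mult'.
Qed.

Lemma limC_unique u l k : limC u l -> limC u k -> l = k.
Proof.
move=> [u1 u2] [v1 v2]; apply: C_ext.
  by have := is_lim_seq_unique _ _ u1; rewrite (is_lim_seq_unique _ _ v1) => -[].
by have := is_lim_seq_unique _ _ u2; rewrite (is_lim_seq_unique _ _ v2) => -[].
Qed.

Lemma limC_const c : limC (fun=> c) c.
Proof. by split; exact: is_lim_seq_const. Qed.

Lemma limC_ext u v l : (forall n, u n = v n) -> limC u l -> limC v l.
Proof. by move=> e [h1 h2]; split; [apply: is_lim_seq_ext h1|apply: is_lim_seq_ext h2] => n; rewrite e. Qed.

(** The total operator [lim] is meaningful only on Cauchy filters, so convergence has to be
    established before it can be evaluated. *)
Lemma lim_eq u l : limC u l -> @lim C_CompleteNormedModule (filtermap u eventually) = l.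
Proof.
move=> hl; have h := proj1 (limCP u l) hl; apply: (limC_unique _ hl); apply/limCP.
have pf : ProperFilter (filtermap u eventually) by apply: filtermap_proper_filter.
have ca : @cauchy C_CompleteNormedModule (filtermap u eventually).
  by move=> eps; exists l; exact: (proj1 (filterlim_locally _ _) h eps).
apply/filterlim_locally => eps.
exact: (@complete_cauchy C_CompleteNormedModule (filtermap u eventually) pf ca eps).
Qed.

Lemma Re_le_Cmod z : Rabs (fst z) <= Cmod z.
Proof. by have := Rmax_Cmod z; have := Rmax_l (Rabs (fst z)) (Rabs (snd z)); lra. Qed.

Lemma Im_le_Cmod z : Rabs (snd z) <= Cmod z.
Proof. by have := Rmax_Cmod z; have := Rmax_r (Rabs (fst z)) (Rabs (snd z)); lra. Qed.

Lemma ex_series_dom (a b : nat -> R) : (forall n, Rabs (a n) <= b n) -> ex_series b -> ex_series (fun n => Rabs (a n)).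
Proof.
move=> h; apply: (@ex_series_le R_AbsRing R_CompleteNormedModule) => n.
by rewrite /norm /= /abs /= Rabs_Rabsolu.
Qed.

Lemma seriesC_dom (a : nat -> C) (b : nat -> R) : (forall n, Cmod (a n) <= b n) -> ex_series b ->
  exists s, is_seriesC a s.
Proof.
move=> h hb.
have e1 : ex_series (fun n => fst (a n)).
  by apply/ex_series_Rabs/(ex_series_dom _ hb) => n; apply: Rle_trans (Re_le_Cmod _) (h n).
have e2 : ex_series (fun n => snd (a n)).
  by apply/ex_series_Rabs/(ex_series_dom _ hb) => n; apply: Rle_trans (Im_le_Cmod _) (h n).
case: e1 => s1 h1; case: e2 => s2 h2; exists (s1, s2); exact/seriesC_split.
Qed.

Lemma series_le_bound (a b : nat -> R) s t : is_series a s -> is_series b t ->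
  (forall n, Rabs (a n) <= b n) -> Rabs s <= t.
Proof.
move=> ha hb h; have ea : ex_series (fun n => Rabs (a n)) by apply: ex_series_dom h _; exists t.
rewrite -(is_series_unique _ _ ha) -(is_series_unique _ _ hb).
apply: Rle_trans (Series_Rabs _ ea) _; apply: Series_le; last by exists t.
by move=> n; split=> //; exact: Rabs_pos.
Qed.

Lemma is_series_finite (a : nat -> R) M : (forall n, (M < n)%N -> a n = 0) -> is_series a (sum_n a M).
Proof.
move=> h; apply/filterlim_locally => eps; exists M => n hn.
have -> : sum_n a n = sum_n a M.
  elim: n hn => [|n IH] hn; first by rewrite (_ : M = 0%N) //; lia.
  case: (leqP M n) => hM; last by rewrite (_ : M = n.+1) //; lia.
  rewrite sum_Sn IH; last lia.
  by rewrite h //; exact: Rplus_0_r.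
exact: ball_center.
Qed.

Lemma sum_n_le_series (a : nat -> R) s n : is_series a s -> (forall n, 0 <= a n) -> sum_n a n <= s.
Proof.
move=> h p; apply: (is_lim_seq_incr_compare (sum_n a)) => // k.
by rewrite sum_Sn; have := p k.+1; rewrite /plus /=; lra.
Qed.

Lemma sum_f_R0_foldr (F : nat -> R) n : sum_f_R0 F n = foldr (fun k acc => F k + acc) 0 (iota 0 n.+1).
Proof.
have cat (l : seq nat) k : foldr (fun k acc => F k + acc) 0 (l ++ [:: k]) = foldr (fun k acc => F k + acc) 0 l + F k.
  by elim: l => /= [|x l ->]; ring.
by elim: n => [|n IH]; [rewrite /=; ring|rewrite tech5 IH (iota_rcons 0 n.+1) cat].
Qed.

Lemma Cauchy_productC (a b : nat -> C) s t : is_seriesC a s -> is_seriesC b t ->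
  ex_series (fun n => Cmod (a n)) -> ex_series (fun n => Cmod (b n)) ->
  is_seriesC (fun n => Csum (iota 0 n.+1) (fun k => Cmult (a k) (b (n - k)%N))) (Cmult s t).
Proof.
move=> /seriesC_split [a1 a2] /seriesC_split [b1 b2] ea eb.
have ab (u : nat -> C) (p : C -> R) : (forall z, Rabs (p z) <= Cmod z) -> ex_series (fun n => Cmod (u n)) ->
   ex_series (fun n => Rabs (p (u n))) by move=> hp; apply: ex_series_dom.
have A1 := ab a fst Re_le_Cmod ea; have A2 := ab a snd Im_le_Cmod ea.
have B1 := ab b fst Re_le_Cmod eb; have B2 := ab b snd Im_le_Cmod eb.
have c1 := is_series_mult _ _ _ _ a1 b1 A1 B1; have c2 := is_series_mult _ _ _ _ a2 b2 A2 B2.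
have c3 := is_series_mult _ _ _ _ a1 b2 A1 B2; have c4 := is_series_mult _ _ _ _ a2 b1 A2 B1.
have mi (x y : R) : minus x y = x - y by [].
have pl (x y : R) : plus x y = x + y by [].
apply/seriesC_split; split.
  have q : is_series (fun n : nat => minus (sum_f_R0 (fun k : nat => fst (a k) * fst (b (n - k)%coq_nat)) n)
     (sum_f_R0 (fun k : nat => snd (a k) * snd (b (n - k)%coq_nat)) n)) (fst (Cmult s t)).
    exact: (is_series_minus _ _ _ _ c1 c2).
  apply: is_series_ext q => n; rewrite mi !sum_f_R0_foldr.
  elim: (iota 0 n.+1) => /= [|k l IH]; first by ring.
  by rewrite -IH -/(subn n k); ring.
have q : is_series (fun n : nat => plus (sum_f_R0 (fun k : nat => fst (a k) * snd (b (n - k)%coq_nat)) n)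
   (sum_f_R0 (fun k : nat => snd (a k) * fst (b (n - k)%coq_nat)) n)) (snd (Cmult s t)).
  exact: (is_series_plus _ _ _ _ c3 c4).
apply: is_series_ext q => n; rewrite pl !sum_f_R0_foldr.
elim: (iota 0 n.+1) => /= [|k l IH]; first by ring.
by rewrite -IH -/(subn n k); ring.
Qed.

Lemma Cpow_nat_add z m n : Cpow_nat z (m + n) = Cmult (Cpow_nat z m) (Cpow_nat z n).
Proof. by elim: m => [|m IH] /=; [rewrite Cmult_1_l|rewrite IH; ring]. Qed.

Lemma Cmod_pow_nat z n : Cmod (Cpow_nat z n) = Cmod z ^ n.
Proof. by elim: n => [|n IH] /=; rewrite ?Cmod_1 // Cmod_mult IH. Qed.

Lemma RtoC_Zsum (T : Type) (s : seq T) (F : T -> Z) : RtoC (IZR (Zsum s F)) = Csum s (fun x => RtoC (IZR (F x))).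
Proof. by elim: s => //= x s IH; rewrite -IH plus_IZR RtoC_plus. Qed.

(** A bound for the weighted l^1 norm of A at radius rho. The norm is submultiplicative, which
    controls products of arbitrary length. *)
Definition abs_bound (A : nat -> Z) (rho b : R) : Prop :=
  exists2 s, is_series (fun j => Rabs (IZR (A j)) * rho ^ j) s & s <= b.

Definition ps_val (A : nat -> Z) (z v : C) : Prop :=
  is_seriesC (fun j => Cmult (RtoC (IZR (A j))) (Cpow_nat z j)) v.

Lemma ps_mul_abs A B rho j : 0 <= rho -> Rabs (IZR (ps_mul A B j)) * rho ^ j <=
  sum_f_R0 (fun k => (Rabs (IZR (A k)) * rho ^ k) * (Rabs (IZR (B (j - k)%coq_nat)) * rho ^ (j - k)%coq_nat)) j.
Proof.
move=> r0; rewrite sum_f_R0_foldr /ps_mul.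
have : {subset iota 0 j.+1 <= iota 0 j.+1} by [].
elim: {1 3 4}(iota 0 j.+1) => [|k l IH] sub; first by rewrite /= Rabs_R0; lra.
rewrite Zsum_cons plus_IZR mult_IZR [foldr _ _ _]/=.
have kj : (k <= j)%N by have := sub k (mem_head _ _); rewrite mem_iota; lia.
have := IH (fun x h => sub x (mem_behead (s:=k::l) h)) => {}IH.
have e : rho ^ j = rho ^ k * rho ^ (j - k) by rewrite -pow_add; congr pow; lia.
have := Rabs_triang (IZR (A k) * IZR (B (j - k)%N)) (IZR (Zsum l (fun i => (A i * B (j - i)%N)%Z))).
rewrite Rabs_mult => tr.
have p0 := pow_le _ j r0.
have : Rabs (IZR (A k)) * Rabs (IZR (B (j - k)%N)) * rho ^ j =
  (Rabs (IZR (A k)) * rho ^ k) * (Rabs (IZR (B (j - k)%N)) * rho ^ (j - k)) by rewrite e; ring.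
rewrite -/(subn j k) => e2.
have : Rabs (IZR (A k) * IZR (B (j - k)%N) + IZR (Zsum l (fun i => (A i * B (j - i)%N)%Z))) * rho ^ j <=
  (Rabs (IZR (A k)) * Rabs (IZR (B (j - k)%N)) + Rabs (IZR (Zsum l (fun i => (A i * B (j - i)%N)%Z)))) * rho ^ j.
  by apply: Rmult_le_compat_r.
rewrite Rmult_plus_distr_r e2; lra.
Qed.

Lemma abs_bound_mul A B rho a b : 0 <= rho -> abs_bound A rho a -> abs_bound B rho b ->
  abs_bound (ps_mul A B) rho (a * b).
Proof.
move=> r0 [s hs sa] [t ht tb].
have nn (D : nat -> Z) j : 0 <= Rabs (IZR (D j)) * rho ^ j by apply: Rmult_le_pos; [exact: Rabs_pos|exact: pow_le].
have ab (D : nat -> Z) u : is_series (fun j => Rabs (IZR (D j)) * rho ^ j) u -> ex_series (fun j => Rabs (Rabs (IZR (D j)) * rho ^ j)).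
  by move=> h; exists u; apply: is_series_ext h => j; rewrite (Rabs_pos_eq (_ * _)) //; exact: nn.
have c := is_series_mult _ _ _ _ hs ht (ab _ _ hs) (ab _ _ ht).
have ex : ex_series (fun j => Rabs (IZR (ps_mul A B j)) * rho ^ j).
  apply: (@ex_series_le R_AbsRing R_CompleteNormedModule) (ex_intro _ _ c) => j.
  by rewrite /norm /= /abs /= Rabs_pos_eq //; exact: ps_mul_abs.
exists (Series (fun j => Rabs (IZR (ps_mul A B j)) * rho ^ j)); first exact: Series_correct.
have s0 : 0 <= s by apply: Rle_trans (sum_n_le_series 0 hs (nn A)); rewrite sum_O; exact: nn.
have t0 : 0 <= t by apply: Rle_trans (sum_n_le_series 0 ht (nn B)); rewrite sum_O; exact: nn.
apply: Rle_trans (_ : s * t <= _); last by apply: Rmult_le_compat.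
rewrite -(is_series_unique _ _ c); apply: Series_le; last by exists (s * t).
by move=> j; split; [exact: nn|exact: ps_mul_abs].
Qed.

Lemma abs_bound_ex A z b : abs_bound A (Cmod z) b ->
  ex_series (fun j => Cmod (Cmult (RtoC (IZR (A j))) (Cpow_nat z j))).
Proof.
by move=> [s hs _]; exists s; apply: is_series_ext hs => j; rewrite Cmod_mult Cmod_R Cmod_pow_nat.
Qed.

Lemma ps_val_mul A B z a b v w : abs_bound A (Cmod z) a -> abs_bound B (Cmod z) b ->
  ps_val A z v -> ps_val B z w -> ps_val (ps_mul A B) z (Cmult v w).
Proof.
move=> hA hB hv hw; have := Cauchy_productC hv hw (abs_bound_ex hA) (abs_bound_ex hB).
apply: seriesC_ext => j; rewrite /ps_mul RtoC_Zsum Cmult_comm -CsumMl.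
apply: eq_Csum_in => k; rewrite mem_iota => hk.
have e : Cpow_nat z j = Cmult (Cpow_nat z k) (Cpow_nat z (j - k)) by rewrite -Cpow_nat_add; congr Cpow_nat; lia.
by rewrite e mult_IZR RtoC_mult; ring.
Qed.

Lemma abs_bound_le A rho a b : a <= b -> abs_bound A rho a -> abs_bound A rho b.
Proof. by move=> ab [s hs sa]; exists s => //; lra. Qed.

Lemma ps_val_ext A B z v : A =1 B -> ps_val A z v -> ps_val B z v.
Proof. by move=> e; apply: seriesC_ext => j; rewrite e. Qed.

Lemma seriesC_finite (a : nat -> C) M : (forall n, (M < n)%N -> a n = RtoC 0) -> is_seriesC a (Csum (iota 0 M.+1) a).
Proof.
move=> h; apply/filterlim_locally => eps; exists M => n hn; rewrite sum_n_Csum.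
have -> : n.+1 = (M.+1 + (n - M))%N by move/leP: hn => hn; lia.
rewrite iotaD Csum_cat [X in Cplus _ X](_ : _ = RtoC 0) ?Cplus_0_r; first exact: ball_center.
rewrite -[RHS](Csum_0 (iota (0 + M.+1) (n - M))); apply: eq_Csum_in => k; rewrite mem_iota => hk.
by apply: h; lia.
Qed.

Lemma ps_val_one z : ps_val ps_one z (RtoC 1).
Proof.
have := @seriesC_finite (fun j => Cmult (RtoC (IZR (ps_one j))) (Cpow_nat z j)) 0.
rewrite /= !Cmult_1_l Cplus_0_r; apply=> -[//|n _].
by rewrite /= Cmult_0_l.
Qed.

Lemma abs_bound_one rho : abs_bound ps_one rho 1.
Proof.
exists 1; last lra.
have := @is_series_finite (fun j => Rabs (IZR (ps_one j)) * rho ^ j) 0.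
rewrite sum_O /= Rabs_R1 Rmult_1_l; apply=> -[//|n _].
by rewrite /= Rabs_R0 Rmult_0_l.
Qed.

Section Factor.
Variable k : nat.
Hypothesis k0 : (0 < k)%N.

Lemma omx_rec j : one_minus_X k j = ((if j == 0%N then 1 else 0) - (if j == k then 1 else 0))%Z.
Proof.
rewrite /one_minus_X; case: (j =P 0%N) => [->|_]; first by rewrite (_ : (0 == k)%N = false) //; lia.
by case: eqP.
Qed.

Lemma Zsum_delta (c n : nat) (F : nat -> Z) :
  Zsum (iota 0 n) (fun i : nat => (if i == c then 1 else 0) * F i)%Z = (if (c < n)%N then F c else 0%Z).
Proof.
have cat (l : seq nat) (x : nat) (G : nat -> Z) : Zsum (l ++ [:: x]) G = (Zsum l G + G x)%Z.
  by elim: l => [|i l IH]; rewrite ?cat0s ?cat_cons !Zsum_cons ?IH /Zsum /=; ring.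
elim: n => [//|n IH]; rewrite (iota_rcons 0 n) cat add0n IH ltnS.
by case: (ltngtP c n) => [h|h|->]; rewrite ?eqxx; ring.
Qed.

Lemma omx_geom : ps_mul (one_minus_X k) (geomX k) =1 ps_one.
Proof.
move=> j; rewrite /ps_mul.
transitivity (Zsum (iota 0 j.+1) (fun i => (if i == 0%N then 1 else 0) * geomX k (j - i))%Z -
   Zsum (iota 0 j.+1) (fun i => (if i == k then 1 else 0) * geomX k (j - i))%Z)%Z.
  elim: (iota 0 j.+1) => [//|i l IH]; rewrite !Zsum_cons IH omx_rec; ring.
rewrite !Zsum_delta ltn0Sn subn0 /geomX /ps_one ltnS; case: leqP => kj.
  rewrite -[in X in (_ - X)%Z](dvdn_addl (j - k) (dvdnn k)) subnK // Z.sub_diag.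
  by rewrite (_ : (j == 0)%N = false) //; lia.
case: (j =P 0%N) => [->|/eqP jn]; first by rewrite dvdn0.
by rewrite gtnNdvd //; lia.
Qed.

Lemma abs_bound_omx rho : 0 <= rho -> abs_bound (one_minus_X k) rho (1 + rho ^ k).
Proof.
move=> r0; pose F (a j : nat) := if j == a then rho ^ j else 0.
have sF a : is_series (F a) (rho ^ a).
  have := @is_series_finite (F a) a; rewrite (_ : sum_n (F a) a = rho ^ a).
    by apply=> n an; rewrite /F; case: eqP => // e; lia.
  rewrite sum_n_Reals; case: a => [|a]; first by rewrite /= /F.
  rewrite tech5 (_ : sum_f_R0 _ a = 0) ?Rplus_0_l /F ?eqxx //.
  rewrite (PartSum.sum_eq _ (fun _ => 0)); first by rewrite sum_cte; ring.
  by move=> i ia; case: eqP => // e; lia.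
exists (1 + rho ^ k); last lra.
apply: is_series_ext (is_series_plus _ _ _ _ (sF 0%N) (sF k)) => j.
change (F 0%N j + F k j = Rabs (IZR (one_minus_X k j)) * rho ^ j).
rewrite /F /one_minus_X; case: (j =P 0%N) => [->|_].
  by rewrite (_ : (0 == k)%N = false) ?Rabs_R1 /=; [ring|lia].
case: eqP => _; first by rewrite (_ : Rabs (-1) = 1) ?Rabs_left; lra.
by rewrite Rabs_R0; ring.
Qed.

Lemma ps_val_omx z : ps_val (one_minus_X k) z (Cminus (RtoC 1) (Cpow_nat z k)).
Proof.
have := @seriesC_finite (fun j => Cmult (RtoC (IZR (one_minus_X k j))) (Cpow_nat z j)) k.
rewrite (_ : Csum _ _ = Cminus (RtoC 1) (Cpow_nat z k)).
  apply=> n kn; rewrite /one_minus_X (_ : (n == 0)%N = false); last lia.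
  by rewrite (_ : (n == k)%N = false); [rewrite Cmult_0_l|lia].
rewrite (iota_rcons 0 k) -(prednK k0) [iota 0 k.-1.+1]/= Csum_cat /= add0n Cplus_0_r.
rewrite Cmult_1_l (_ : Csum _ _ = RtoC 0).
  rewrite prednK // /one_minus_X eqxx (_ : (k == 0)%N = false); last lia.
  have m1 : RtoC (-1) = Copp (RtoC 1) by rewrite -RtoC_opp.
  by rewrite m1; ring.
rewrite -[RHS](Csum_0 (iota 1 k.-1)); apply: eq_Csum_in => i; rewrite mem_iota => hi.
rewrite /one_minus_X (_ : (i == 0)%N = false); last lia.
by rewrite (_ : (i == k.-1.+1)%N = false); [rewrite Cmult_0_l|lia].
Qed.

Lemma abs_bound_geom_ex rho : 0 <= rho < 1 -> exists b, abs_bound (geomX k) rho b.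
Proof.
move=> hr; have [s hs] : ex_series (fun j => Rabs (IZR (geomX k j)) * rho ^ j).
  apply: (@ex_series_le R_AbsRing R_CompleteNormedModule _ (fun j => rho ^ j)).
    move=> j; rewrite /norm /= /abs /= Rabs_mult Rabs_Rabsolu (Rabs_pos_eq (rho ^ j)); last by apply: pow_le; lra.
    have := pow_le rho j (proj1 hr); rewrite /geomX; case: ifP => _; rewrite ?Rabs_R1 ?Rabs_R0; lra.
  by exists (/ (1 - rho)); apply: is_series_geom; rewrite Rabs_pos_eq; lra.
by exists s, s => //; lra.
Qed.

(** Evaluating the formal identity (1 - X^k) geomX = 1 at z gives both the nonvanishing and the
    inverse. *)
Lemma ps_val_geom z : Cmod z < 1 -> Cminus (RtoC 1) (Cpow_nat z k) <> RtoC 0 /\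
  ps_val (geomX k) z (Cinv (Cminus (RtoC 1) (Cpow_nat z k))).
Proof.
move=> hz; have z0 := Cmod_ge_0 z.
have [b hb] := abs_bound_geom_ex (conj z0 hz).
have [v hv] : exists v, ps_val (geomX k) z v.
  by apply: seriesC_dom (abs_bound_ex hb) => n; lra.
have := ps_val_mul (abs_bound_omx z0) hb (@ps_val_omx z) hv.
move/(ps_val_ext omx_geom) => h; have e := seriesC_unique h (ps_val_one z).
have n0 : Cminus (RtoC 1) (Cpow_nat z k) <> RtoC 0.
  by move=> e0; rewrite e0 Cmult_0_l in e; have := C1_nz; rewrite e.
split=> //; rewrite (_ : Cinv _ = v) //.
move: (Cminus _ _) n0 e => w n0 e.
by transitivity (Cmult (Cinv w) (Cmult w v)); [rewrite e Cmult_1_r|field].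
Qed.

Lemma RtoC_pow x n : Cpow_nat (RtoC x) n = RtoC (x ^ n).
Proof. by elim: n => //= n ->; rewrite RtoC_mult. Qed.

(** The coefficients are nonnegative, so the norm is the value at rho. *)
Lemma abs_bound_geom rho : 0 <= rho < 1 -> abs_bound (geomX k) rho (/ (1 - rho ^ k)).
Proof.
move=> hr; have p1 : rho ^ k < 1.
  by apply: (proj2 (pow_lt_1_compat _ _ hr _)); lia.
have [b [s hs _]] := abs_bound_geom_ex hr; exists s => //.
have mz : Cmod (RtoC rho) < 1 by rewrite Cmod_R Rabs_pos_eq; lra.
have [_ /seriesC_split [h _]] := ps_val_geom mz.
rewrite RtoC_pow -RtoC_minus -RtoC_inv in h; last lra.
have h2 : is_series (fun j => Rabs (IZR (geomX k j)) * rho ^ j) (/ (1 - rho ^ k)).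
  apply: is_series_ext h => j; rewrite RtoC_pow -RtoC_mult /= /geomX; case: ifP; rewrite ?Rabs_R1 ?Rabs_R0 //.
by rewrite -(is_series_unique _ _ hs) -(is_series_unique _ _ h2); lra.
Qed.

Lemma ps_pow_bound A rho b e : 0 <= rho -> abs_bound A rho b -> abs_bound (ps_pow A e) rho (b ^ e).
Proof.
by move=> r0 h; elim: e => [|e IH]; [exact: abs_bound_one|exact: abs_bound_mul].
Qed.

Lemma ps_pow_val A z b v e : abs_bound A (Cmod z) b -> ps_val A z v -> ps_val (ps_pow A e) z (Cpow_nat v e).
Proof.
move=> hb hv; elim: e => [|e IH]; first exact: ps_val_one.
apply: (ps_val_mul hb _ hv IH); exact: (ps_pow_bound _ (Cmod_ge_0 z) hb).
Qed.

Lemma Cpow_nat_inv v n : v <> RtoC 0 -> Cpow_nat (Cinv v) n = Cinv (Cpow_nat v n).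
Proof.
move=> v0; elim: n => [|n IH] /=; first by field; exact: C1_nz.
by rewrite IH; field; split=> //; exact: Cpow_nat_neq0.
Qed.

Lemma factor_pow_val e z : Cmod z < 1 -> ps_val (factor_pow k e) z (CpowZ (Cminus (RtoC 1) (Cpow_nat z k)) e).
Proof.
move=> hz; have [n0 hg] := ps_val_geom hz; have z0 := Cmod_ge_0 z.
case: e => [|p|p]; rewrite /factor_pow /CpowZ.
- exact: ps_val_one.
- apply: ps_pow_val (@ps_val_omx z); exact: abs_bound_omx.
by rewrite -Cpow_nat_inv //; apply: ps_pow_val hg; apply: abs_bound_geom.
Qed.

(** The bound has exponential form so that the bounds of many factors multiply to the exponential of
    a geometric sum. *)
Lemma factor_pow_bound e rho : 0 <= rho < 1 ->
  abs_bound (factor_pow k e) rho (exp (IZR (Z.abs e) * rho ^ k / (1 - rho))).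
Proof.
move=> hr; have p0 := pow_le _ k (proj1 hr).
have p1 : rho ^ k <= rho.
  rewrite -(prednK k0) /=; have := pow_incr rho 1 k.-1 ltac:(lra); rewrite pow1.
  by have := pow_le _ k.-1 (proj1 hr); nra.
set x := rho ^ k in p0 p1 *.
have q0 : x <= x / (1 - rho).
  apply: (Rmult_le_reg_r (1 - rho)); first lra.
  by rewrite /Rdiv Rmult_assoc Rinv_l ?Rmult_1_r; [nra|lra].
have b1 : 1 + x <= exp (x / (1 - rho)) by have := exp_ineq1_le (x / (1 - rho)); lra.
have b2 : / (1 - x) <= exp (x / (1 - rho)).
  apply: Rle_trans (exp_ineq1_le _).
  have -> : / (1 - x) = 1 + x / (1 - x) by field; lra.
  apply: Rplus_le_compat_l; apply: Rmult_le_compat_l => //; apply: Rinv_le_contravar; lra.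
have pw A n : abs_bound A rho (exp (x / (1 - rho))) -> abs_bound (ps_pow A n) rho (exp (INR n * x / (1 - rho))).
  move=> h; have := ps_pow_bound n (proj1 hr) h.
  rewrite (_ : exp _ ^ n = exp (INR n * x / (1 - rho))) //.
  elim: n {h} => [|n IH]; first by rewrite /= /Rdiv !Rmult_0_l exp_0.
  by rewrite S_INR /= IH -exp_plus; congr exp; field; lra.
case: e => [|p|p]; rewrite /factor_pow /Z.abs.
- by apply: abs_bound_le (abs_bound_one rho); rewrite /Rdiv !Rmult_0_l exp_0; lra.
- rewrite -(positive_nat_Z p) -INR_IZR_INZ Nat2Z.id.
  by apply: pw; apply: abs_bound_le b1 _; apply: abs_bound_omx; lra.
rewrite -(positive_nat_Z p) -INR_IZR_INZ.
by apply: pw; apply: abs_bound_le b2 _; exact: abs_bound_geom.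
Qed.

Lemma factor_pow_low e j : (j < k)%N -> factor_pow k e j = ps_one j.
Proof.
have lo A n : (forall i, (i < k)%N -> A i = ps_one i) -> forall i, (i < k)%N -> ps_pow A n i = ps_one i.
  move=> hA; elim: n => [//|n IH] i ik /=; rewrite /ps_mul.
  transitivity (Zsum (iota 0 i.+1) (fun m => (if m == 0%N then 1 else 0) * ps_one (i - m)%N)%Z).
    apply: eq_Zsum => m; rewrite mem_iota => hm; rewrite hA; last lia.
    by rewrite IH //; lia.
  by rewrite Zsum_delta subn0.
move=> jk; rewrite /factor_pow; case: e => [//|p|p]; apply: lo => // i ik.
  by rewrite /one_minus_X /ps_one; case: eqP => // _; rewrite (_ : (i == k) = false) //; lia.
rewrite /geomX /ps_one; case: (i =P 0%N) => [->|/eqP i0]; first by rewrite dvdn0.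
by rewrite gtnNdvd //; lia.
Qed.
End Factor.

Definition fprod (s : seq (nat * Z)) : nat -> Z :=
  foldr (fun p acc => ps_mul (factor_pow p.1 p.2) acc) ps_one s.

Definition wsum (rho : R) (s : seq (nat * Z)) : R :=
  foldr (fun p acc => IZR (Z.abs p.2) * rho ^ p.1 + acc) 0 s.

Lemma fprod_bound s rho : 0 <= rho < 1 -> all (fun p : nat * Z => 0 < p.1)%N s ->
  abs_bound (fprod s) rho (exp (wsum rho s / (1 - rho))).
Proof.
move=> hr; elim: s => [_|[k e] s IH] /=.
  by apply: abs_bound_le (abs_bound_one rho); rewrite /Rdiv Rmult_0_l exp_0; lra.
move=> /andP [k0 hs]; rewrite /Rdiv Rmult_plus_distr_r exp_plus.
by apply: abs_bound_mul; [lra|exact: factor_pow_bound|exact: IH].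
Qed.

Lemma fprod_val s z : Cmod z < 1 -> all (fun p : nat * Z => 0 < p.1)%N s ->
  ps_val (fprod s) z (Cprod s (fun p => CpowZ (Cminus (RtoC 1) (Cpow_nat z p.1)) p.2)).
Proof.
move=> hz; have z0 := Cmod_ge_0 z; elim: s => [_|[k e] s IH] /=; first exact: ps_val_one.
move=> /andP [k0 hs]; apply: (ps_val_mul (@factor_pow_bound k k0 e _ (conj z0 hz)) (fprod_bound (conj z0 hz) hs)).
  exact: factor_pow_val.
exact: IH.
Qed.

Lemma ps_mul_low A A' B B' i : (forall m, (m <= i)%N -> A m = A' m) -> (forall m, (m <= i)%N -> B m = B' m) ->
  ps_mul A B i = ps_mul A' B' i.
Proof.
by move=> hA hB; apply: eq_Zsum => m; rewrite mem_iota => hm; rewrite hA ?hB //; lia.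
Qed.

Lemma ps_mul1 B i : ps_mul ps_one B i = B i.
Proof. by rewrite /ps_mul Zsum_delta subn0. Qed.

(** A factor with k > j is 1 + O(X^(j+1)) and does not affect the coefficients up to j. *)
Lemma fprod_filter j s i : (i <= j)%N -> all (fun p : nat * Z => 0 < p.1)%N s ->
  fprod s i = fprod [seq p <- s | p.1 <= j]%N i.
Proof.
elim: s i => [//|[k e] s IH] i ij /= /andP [k0 hs]; case: leqP => kj /=.
  by apply: ps_mul_low => // m mi; apply: IH => //; lia.
rewrite -IH // -[RHS]ps_mul1; apply: ps_mul_low => // m mi.
by apply: factor_pow_low => //; lia.
Qed.

Definition eta_list (ns : seq nat) (e : nat -> Z) (M : nat) : seq (nat * Z) :=
  flatten [seq [seq ((n * m)%N, e n) | m <- iota 1 M] | n <- ns].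

Lemma eta_list_pos ns e M : all (fun n : nat => 0 < n)%N ns -> all (fun p : nat * Z => 0 < p.1)%N (eta_list ns e M).
Proof.
elim: ns => //= n ns IH /andP [n0 h]; rewrite all_cat IH // andbT all_map; apply/allP => m /=.
by rewrite mem_iota muln_gt0 n0; lia.
Qed.

Lemma eta_list_filter ns e j M : (j <= M)%N -> all (fun n : nat => 0 < n)%N ns ->
  [seq p <- eta_list ns e M | p.1 <= j]%N = [seq p <- eta_list ns e j | p.1 <= j]%N.
Proof.
move=> jM; elim: ns => //= n ns IH /andP [n0 h]; rewrite /eta_list /= !filter_cat -/(eta_list _ _ _) IH //.
congr cat; rewrite -(subnKC jM) iotaD map_cat filter_cat [X in _ ++ X](_ : _ = [::]) ?cats0 //.
rewrite filter_map [X in map _ X](_ : _ = [::]) //.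
apply/eqP; rewrite -[_ == _]negbK -has_filter; apply/hasPn => m; rewrite mem_iota => hm /=.
by rewrite -ltnNge; apply: leq_trans (leq_pmull m n0); lia.
Qed.

Lemma fprod_stable ns e j M : (j <= M)%N -> all (fun n : nat => 0 < n)%N ns ->
  fprod (eta_list ns e M) j = fprod (eta_list ns e j) j.
Proof.
move=> jM h; rewrite (fprod_filter (leqnn j)) ?eta_list_pos // eta_list_filter // -fprod_filter //.
exact: eta_list_pos.
Qed.

Lemma eta_coefE r N j : eta_coef r N j = fprod (eta_list (divisors N) r j) j.
Proof.
rewrite /eta_coef /fprod /eta_list; congr (_ j); elim: (divisors N) => //= n ns ->.
by rewrite foldr_cat foldr_map.
Qed.

(** A geometric series bounds the contribution of each n, uniformly in the truncation M. *)
Lemma wsum_eta_list ns e M rho : 0 <= rho < 1 -> all (fun n : nat => 0 < n)%N ns ->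
  wsum rho (eta_list ns e M) <= foldr (fun n acc => IZR (Z.abs (e n)) + acc) 0 ns / (1 - rho).
Proof.
move=> hr; have geo n (a : nat) : (0 < n)%N -> wsum rho [seq ((n * m)%N, e n) | m <- iota a M] <= IZR (Z.abs (e n)) * (rho ^ a / (1 - rho)).
  have e0 : 0 <= IZR (Z.abs (e n)) by apply: IZR_le; exact: Z.abs_nonneg.
  move=> n0; elim: M a => [|M IH] a /=.
    by apply: Rmult_le_pos => //; apply: Rdiv_le_0_compat; [apply: pow_le|]; lra.
  have := IH a.+1.
  have e1 : rho ^ a / (1 - rho) = rho ^ a + rho ^ a.+1 / (1 - rho) by rewrite /=; field; lra.
  have : rho ^ (n * a) <= rho ^ a.
    have -> : (n * a = a + n.-1 * a)%N by rewrite -{1}(prednK n0) mulSn.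
    rewrite pow_add -{2}(Rmult_1_r (rho ^ a)); apply: Rmult_le_compat_l; first by apply: pow_le; lra.
    by rewrite -(pow1 (n.-1 * a)); apply: pow_incr; lra.
  by move=> /(Rmult_le_compat_l _ _ _ e0); rewrite e1 Rmult_plus_distr_l; lra.
have wcat s t : wsum rho (s ++ t) = wsum rho s + wsum rho t by elim: s => /= [|p s ->]; ring.
elim: ns => /= [_|n ns IH /andP [n0 h]]; first by rewrite /Rdiv Rmult_0_l; lra.
rewrite /eta_list /= wcat -/(eta_list _ _ _) /Rdiv Rmult_plus_distr_r; apply: Rplus_le_compat; last exact: IH.
apply: Rle_trans (geo n 1%N n0) _; apply: Rmult_le_compat_l; first by apply: IZR_le; exact: Z.abs_nonneg.
rewrite pow_1 /Rdiv -{2}(Rmult_1_l (/ _)); apply: Rmult_le_compat_r; last lra.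
by apply: Rlt_le; apply: Rinv_0_lt_compat; lra.
Qed.

Lemma abs_bound_coef A rho b j : 0 <= rho -> abs_bound A rho b -> Rabs (IZR (A j)) * rho ^ j <= b.
Proof.
move=> r0 [s hs sb]; apply: Rle_trans sb.
have nn i : 0 <= Rabs (IZR (A i)) * rho ^ i by apply: Rmult_le_pos; [exact: Rabs_pos|exact: pow_le].
apply: Rle_trans (sum_n_le_series j hs nn); case: j => [|j]; first by rewrite sum_O; lra.
rewrite sum_Sn; change (Rabs (IZR (A j.+1)) * rho ^ j.+1 <= sum_n (fun i => Rabs (IZR (A i)) * rho ^ i) j + Rabs (IZR (A j.+1)) * rho ^ j.+1).
have : 0 <= sum_n (fun i => Rabs (IZR (A i)) * rho ^ i) j; last lra.
elim: j => [|j IH]; first by rewrite sum_O.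
by rewrite sum_Sn; apply: Rplus_le_le_0_compat.
Qed.

(* Tail estimate: with |z| <= x^3 the terms are dominated by [B x^(2j) <= B x^M x^j] for [j >= M]. *)
Lemma ps_val_tail A z v x B M : 0 <= x < 1 -> Cmod z <= x * x * x ->
  (forall j, Rabs (IZR (A j)) * x ^ j <= B) -> ps_val A z v ->
  Cmod (Cminus v (Csum (iota 0 M.+1) (fun j => Cmult (RtoC (IZR (A j))) (Cpow_nat z j)))) <= 2 * (B * x ^ M / (1 - x)).
Proof.
move=> hx hz hB hv.
have B0 : 0 <= B by apply: Rle_trans (hB 0%N); rewrite /= Rmult_1_r; exact: Rabs_pos.
pose a j := Cmult (RtoC (IZR (A j))) (Cpow_nat z j).
pose a1 j := if (j <= M)%N then a j else RtoC 0.
have h1 : is_seriesC a1 (Csum (iota 0 M.+1) a).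
  rewrite (_ : Csum _ a = Csum (iota 0 M.+1) a1); last first.
    by apply: eq_Csum_in => j; rewrite mem_iota /a1 => hj; rewrite (_ : (j <= M)%N) //; lia.
  by apply: seriesC_finite => n Mn; rewrite /a1 leqNgt Mn.
have m1 : RtoC (-1) = Copp (RtoC 1) by rewrite -RtoC_opp.
have h2 := seriesC_plus hv (@seriesC_scal _ _ (RtoC (-1)) h1).
rewrite (_ : Cminus v _ = Cplus v (Cmult (RtoC (-1)) (Csum (iota 0 M.+1) a))); last by rewrite m1 /a; ring.
have xM := pow_le _ M (proj1 hx).
have bd j : Cmod (Cplus (a j) (Cmult (RtoC (-1)) (a1 j))) <= B * x ^ M * x ^ j.
  have xj := pow_le _ j (proj1 hx).
  rewrite /a1; case: leqP => jM.
    rewrite (_ : Cplus _ _ = RtoC 0); last by rewrite m1; ring.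
    by rewrite Cmod_0; apply: Rmult_le_pos => //; apply: Rmult_le_pos.
  rewrite Cmult_0_r Cplus_0_r /a Cmod_mult Cmod_R Cmod_pow_nat.
  apply: Rle_trans (_ : Rabs (IZR (A j)) * (x * x * x) ^ j <= _).
    apply: Rmult_le_compat_l; first exact: Rabs_pos.
    by apply: pow_incr; split=> //; exact: Cmod_ge_0.
  rewrite !Rpow_mult_distr (_ : Rabs _ * _ = Rabs (IZR (A j)) * x ^ j * (x ^ j * x ^ j)); last ring.
  apply: Rle_trans (_ : B * (x ^ j * x ^ j) <= _).
    by apply: Rmult_le_compat_r => //; apply: Rmult_le_pos.
  rewrite Rmult_assoc; apply: Rmult_le_compat_l => //; apply: Rmult_le_compat_r => //.
  have -> : (j = M + (j - M))%N by lia.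
  rewrite pow_add -[X in _ <= X]Rmult_1_r; apply: Rmult_le_compat_l => //.
  by rewrite -(pow1 (j - M)); apply: pow_incr; lra.
have h3 : is_series (fun j => B * x ^ M * x ^ j) (B * x ^ M / (1 - x)).
  have := is_series_scal (B * x ^ M) _ _ (is_series_geom x _); apply.
  by rewrite Rabs_pos_eq; lra.
have /seriesC_split [p1 p2] := h2.
have q1 := series_le_bound p1 h3 (fun j => Rle_trans _ _ _ (Re_le_Cmod _) (bd j)).
have q2 := series_le_bound p2 h3 (fun j => Rle_trans _ _ _ (Im_le_Cmod _) (bd j)).
apply: Rle_trans (Cmod_2Rmax _) _.
have s2 : sqrt 2 <= 2 by rewrite -{2}(sqrt_square 2); [apply: sqrt_le_1|]; lra.
apply: Rmult_le_compat => //; [exact: sqrt_pos| |exact: Rmax_lub].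
by apply: Rle_trans (Rabs_pos _) (Rmax_l _ _).
Qed.

Lemma limC_close u v l (e : nat -> R) : (forall n, Cmod (Cminus (u n) (v n)) <= e n) -> is_lim_seq e 0 ->
  limC v l -> limC u l.
Proof.
move=> h he [v1 v2].
have z (p : C -> R) : (forall z w, p (Cminus z w) = p z - p w) -> (forall z, Rabs (p z) <= Cmod z) ->
   is_lim_seq (fun n => p (u n) - p (v n)) 0.
  move=> pm pl; apply/is_lim_seq_abs_0.
  apply: (is_lim_seq_le_le (fun=> 0) _ e) => //; last exact: is_lim_seq_const.
  move=> n; split; first exact: Rabs_pos.
  by rewrite -pm; apply: Rle_trans (pl _) (h n).
have z1 := z fst (fun=> fun=> erefl) Re_le_Cmod; have z2 := z snd (fun=> fun=> erefl) Im_le_Cmod.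
split.
  have := is_lim_seq_plus' _ _ _ _ z1 v1; rewrite Rplus_0_l; apply: is_lim_seq_ext => n; ring.
have := is_lim_seq_plus' _ _ _ _ z2 v2; rewrite Rplus_0_l; apply: is_lim_seq_ext => n; ring.
Qed.

(** Coefficients up to M agree with those of the limit series by [fprod_stable], and the bound B is
    common to all truncations; hence the tails beyond M tend to 0 and the products converge to the
    value of the series. *)
Lemma eta_list_conv ns e z : Cmod z < 1 -> all (fun n : nat => 0 < n)%N ns -> exists2 v,
  limC (fun M => Cprod (eta_list ns e M) (fun p => CpowZ (Cminus (RtoC 1) (Cpow_nat z p.1)) p.2)) v &
  ps_val (fun j => fprod (eta_list ns e j) j) z v.
Proof.
move=> hz hn; have z0 := Cmod_ge_0 z.
(* The arithmetic mean of 1, 1 and |z| dominates their geometric mean, so |z| <= x^3 while x < 1. *)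
pose x := (2 + Cmod z) / 3.
have hx : 0 <= x < 1 by rewrite /x; lra.
have hzx : Cmod z <= x * x * x.
  have e1 : x * x * x - Cmod z = (1 - x) * (1 - x) * (2 + x) by rewrite /x; field.
  by have : 0 <= (1 - x) * (1 - x) * (2 + x) by [apply: Rmult_le_pos; nra]; lra.
pose B := exp (foldr (fun n acc => IZR (Z.abs (e n)) + acc) 0 ns / (1 - x) / (1 - x)).
have bB M j : Rabs (IZR (fprod (eta_list ns e M) j)) * x ^ j <= B.
  apply: abs_bound_coef; first lra.
  apply: abs_bound_le (fprod_bound hx (eta_list_pos e M hn)).
  have i0 : 0 <= / (1 - x) by apply: Rlt_le; apply: Rinv_0_lt_compat; lra.
  have := Rmult_le_compat_r (/ (1 - x)) _ _ i0 (@wsum_eta_list ns e M x hx hn).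
  by rewrite /B /Rdiv; case=> [/exp_increasing|->]; lra.
pose E j := fprod (eta_list ns e j) j.
have bE j : Rabs (IZR (E j)) * x ^ j <= B by exact: bB.
have [v hv] : exists v, ps_val E z v.
  have h3 : is_series (fun j => B * x ^ j) (B * (/ (1 - x))).
    have := is_series_scal B _ _ (is_series_geom x _); apply.
    by rewrite Rabs_pos_eq; lra.
  apply: (@seriesC_dom _ (fun j => B * x ^ j)); last by exists (B * (/ (1 - x))).
  move=> j; rewrite Cmod_mult Cmod_R Cmod_pow_nat.
  apply: Rle_trans (_ : Rabs (IZR (E j)) * (x * x) ^ j <= _).
    apply: Rmult_le_compat_l; first exact: Rabs_pos.
    by apply: pow_incr; split=> //; nra.
  rewrite Rpow_mult_distr -Rmult_assoc; apply: Rmult_le_compat_r => //; apply: pow_le; lra.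
exists v => //.
apply: (@limC_close _ (fun M => Csum (iota 0 M.+1) (fun j => Cmult (RtoC (IZR (E j))) (Cpow_nat z j))) _
  (fun M => 2 * (B * x ^ M / (1 - x)))).
- move=> M; rewrite (_ : Csum _ _ = Csum (iota 0 M.+1)
    (fun j => Cmult (RtoC (IZR (fprod (eta_list ns e M) j))) (Cpow_nat z j))).
    by apply: ps_val_tail (bB M) _ => //; apply: fprod_val => //; exact: eta_list_pos.
  apply: eq_Csum_in => j; rewrite mem_iota => hj; rewrite /E fprod_stable //; lia.
- have := is_lim_seq_scal_l _ (2 * (B / (1 - x))) _ (is_lim_seq_geom x _).
  rewrite /= Rmult_0_r; move=> /(_ ltac:(rewrite Rabs_pos_eq; lra)); apply: is_lim_seq_ext => n.
  by field; lra.
apply/limCP; have := proj1 (seriesC_lim _ _) hv => h.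
by apply: filterlim_comp h => P [n hP]; exists n => m hm; apply: hP; lia.
Qed.

Lemma ee_pow t n : Cpow_nat (ee t) n = ee (Cmult (RtoC (INR n)) t).
Proof.
elim: n => [|n IH]; first by rewrite /= Cmult_0_l ee_0.
by rewrite [Cpow_nat _ _]/= IH -ee_add S_INR RtoC_plus; congr ee; ring.
Qed.

Lemma Cmod_ee t : Cmod (ee t) = exp (- (2 * PI * snd t)).
Proof.
rewrite /ee /cexp /Cmod /= !Rmult_0_l Rminus_0_l Rplus_0_l.
move: (exp_pos (- (2 * PI * t.2))) (2 * PI * t.1); move: (exp _) => E E0 x.
have := sin2_cos2 x; rewrite /Rsqr => sc.
rewrite (_ : _ + _ = E * E); first by rewrite sqrt_square //; lra.
transitivity (E * E * (sin x * sin x + cos x * cos x)); last by rewrite sc; ring.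
by ring.
Qed.

Lemma Cmod_ee_lt1 t : Hp t -> Cmod (ee t) < 1.
Proof.
rewrite /Hp Cmod_ee => ht; rewrite -exp_0; apply: exp_increasing.
by have := PI_RGT_0; nra.
Qed.

Lemma limC_inv u l : l <> RtoC 0 -> limC u l -> limC (fun n => Cinv (u n)) (Cinv l).
Proof.
move=> l0 [h1 h2].
have d0 : fst l ^ 2 + snd l ^ 2 <> 0.
  move=> h; apply: l0; apply: C_ext => /=; nra.
have d : is_lim_seq (fun n => fst (u n) ^ 2 + snd (u n) ^ 2) (fst l ^ 2 + snd l ^ 2).
  apply: is_lim_seq_plus'; rewrite /=.
    by apply: is_lim_seq_mult' => //; apply: is_lim_seq_mult' => //; exact: is_lim_seq_const.
  by apply: is_lim_seq_mult' => //; apply: is_lim_seq_mult' => //; exact: is_lim_seq_const.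
split; first exact: is_lim_seq_div'.
apply: is_lim_seq_div' => //.
exact: (proj1 (is_lim_seq_opp _ _) h2).
Qed.

Lemma limC_powZ u l e : l <> RtoC 0 -> limC u l -> limC (fun n => CpowZ (u n) e) (CpowZ l e).
Proof.
move=> l0 h; have pw n : limC (fun k => Cpow_nat (u k) n) (Cpow_nat l n).
  by elim: n => [|n IH] /=; [exact: limC_const|exact: limC_mul].
case: e => [|p|p] /=; [exact: limC_const|exact: pw|].
by apply: limC_inv => //; exact: Cpow_nat_neq0.
Qed.

Lemma limC_prod (T : Type) (s : seq T) (u : T -> nat -> C) (l : T -> C) (P : T -> Prop) : List.Forall P s ->
  (forall x, P x -> limC (u x) (l x)) -> limC (fun n => Cprod s (fun x => u x n)) (Cprod s l).
Proof.
by move=> hs h; elim: hs => [|x t px _ IH] /=; [exact: limC_const|apply: limC_mul => //; exact: h].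
Qed.

Lemma Cprod_cat (T : Type) (s t : seq T) F : Cprod (s ++ t) F = Cmult (Cprod s F) (Cprod t F).
Proof. by elim: s => /= [|x s ->]; rewrite ?Cmult_1_l // Cmult_assoc. Qed.

Lemma Cprod_map (S T : Type) (h : S -> T) s F : Cprod (map h s) F = Cprod s (fun x => F (h x)).
Proof. by elim: s => //= x s ->. Qed.

Lemma CprodM (T : Type) (s : seq T) F G : Cprod s (fun x => Cmult (F x) (G x)) = Cmult (Cprod s F) (Cprod s G).
Proof. by elim: s => /= [|x s ->]; [rewrite Cmult_1_l|ring]. Qed.

Lemma eq_Cprod (T : Type) (s : seq T) F G (P : T -> Prop) : List.Forall P s -> (forall x, P x -> F x = G x) ->
  Cprod s F = Cprod s G.
Proof. by move=> hs h; elim: hs => //= x l px _ ->; rewrite h. Qed.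

Lemma CpowZ_1l e : CpowZ (RtoC 1) e = RtoC 1.
Proof.
have p1 n : Cpow_nat (RtoC 1) n = RtoC 1 by elim: n => //= n ->; rewrite Cmult_1_l.
by case: e => [//|p|p]; rewrite /CpowZ p1 //; apply: C_ext => /=; field.
Qed.

Lemma CpowZ_prod (T : Type) (s : seq T) (F : T -> C) e (P : T -> Prop) : List.Forall P s ->
  (forall x, P x -> F x <> RtoC 0) -> Cprod s F <> RtoC 0 /\ CpowZ (Cprod s F) e = Cprod s (fun x => CpowZ (F x) e).
Proof.
move=> hs h; elim: hs => [|x l px _ [n0 IH]] /=; first by split; [exact: C1_nz|exact: CpowZ_1l].
by split; [apply: Cmult_neq_0 => //; exact: h|rewrite CpowZ_mul ?IH //; exact: h].
Qed.

Lemma Forall_mem (s : seq nat) : List.Forall (fun x : nat => x \in s) s.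
Proof.
have : {subset s <= s} by [].
elim: {1 4}s => [|x t IH] sub; constructor; first by apply: sub; rewrite mem_head.
by apply: IH => y yt; apply: sub; rewrite inE yt orbT.
Qed.

Lemma one_minus_ee_neq0 t m : Hp t -> (0 < m)%N -> Cminus (RtoC 1) (ee (Cmult (RtoC (INR m)) t)) <> RtoC 0.
Proof. by move=> ht m0; rewrite -ee_pow; exact: (proj1 (ps_val_geom m0 (Cmod_ee_lt1 ht))). Qed.

(** The product with exponents -1 converges too, and the two limits multiply to 1; therefore neither
    vanishes. *)
Lemma eta_partial_lim t : Hp t -> exists2 v, limC (eta_partial t) v & v <> RtoC 0.
Proof.
move=> ht; have hz := Cmod_ee_lt1 ht.
have [v hv _] := @eta_list_conv [:: 1%N] (fun=> 1%Z) _ hz isT.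
have [w hw _] := @eta_list_conv [:: 1%N] (fun=> (-1)%Z) _ hz isT.
have e1 M : Cprod (eta_list [:: 1%N] (fun=> 1%Z) M) (fun p => CpowZ (Cminus (RtoC 1) (Cpow_nat (ee t) p.1)) p.2)
  = eta_partial t M.
  rewrite /eta_list /= cats0 Cprod_map /eta_partial; elim: (iota 1 M) => //= m l ->.
  by rewrite mul1n ee_pow Cmult_1_r.
have e2 M : Cmult (eta_partial t M)
  (Cprod (eta_list [:: 1%N] (fun=> (-1)%Z) M) (fun p => CpowZ (Cminus (RtoC 1) (Cpow_nat (ee t) p.1)) p.2)) = RtoC 1.
  rewrite /eta_list /= cats0 Cprod_map /eta_partial -CprodM.
  rewrite (eq_Cprod (G := fun=> RtoC 1) (Forall_mem (iota 1 M))); last first.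
    move=> m; rewrite mem_iota => hm /=; rewrite mul1n ee_pow Cmult_1_r; apply: Cinv_r.
    by apply: one_minus_ee_neq0 => //; lia.
  by elim: (iota 1 M) => //= m l ->; rewrite Cmult_1_l.
have hv' := limC_ext e1 hv; exists v => // v0.
have := limC_mul hv' hw; rewrite v0 Cmult_0_l => /(limC_ext e2) h.
by apply: C1_nz; exact: limC_unique (limC_const _) h.
Qed.

Lemma eta_lim t : Hp t -> exists v, [/\ limC (eta_partial t) v, v <> RtoC 0 &
  eta t = Cmult (ee (Cmult (RtoC (/ 24)) t)) v].
Proof.
move=> ht; have [v hv v0] := eta_partial_lim ht; exists v; split=> //.
by rewrite /eta (lim_eq hv).
Qed.

Lemma Hp_scale n t : (0 < n)%N -> Hp t -> Hp (Cmult (RtoC (INR n)) t).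
Proof.
move=> n0; rewrite /Hp /= Rmult_0_l Rplus_0_r => ht; have := lt_0_INR n ltac:(lia); nra.
Qed.

Lemma ee_powZ z e : CpowZ (ee z) e = ee (Cmult (RtoC (IZR e)) z).
Proof.
case: e => [|p|p]; first by rewrite /= Cmult_0_l ee_0.
  by rewrite /CpowZ ee_pow INR_IZR_INZ positive_nat_Z.
rewrite /CpowZ ee_pow INR_IZR_INZ positive_nat_Z -Pos2Z.opp_pos opp_IZR RtoC_opp.
set w := Cmult _ z; have -> : Cmult (Copp (RtoC (IZR (Z.pos p)))) z = Copp w by rewrite /w; ring.
have := ee_add w (Copp w); rewrite Cplus_opp_r ee_0 => e.
have w0 := @ee_neq0 w.
by transitivity (Cmult (Cinv (ee w)) (Cmult (ee w) (ee (Copp w)))); [rewrite -e Cmult_1_r|field].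
Qed.

Section EtaQuotient.
Variables (r : nat -> Z) (N : nat).
Hypothesis N0 : (0 < N)%N.

Lemma eta_quotient_neq0 t : Hp t -> eta_quotient r N t <> RtoC 0.
Proof.
move=> ht; have fd := Forall_mem (divisors N).
apply: (proj1 (@CpowZ_prod _ _ _ 1 _ fd _)) => n; rewrite -dvdn_divisors // => nN.
apply: CpowZ_neq0; have n0 := dvdn_gt0 N0 nN.
have [v [_ v0 ->]] := eta_lim (Hp_scale n0 ht).
by apply: Cmult_neq_0 => //; exact: ee_neq0.
Qed.

(** The truncated products converge jointly to the formal series and, factor by factor, to the eta
    values without their leading powers of q; uniqueness of limits identifies the two. *)
Lemma eta_quotient_series t : Hp t -> is_seriesC (fun j => Cmult (RtoC (IZR (eta_coef r N j)))
  (ee (Cmult (RtoC (INR j + IZR (xN r N) / 24)) t))) (eta_quotient r N t).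
Proof.
move=> ht; have hz := Cmod_ee_lt1 ht; have fd := Forall_mem (divisors N).
have dp : all (fun n : nat => 0 < n)%N (divisors N).
  by apply/allP => n; rewrite -dvdn_divisors // => /(dvdn_gt0 N0).
have [v hv sv] := @eta_list_conv (divisors N) r _ hz dp.
have ex (n : nat) : exists w, n \in divisors N -> [/\ limC (eta_partial (Cmult (RtoC (INR n)) t)) w, w <> RtoC 0 &
  eta (Cmult (RtoC (INR n)) t) = Cmult (ee (Cmult (RtoC (/ 24)) (Cmult (RtoC (INR n)) t))) w].
  case nd : (n \in divisors N); last by exists (RtoC 0).
  have [w hw] := eta_lim (Hp_scale (allP dp _ nd) ht); by exists w.
have [w hw] := functional_choice _ ex.
have vE : v = Cprod (divisors N) (fun n => CpowZ (w n) (r n)).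
  apply: (limC_unique hv).
  have lp : limC (fun M => Cprod (divisors N) (fun n => CpowZ (eta_partial (Cmult (RtoC (INR n)) t) M) (r n)))
     (Cprod (divisors N) (fun n => CpowZ (w n) (r n))).
    apply: (limC_prod fd) => n nd; have [h1 h2 _] := hw n nd; exact: limC_powZ.
  apply: limC_ext lp.
  move=> M; rewrite /eta_list; elim: fd => //= n l nd _ ->; rewrite Cprod_cat Cprod_map; congr (Cmult _ _).
  rewrite /eta_partial (proj2 (@CpowZ_prod _ _ _ (r n) _ (Forall_mem (iota 1 M)) _)).
    apply: (eq_Cprod (Forall_mem (iota 1 M))) => m _ /=; rewrite ee_pow mult_INR RtoC_mult.
    by congr (CpowZ (Cminus _ (ee _)) _); ring.
  move=> m; rewrite mem_iota => hm; apply: one_minus_ee_neq0; last lia.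
  by apply: Hp_scale => //; exact: (allP dp).
have fE : eta_quotient r N t = Cmult (ee (Cmult (RtoC (IZR (xN r N) / 24)) t)) v.
  rewrite vE /eta_quotient /xN; elim: fd => [|n l nd _ IH].
    by rewrite /= /Rdiv Rmult_0_l Cmult_0_l ee_0 Cmult_1_l.
  rewrite /= IH; have [h1 h2 ->] := hw n nd.
  rewrite CpowZ_mul //; last exact: ee_neq0.
  rewrite ee_powZ plus_IZR mult_IZR -INR_IZR_INZ.
  set A := Cprod l _; set B := CpowZ (w n) _.
  rewrite (_ : RtoC ((INR n * IZR (r n) + IZR (Zsum l (fun n0 : nat => (Z.of_nat n0 * r n0)%Z))) / 24) =
    Cplus (RtoC (INR n * IZR (r n) / 24)) (RtoC (IZR (Zsum l (fun n0 : nat => (Z.of_nat n0 * r n0)%Z)) / 24))); last first.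
    by rewrite -RtoC_plus; congr RtoC; field.
  rewrite Cmult_plus_distr_r ee_add.
  rewrite (_ : Cmult (RtoC (IZR (r n))) _ = Cmult (RtoC (INR n * IZR (r n) / 24)) t); first by ring.
  rewrite !Cmult_assoc -!RtoC_mult; congr (Cmult (RtoC _) t); field.
rewrite fE; apply: seriesC_ext (@seriesC_scal _ _ _ sv) => j.
rewrite eta_coefE ee_pow RtoC_plus Cmult_plus_distr_r ee_add; ring.
Qed.

Lemma eta_coef0 : eta_coef r N 0 = 1%Z.
Proof. by rewrite /eta_coef; elim: (divisors N) => //= n l ->. Qed.
End EtaQuotient.

(** * Behaviour of the Hecke sum at the cusps *)

Definition rational (x : R) : Prop := exists p q : Z, (0 < q)%Z /\ x * IZR q = IZR p.

Lemma rational_IZR z : rational (IZR z).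
Proof. by exists z, 1%Z; split=> //; rewrite Rmult_1_r. Qed.

Lemma rational_add x y : rational x -> rational y -> rational (x + y).
Proof.
move=> [p [q [q0 e]]] [p' [q' [q0' e']]]; exists (p * q' + p' * q)%Z, (q * q')%Z; split; first nia.
by rewrite plus_IZR !mult_IZR -e -e'; ring.
Qed.

Lemma rational_mul x y : rational x -> rational y -> rational (x * y).
Proof.
move=> [p [q [q0 e]]] [p' [q' [q0' e']]]; exists (p * p')%Z, (q * q')%Z; split; first nia.
by rewrite !mult_IZR -e -e'; ring.
Qed.

Lemma rational_opp x : rational x -> rational (- x).
Proof. by move=> h; rewrite (_ : - x = IZR (-1) * x); [apply: rational_mul => //; exact: rational_IZR|ring]. Qed.

Lemma rational_inv z : rational (/ IZR z).
Proof.
case: (Z.eq_dec z 0) => [->|z0]; first by rewrite Rinv_0; exact: (rational_IZR 0).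
exists (Z.sgn z), (Z.abs z); split; first lia.
by apply: (Rmult_eq_reg_l (IZR z)); [rewrite -Rmult_assoc Rinv_r ?Rmult_1_l -?mult_IZR; [congr IZR; lia|]|];
  apply: not_0_IZR.
Qed.

Lemma rational_saw p k : rational (saw p k).
Proof.
rewrite /saw; case: ifP => _; first exact: (rational_IZR 0).
apply: rational_add; last exact: (rational_opp (rational_inv 2)).
by apply: rational_mul; [exact: rational_IZR|exact: rational_inv].
Qed.

Lemma rational_dedekind h k : rational (dedekind_sum h k).
Proof.
rewrite /dedekind_sum; elim: (iota _ _) => /= [|j l IH]; first exact: (rational_IZR 0).
by apply: rational_add => //; apply: rational_mul; exact: rational_saw.
Qed.

Lemma rational_Psi a b c d : rational (Psi a b c d).
Proof.
have q z w : rational (IZR z / IZR w) by apply: rational_mul; [exact: rational_IZR|exact: rational_inv].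
have d12 h k : rational (12 * dedekind_sum h k).
  by apply: rational_mul; [exact: (rational_IZR 12)|exact: rational_dedekind].
rewrite /Psi; case: ifP => _.
  by apply: rational_add; [exact: rational_add|exact: (rational_opp (rational_IZR 3))].
case: ifP => _; first by apply: rational_add; [exact: rational_add|exact: (rational_IZR 3)].
case: ifP => _; first exact: rational_IZR.
by apply: rational_add; [exact: (rational_opp (rational_IZR _))|exact: (rational_opp (rational_IZR 6))].
Qed.

Lemma eR_root_unity x : rational x -> exists2 n : nat, (0 < n)%N & Cpow_nat (eR x) n = RtoC 1.
Proof.
move=> [p [q [q0 e]]]; exists (Z.to_nat q); first lia.
rewrite /eR ee_pow INR_IZR_INZ Z2Nat.id -?RtoC_mult; last lia.
by rewrite Rmult_comm e ee_eR eR_int.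
Qed.

(** Dedekind sums are rational, so the value has finite order. This covers all integral matrices,
    including those outside the range of [eta_char_val], and finite order is enough for periodicity
    at the cusps. *)
Lemma eta_char_root_unity r N a b c d : exists2 n : nat, (0 < n)%N & Cpow_nat (eta_char r N a b c d true) n = RtoC 1.
Proof.
rewrite /eta_char /sgnC CpowZ_1l Cmult_1_l; apply: eR_root_unity.
apply: rational_mul; first exact: (rational_inv 24).
elim: (divisors N) => /= [|n l IH]; first exact: (rational_IZR 0).
by apply: rational_add => //; apply: rational_mul; [exact: rational_IZR|exact: rational_Psi].
Qed.

Lemma csqrt_upper w : Hp w -> 0 < fst (csqrt w) /\ 0 < snd (csqrt w).
Proof.
rewrite /Hp => hw; have := f_equal snd (csqrt_sqr w); have := csqrt_half w.
by case: (csqrt w) => p q /= [h|[h1 h2]] e; nra.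
Qed.

(** Roots of points in the upper half plane lie in the open first quadrant, so their quotient has
    positive real part and is principal. *)
Lemma csqrt_quotient w w' : Hp w -> Hp w' -> csqrt (Cdiv w' w) = Cdiv (csqrt w') (csqrt w).
Proof.
move=> hw hw'; have [p1 p2] := csqrt_upper hw; have [q1 q2] := csqrt_upper hw'.
have n0 : csqrt w <> RtoC 0 by move=> e; rewrite e /= in p1; lra.
apply: csqrt_unique.
  rewrite -{3}(csqrt_sqr w) -{3}(csqrt_sqr w'); by field.
left; move: (csqrt w) (csqrt w') p1 p2 q1 q2 {n0} => [p q] [p' q'] /= p1 p2 q1 q2.
have d : 0 < p ^ 2 + q ^ 2 by nra.
rewrite (_ : p * (p * 1) + q * (q * 1) = p ^ 2 + q ^ 2); last by ring.
rewrite (_ : _ - _ = (p' * p + q' * q) / (p ^ 2 + q ^ 2)); last by field; lra.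
by apply: Rdiv_lt_0_compat => //; nra.
Qed.

Lemma csqrt_opp_upper w : Hp w -> csqrt (Copp w) = Cmult (0, -1) (csqrt w).
Proof.
move=> hw; have [p1 p2] := csqrt_upper hw; apply: csqrt_unique.
  rewrite -{3}(csqrt_sqr w); apply: C_ext => /=; ring.
by left; move: (csqrt w) p1 p2 => [p q] /= p1 p2; lra.
Qed.

Lemma Hp_den g t : (0 < mc g)%Z -> Hp t -> Hp (den g t).
Proof. by rewrite /Hp /den /= => /IZR_lt c0 ht; nra. Qed.

(** Integral denominators guarantee a common one for finite sums. *)
Definition has_qexp (st : bool) (G : C -> C) : Prop := exists2 n : nat, (0 < n)%N & qexp st (INR n) G.

Lemma qexp_widen st (m n : nat) G : (0 < m)%N -> (0 < n)%N -> qexp st (INR m) G -> qexp st (INR (m * n)) G.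
Proof.
move=> m0 n0 [B hB hs].
have pm := lt_0_INR m ltac:(lia); have pn := lt_0_INR n ltac:(lia).
apply: (@reindex_qexp st B (INR m) 0) => //; first by rewrite mult_INR; nra.
  by move=> t ht; apply: seriesC_ext (hB t ht) => k; rewrite Rplus_0_r.
move=> k nz; exists (k * n)%N; first by rewrite !mult_INR; field; lra.
move=> s; case: k nz => [|k] nz; last by rewrite muln_gt0.
by case: nz; exact: hs.
Qed.

Lemma has_qexp_sum st (T : Type) (s : seq T) (F : T -> C -> C) (P : T -> Prop) : List.Forall P s ->
  (forall x, P x -> has_qexp st (F x)) -> has_qexp st (fun t => Csum s (fun x => F x t)).
Proof.
move=> hs hF; elim: hs => [|x l px _ [n n0 IH]] /=; first by exists 1%N => //; exact: qexp_0.
have [m m0 hm] := hF x px; exists (m * n)%N; first by rewrite muln_gt0 m0.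
by apply: qexp_plus; [exact: qexp_widen|rewrite mulnC; exact: qexp_widen].
Qed.

Lemma has_qexp_scal st G c : has_qexp st G -> has_qexp st (fun t => Cmult c (G t)).
Proof. by move=> [n n0 h]; exists n => //; exact: qexp_scal. Qed.

Lemma has_qexp_ext st G1 G2 : (forall t, Hp t -> G1 t = G2 t) -> has_qexp st G1 -> has_qexp st G2.
Proof. by move=> e [n n0 h]; exists n => //; exact: qexp_ext h. Qed.

Lemma has_qexp_affine st G (A B D : Z) : (0 < A)%Z -> (0 < D)%Z -> has_qexp st G ->
  has_qexp st (fun t => G (act (Mat A B 0 D) t)).
Proof.
move=> A0 D0 [n n0 [Bs hB hs]].
have pA := IZR_lt _ _ A0; have pD := IZR_lt _ _ D0; have pn := lt_0_INR n ltac:(lia).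
have dn : INR (n * Z.to_nat D) = INR n * IZR D by rewrite mult_INR (INR_IZR_INZ (Z.to_nat D)) Z2Nat.id //; lia.
exists (n * Z.to_nat D)%N; first by rewrite muln_gt0 n0; lia.
apply: (@reindex_qexp st (fun m => Cmult (Bs m) (eR (INR m / INR n * (IZR B / IZR D)))) (INR n * IZR D / IZR A) 0).
- by apply: Rdiv_lt_0_compat => //; nra.
- by rewrite dn; nra.
- move=> t ht; have ha : Hp (act (Mat A B 0 D) t) by apply: Hp_act => //; rewrite /mdet; cbn [ma mb mc md]; lia.
  apply: seriesC_ext (hB _ ha) => m; rewrite Rplus_0_r -Cmult_assoc; congr (Cmult _ _).
  rewrite /eR -ee_add; congr ee; rewrite actE /numer /den; cbn [ma mb mc md].
  have D0' : RtoC (IZR D) <> RtoC 0 by apply: RtoC_neq0; lra.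
  have A0' : RtoC (IZR A) <> RtoC 0 by apply: RtoC_neq0; lra.
  have n0' : RtoC (INR n) <> RtoC 0 by apply: RtoC_neq0; lra.
  rewrite /Rdiv Rinv_mult ?Rinv_inv !RtoC_mult !RtoC_inv ?RtoC_mult; try nra.
  rewrite (_ : Cplus (Cmult (RtoC 0) t) (RtoC (IZR D)) = RtoC (IZR D)); last ring.
  by field; repeat split.
move=> m nz; have nz' : Bs m <> RtoC 0 by move=> e; apply: nz; rewrite e Cmult_0_l.
exists (m * Z.to_nat A)%N.
  by rewrite dn mult_INR (INR_IZR_INZ (Z.to_nat A)) Z2Nat.id; [field; lra|lia].
move=> s; case: m nz' {nz} => [|m] nz'; first by case: nz'; exact: hs.
by rewrite muln_gt0; lia.
Qed.

(** Dividing the first column by its gcd gives a primitive vector, which Bezout completes to a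
    matrix G of determinant 1; G^-1 M is then upper triangular. *)
Lemma hermite_factor M : (0 < mdet M)%Z -> exists G A B D,
  [/\ mdet G = 1%Z, (0 < A)%Z, (0 < D)%Z & M = mmul G (Mat A B 0 D)].
Proof.
case: M => a b c d; rewrite /mdet; cbn [ma mb mc md] => dM.
have [x [y e]] := Z.gcd_bezout a c (Z.gcd a c) erefl.
have [[u hu] [v hv]] := (Z.gcd_divide_l a c, Z.gcd_divide_r a c).
have g0 : (0 < Z.gcd a c)%Z.
  have := Z.gcd_nonneg a c; case: (Z.eq_dec (Z.gcd a c) 0); last lia.
  by move=> /Z.gcd_eq_0 [a0 c0]; move: dM; rewrite a0 c0; lia.
move: (Z.gcd a c) hu hv e g0 => g hu hv e g0.
have e1 : (x * u + y * v = 1)%Z.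
  by apply: (Z.mul_reg_r _ _ g); [lia|rewrite Z.mul_1_l -[RHS]e hu hv; ring].
exists (Mat u (- y) v x), g, (x * b + y * d)%Z, (u * d - v * b)%Z.
rewrite /mdet; cbn [ma mb mc md]; split=> //.
- by rewrite -e1; ring.
- have e2 : ((u * d - v * b) * g = a * d - b * c)%Z by rewrite hu hv; ring.
  by rewrite -e2 in dM; move: (u * d - v * b)%Z dM g0 => w; nia.
rewrite /mmul; cbn [ma mb mc md]; congr Mat.
- by rewrite hu; ring.
- transitivity ((x * u + y * v) * b)%Z; [rewrite e1|]; ring.
- by rewrite hv; ring.
transitivity ((x * u + y * v) * d)%Z; [rewrite e1|]; ring.
Qed.

Lemma ex_derive_scalC (V : NormedModule C_AbsRing) (k : C) (f : C_AbsRing -> V) x :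
  ex_derive f x -> ex_derive (fun z => scal (k : C_AbsRing) (f z)) x.
Proof.
move=> [d hd]; exists (scal (k : C_AbsRing) d).
rewrite /is_derive.
apply: (filterdiff_ext_lin (fun z : AbsRing_NormedModule C_AbsRing => scal (k : C_AbsRing) (f z)) (fun y : AbsRing_NormedModule C_AbsRing => scal (k : C_AbsRing) (scal (y : C_AbsRing) d))).
  apply: (@filterdiff_scal_r_fct C_AbsRing (AbsRing_NormedModule C_AbsRing) V _ _ (k : C_AbsRing) f (fun y => scal (y : C_AbsRing) d)) => //; exact: Cmult_comm.
by move=> y; rewrite !scal_assoc; congr scal; exact: Cmult_comm.
Qed.

Section Cusps.
Variables (r : nat -> Z) (N : nat) (f : C -> C).
Hypotheses (N0 : (0 < N)%N) (ftr : transforms N (twok r N) (eta_char r N) f).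

Definition slash_by (G : mat) (t : C) : C := slash (twok r N) f (ma G) (mb G) (mc G) (md G) true t.

Lemma slash_byE G t : slash_by G t = Cmult (CpowZ (csqrt (den G t)) (- twok r N)) (f (act G t)).
Proof. by rewrite /slash_by /slash /sgnC Cmult_1_l. Qed.

(* [G T^N G^-1] lies in [Gamma0 N], and its multiplier is a root of unity. *)
Lemma slash_periodic_pos G : mdet G = 1%Z -> (0 < mc G)%Z -> exists2 n : nat, (0 < n)%N &
  forall t, Hp t -> slash_by G (Cplus t (RtoC (INR n))) = slash_by G t.
Proof.
move=> dG cG; pose TN := Mat 1 (Z.of_nat N) 0 1; pose de := mmul (mmul G TN) (minv G).
have dT : mdet TN = 1%Z by rewrite /mdet /TN; cbn [ma mb mc md]; ring.
have gd : gam0 N de.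
  split; first by rewrite /de !mdet_mul dG dT /mdet /minv; cbn [ma mb mc md]; move: dG; rewrite /mdet; lia.
  by exists (- mc G * mc G)%Z; rewrite /de /mmul /minv /TN; cbn [ma mb mc md]; ring.
have dd : mdet de = 1%Z by case: gd.
have deG : mmul de G = mmul G TN by rewrite mmulVr.
set chi := eta_char r N (ma de) (mb de) (mc de) (md de) true.
have step t : Hp t -> slash_by G (Cplus t (RtoC (INR N))) = Cmult chi (slash_by G t).
  move=> ht; have hs := Hp_shift (INR N) ht.
  have aT : act TN t = Cplus t (RtoC (INR N)).
    rewrite /act /mobius /TN; cbn [ma mb mc md]; rewrite -INR_IZR_INZ.
    by rewrite (_ : Cplus (Cmult (RtoC 0) t) (RtoC 1) = RtoC 1); [field|ring].
  have hG : Hp (act G t) by apply: Hp_act => //; rewrite dG.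
  (* Here c > 0 is used: both automorphy factors lie in the upper half plane, where principal roots
     may be divided. *)
  have w1 := Hp_den cG ht; have w2 := Hp_den cG hs.
  have dT1 : den TN t = RtoC 1 by rewrite /den /TN; cbn [ma mb mc md]; ring.
  have dE : Cmult (den de (act G t)) (den G t) = den G (Cplus t (RtoC (INR N))).
    rewrite -den_mul ?dG // deG den_mul ?dT // aT dT1 Cmult_1_r //.
  have n1 : den G t <> RtoC 0 by apply: den_neq0; rewrite ?dG.
  have n2 : den G (Cplus t (RtoC (INR N))) <> RtoC 0 by apply: den_neq0; rewrite ?dG.
  have dq : den de (act G t) = Cdiv (den G (Cplus t (RtoC (INR N)))) (den G t) by rewrite -dE; field.
  have c1 := csqrt_neq0 n1; have c2 := csqrt_neq0 n2.
  have i1 := Cinv_neq0 c1.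
  have aE : act G (Cplus t (RtoC (INR N))) = act de (act G t).
    by rewrite -aT -!act_mul ?dG ?dT ?dd // deG.
  rewrite !slash_byE aE (f_act ftr gd hG) -/chi dq csqrt_quotient // /Cdiv CpowZ_mul // !CpowZ_opp //.
  have z1 := @CpowZ_neq0 _ (twok r N) c1; have z2 := @CpowZ_neq0 _ (twok r N) c2.
  have -> : CpowZ (Cinv (csqrt (den G t))) (twok r N) = Cinv (CpowZ (csqrt (den G t)) (twok r N)).
    have := @CpowZ_mul (csqrt (den G t)) (Cinv (csqrt (den G t))) (twok r N) c1 i1.
    rewrite Cinv_r // CpowZ_1l => e; move: z1 e; move: (CpowZ _ _) (CpowZ _ _) => B A z1 e.
    by transitivity (Cmult (Cinv A) (Cmult A B)); [field|rewrite -e; field].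
  by field; split.
have [n n0 hn] := eta_char_root_unity r N (ma de) (mb de) (mc de) (md de).
exists (n * N)%N; first by rewrite muln_gt0 n0.
have it m t : Hp t -> slash_by G (Cplus t (RtoC (INR (m * N)))) = Cmult (Cpow_nat chi m) (slash_by G t).
  move=> ht; elim: m => [|m IH]; first by rewrite mul0n /= Cplus_0_r Cmult_1_l.
  rewrite mulSn plus_INR Rplus_comm RtoC_plus Cplus_assoc step ?IH /=; last exact: Hp_shift.
  by ring.
by move=> t ht; rewrite it // hn Cmult_1_l.
Qed.

Lemma slash_periodic G : mdet G = 1%Z -> exists2 n : nat, (0 < n)%N &
  forall t, Hp t -> slash_by G (Cplus t (RtoC (INR n))) = slash_by G t.
Proof.
move=> dG; case: (Z.lt_trichotomy (mc G) 0) => [cG|[cG|cG]]; last exact: slash_periodic_pos.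
- pose G' := Mat (- ma G) (- mb G) (- mc G) (- md G).
  have dG' : mdet G' = 1%Z by rewrite -dG /mdet /G'; cbn [ma mb mc md]; ring.
  have cG' : (0 < mc G')%Z by rewrite /G'; cbn [mc]; lia.
  have [n n0 hn] := slash_periodic_pos dG' cG'; exists n => //.
  have e t : Hp t -> slash_by G t = Cmult (CpowZ (0, -1) (- twok r N)) (slash_by G' t).
    move=> ht; rewrite !slash_byE.
    have d' : den G t = Copp (den G' t).
      by rewrite /den /G'; cbn [ma mb mc md]; rewrite !opp_IZR !RtoC_opp; ring.
    have n' : den G' t <> RtoC 0 by apply: den_neq0; rewrite ?dG'.
    rewrite d' csqrt_opp_upper; last exact: Hp_den.
    rewrite CpowZ_mul; [|by move=> h; have /= := f_equal snd h; lra|exact: csqrt_neq0].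
    rewrite -Cmult_assoc; congr (Cmult _ (Cmult _ (f _))); rewrite !actE d'.
    have -> : numer G t = Copp (numer G' t).
      by rewrite /numer /G'; cbn [ma mb mc md]; rewrite !opp_IZR !RtoC_opp; ring.
    by field.
  by move=> t ht; rewrite !e ?hn //; exact: Hp_shift.
(* For c = 0 the automorphy factor is constant and f is shifted by 24, under which it is
   invariant. *)
exists 24%N => // t ht; rewrite !slash_byE.
have ad : (ma G * md G = 1)%Z by move: dG; rewrite /mdet cG; lia.
have dne : RtoC (IZR (md G)) <> RtoC 0 by apply: RtoC_neq0; apply: not_0_IZR => e; rewrite e in ad; lia.
have aE : RtoC (IZR (ma G)) = RtoC (IZR (md G)).
  congr (RtoC (IZR _)); case: (Z.mul_eq_1 _ _ ad) => h; rewrite h in ad *; lia.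
have -> : den G (Cplus t (RtoC (INR 24))) = den G t by rewrite /den cG !Cmult_0_l.
congr (Cmult _ _).
have -> : act G (Cplus t (RtoC (INR 24))) = Cplus (act G t) (RtoC (IZR 24)).
  rewrite !actE /numer /den cG !Cmult_0_l !Cplus_0_l aE (_ : INR 24 = IZR 24); last by rewrite INR_IZR_INZ.
  by field.
rewrite (f_shift N0 ftr); last by apply: Hp_act; rewrite ?dG.
rewrite (_ : em _ = RtoC 1) ?Cmult_1_l // -em_0; apply: em_mod; exists (xN r N); ring.
Qed.

Variables (st : bool) (l : nat).
Hypotheses (fcusp : forall a b c d : Z, (a * d - b * c = 1)%Z -> cusp_expansion st (slash (twok r N) f a b c d true))
  (fhol : holomorphic_H f) (l0 : (0 < l)%N).

Lemma slash_qexp G : mdet G = 1%Z -> has_qexp st (slash_by G).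
Proof.
move=> dG; have [n n0 per] := slash_periodic dG; exists n => //.
by apply: cusp_periodic per; [apply: lt_0_INR; lia|exact: fcusp].
Qed.

(** Factor (a b; 0 d) g = G (A B; 0 D) with G of determinant 1. Up to the constant (D/d)^(-k), the
    term is f slashed by G at (A t + B) / D; the automorphy factors differ by the positive number
    D/d, so their roots are compatible. *)
Lemma hecke_term_qexp g a b d : mdet g = 1%Z -> (0 < a)%N -> (0 < d)%N ->
  has_qexp st (fun t => Cmult (CpowZ (csqrt (den g t)) (- twok r N)) (f (tri_act a b d (act g t)))).
Proof.
move=> dg a0 d0; pose al := Mat (Z.of_nat a) (Z.of_nat b) 0 (Z.of_nat d).
have dal : (0 < mdet al)%Z by rewrite /mdet /al; cbn [ma mb mc md]; lia.
have triE t : tri_act a b d t = act al t.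
  rewrite /act /mobius /tri_act /al; cbn [ma mb mc md]; rewrite -!INR_IZR_INZ.
  by rewrite (_ : Cplus (Cmult (RtoC 0) t) (RtoC (INR d)) = RtoC (INR d)); last ring.
have [G [A [B [D [dG A0 D0 E]]]]] := @hermite_factor (mmul al g) ltac:(by rewrite mdet_mul dg Z.mul_1_r).
pose T := Mat A B 0 D.
have dT : (0 < mdet T)%Z by rewrite /mdet /T; cbn [ma mb mc md]; lia.
have pD := IZR_lt _ _ D0; have pd := lt_0_INR d ltac:(lia).
apply: has_qexp_ext (has_qexp_scal (CpowZ (RtoC (sqrt (IZR D / INR d))) (- twok r N)) (has_qexp_affine B A0 D0 (slash_qexp dG))) => t ht.
have hT : Hp (act T t) by exact: Hp_act.
have hg : Hp (act g t) by apply: Hp_act; rewrite ?dg.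
rewrite triE -act_mul ?dg // E act_mul ?dG // slash_byE -/T Cmult_assoc; congr (Cmult _ _).
have dE : Cmult (RtoC (INR d)) (den g t) = Cmult (den G (act T t)) (RtoC (IZR D)).
  have dg0 : mdet g <> 0%Z by rewrite dg.
  have dT0 : mdet T <> 0%Z by move: dT; lia.
  have := den_mul al dg0 ht; rewrite E (den_mul G dT0 ht).
  rewrite {2}/den {2}/den /T /al; cbn [mc md]; rewrite -INR_IZR_INZ => e.
  transitivity (Cmult (Cplus (Cmult (RtoC 0) (act g t)) (RtoC (INR d))) (den g t)); first by ring.
  by rewrite -e; ring.
have d0' : RtoC (INR d) <> RtoC 0 by exact: INR_neq0.
have q0 : 0 < IZR D / INR d by exact: Rdiv_lt_0_compat.
have -> : den g t = Cmult (RtoC (IZR D / INR d)) (den G (act T t)).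
  rewrite RtoC_div; last lra.
  transitivity (Cmult (Cinv (RtoC (INR d))) (Cmult (RtoC (INR d)) (den g t))); first by field.
  by rewrite dE; field.
rewrite csqrt_scale // CpowZ_mul //.
  by apply: RtoC_neq0; have := sqrt_lt_R0 _ q0; lra.
by apply: csqrt_neq0; apply: den_neq0; rewrite ?dG.
Qed.

Lemma hecke_index_pos : List.Forall (fun p : nat * nat => (0 < p.1)%N /\ (0 < l %/ p.1)%N) (hecke_index N l).
Proof.
have : {subset hecke_index N l <= hecke_index N l} by [].
elim: {1 3}(hecke_index N l) => [|[a b] s IH] sub; constructor.
  have /(hecke_indexP _ _ _ l0) [al _ bl _] := sub _ (mem_head _ _).
  by split; [exact: dvdn_gt0 al|exact: leq_ltn_trans bl].
by apply: IH => x xs; apply: sub; rewrite inE xs orbT.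
Qed.

Lemma hecke_sum_cusp a b c d : (a * d - b * c = 1)%Z ->
  cusp_expansion st (slash (twok r N) (hecke_sum r N f l) a b c d true).
Proof.
move=> det; pose g := Mat a b c d.
have [n n0 h] : has_qexp st (slash (twok r N) (hecke_sum r N f l) a b c d true).
  apply: (has_qexp_ext _ (@has_qexp_sum st _ _ (fun (p : nat * nat) t => Cmult (hecke_weight r N l p.1 p.2)
    (Cmult (CpowZ (csqrt (den g t)) (- twok r N)) (f (tri_act p.1 p.2 (l %/ p.1) (act g t))))) _ hecke_index_pos _)).
    move=> t ht; rewrite /slash /sgnC Cmult_1_l -/(den g t) -/(act g t) /hecke_sum -CsumMl.
    by apply: (eq_Csum hecke_index_pos) => p _; ring.
  by move=> p [p1 p2]; apply: has_qexp_scal; exact: hecke_term_qexp.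
by apply: qexp_cusp h; apply: lt_0_INR; lia.
Qed.

Lemma hecke_sum_hol : holomorphic_H (hecke_sum r N f l).
Proof.
move=> t ht; rewrite /hecke_sum; elim: hecke_index_pos => [|p s [p1 p2] _ IH].
  exact: (@ex_derive_const C_AbsRing C_NormedModule).
apply: (@ex_derive_plus C_AbsRing C_NormedModule) IH.
apply: (@ex_derive_scalC C_NormedModule).
apply: (@ex_derive_comp C_AbsRing C_NormedModule f); first by apply: fhol; exact: Hp_tri.
apply: (@ex_derive_ext C_AbsRing _ (fun z => plus (scal (Cdiv (RtoC (INR p.1)) (RtoC (INR (l %/ p.1)))) z) (Cdiv (RtoC (INR p.2)) (RtoC (INR (l %/ p.1)))))).
  by move=> z; rewrite /tri_act /plus /scal /= /mult /=; field; exact: INR_neq0.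
apply: (@ex_derive_plus C_AbsRing (AbsRing_NormedModule C_AbsRing)).
  apply: (@ex_derive_scalC (AbsRing_NormedModule C_AbsRing)).
  exact: ex_derive_id.
exact: ex_derive_const.
Qed.
End Cusps.

(** * The eigenvalue of the Hecke sum *)

Lemma dim_eq1_multiple (P : (C -> C) -> Prop) f g : dim_eq1 P -> P f -> P g ->
  (forall t, Hp t -> f t <> RtoC 0) -> exists c, forall t, Hp t -> g t = Cmult c (f t).
Proof.
move=> [g0 [_ [_ h]]] Pf Pg nz; have [c hc] := h f Pf; have [c' hc'] := h g Pg.
have hi : Hp (0, 1) by rewrite /Hp /=; lra.
have c0 : c <> RtoC 0 by move=> e; apply: (nz _ hi); rewrite hc // e Cmult_0_l.
by exists (Cdiv c' c) => t ht; rewrite hc // hc' //; field.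
Qed.

Lemma seriesC_sum (T : Type) (s : seq T) (a : T -> nat -> C) (v : T -> C) (P : T -> Prop) : List.Forall P s ->
  (forall p, P p -> is_seriesC (a p) (v p)) -> is_seriesC (fun n => Csum s (fun p => a p n)) (Csum s v).
Proof.
move=> hs h; elim: hs => [|x l px _ IH] /=; last by apply: seriesC_plus => //; exact: h.
by have := @seriesC_finite (fun=> RtoC 0) 0 (fun n _ => erefl); rewrite /= Cplus_0_l.
Qed.

Section Eigenvalue.
Variables (r : nat -> Z) (N l : nat).
Hypotheses (N0 : (0 < N)%N) (l0 : (0 < l)%N).
Let x := xN r N.
Let f := eta_quotient r N.
Let K : nat := (Z.abs_nat x * (l * l))%N.

(* The factor [q^(K/(24 l))] makes all exponents nonnegative integers over [24 l]. *)
Lemma shifted_series (a b d s : nat) : (0 < a)%N -> (0 < d)%N -> (a * l = d * s)%N -> (s <= l * l)%N ->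
  exists B : nat -> C,
  [/\ forall t, Hp t -> is_seriesC (fun n => Cmult (B n) (ee (Cmult (RtoC (INR n / (24 * INR l))) t)))
        (Cmult (ee (Cmult (RtoC (INR K / (24 * INR l))) t)) (f (tri_act a b d t))),
      forall j n : nat, ((24 * Z.of_nat j + x) * Z.of_nat s + Z.of_nat K = Z.of_nat n)%Z ->
        B n = Cmult (RtoC (IZR (eta_coef r N j))) (eR ((INR j + IZR x / 24) * (INR b / INR d))) &
      forall n : nat, (forall j : nat, ((24 * Z.of_nat j + x) * Z.of_nat s + Z.of_nat K <> Z.of_nat n)%Z) -> B n = RtoC 0].
Proof.
move=> a0 d0 als sl.
have pa := lt_0_INR a ltac:(lia); have pd := lt_0_INR d ltac:(lia); have pl := lt_0_INR l ltac:(lia).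
have als' : INR a * INR l = INR d * INR s by have := f_equal INR als; rewrite !mult_INR.
pose h := INR d / INR a; pose kap := IZR x / 24 + INR K / (24 * INR l) * h.
have h0 : 0 < h by exact: Rdiv_lt_0_compat.
have idx (j : nat) : (INR j + kap) / h * (24 * INR l) = IZR ((24 * Z.of_nat j + x) * Z.of_nat s + Z.of_nat K).
  rewrite plus_IZR mult_IZR plus_IZR mult_IZR -!INR_IZR_INZ.
  have -> : (INR j + kap) / h * (24 * INR l) = (24 * INR j + IZR x) * (INR a * INR l) / INR d + INR K.
    by rewrite /kap /h; field; lra.
  by rewrite als'; field; lra.
(* As s <= l^2, the number K = |x_N| l^2 outweighs a negative x_N s. *)
have pos (j : nat) : (0 <= (24 * Z.of_nat j + x) * Z.of_nat s + Z.of_nat K)%Z.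
  have KE : Z.of_nat K = (Z.abs x * Z.of_nat (l * l))%Z by rewrite /K Nat2Z.inj_mul Zabs2Nat.id_abs.
  rewrite KE; have : (Z.of_nat s <= Z.of_nat (l * l))%Z by lia.
  have := Nat2Z.is_nonneg s; have := Nat2Z.is_nonneg j.
  move: (Z.of_nat s) (Z.of_nat (l * l)) (Z.of_nat j) (x) => S L J y; clear.
  by case: (Z.abs_spec y) => [[y0 ->]|[y0 ->]]; nia.
have ser t : Hp t -> is_seriesC (fun j => Cmult (Cmult (RtoC (IZR (eta_coef r N j))) (eR ((INR j + IZR x / 24) * (INR b / INR d))))
    (ee (Cmult (RtoC ((INR j + kap) / h)) t)))
  (Cmult (ee (Cmult (RtoC (INR K / (24 * INR l))) t)) (f (tri_act a b d t))).
  move=> ht; have hs := @eta_quotient_series r N N0 _ (Hp_tri b a0 d0 ht).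
  apply: seriesC_ext (@seriesC_scal _ _ _ hs) => j.
  set e := RtoC (IZR _); rewrite [X in Cmult _ X = _]/= (Cmult_comm e) Cmult_assoc -ee_add Cmult_comm -Cmult_assoc; congr (Cmult e _).
  rewrite /eR -ee_add; congr ee; rewrite /tri_act.
  have -> : (INR j + kap) / h = (INR j + IZR x / 24) * (INR a / INR d) + INR K / (24 * INR l).
    by rewrite /kap /h; field; lra.
  have dn : RtoC (INR d) <> RtoC 0 by exact: INR_neq0.
  rewrite -/x; move: (INR j + IZR x / 24) (INR K / (24 * INR l)) => u v.
  rewrite RtoC_plus /Rdiv !RtoC_mult !RtoC_inv; try lra.
  by field.
have pH : 0 < 24 * INR l by lra.
have [m _|B [hB h1 h2]] := reindex_series h0 pH ser.
  by exists (Z.to_nat ((24 * Z.of_nat m + x) * Z.of_nat s + Z.of_nat K)); rewrite idx INR_IZR_INZ Z2Nat.id.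
exists B; split=> //.
  by move=> j n e; apply: h1; rewrite idx INR_IZR_INZ e.
move=> n hn; apply: h2 => j e; case: (hn j); apply: eq_IZR; rewrite -idx e INR_IZR_INZ //.
Qed.

(** The hypothesis is j + x_N/24 = l x_N / (24 a^2) with denominators cleared; together with
    [cf_at_none] it describes the coefficient occurring in [c_l]. *)
Lemma cf_at_solution (a j : nat) : (0 < a)%N -> ((24 * Z.of_nat j + x) * Z.of_nat (a * a) = x * Z.of_nat l)%Z ->
  cf_at r N (Z.of_nat l * x) (24 * Z.of_nat a ^ 2) = eta_coef r N j.
Proof.
move=> a0 e; rewrite /cf_at -/x.
have -> : (24 * (Z.of_nat l * x) - x * (24 * Z.of_nat a ^ 2) = Z.of_nat j * (24 * (24 * Z.of_nat a ^ 2)))%Z.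
  by move: e; rewrite Nat2Z.inj_mul => e; rewrite (Z.mul_comm (Z.of_nat l)) -e; ring.
have d0 : (0 < 24 * (24 * Z.of_nat a ^ 2))%Z by have : (0 < Z.of_nat a ^ 2)%Z by [apply: Z.pow_pos_nonneg; lia]; lia.
move: (24 * (24 * _))%Z d0 => D d0.
rewrite Z.mod_mul ?Z.div_mul ?Nat2Z.id; [|lia|lia].
by rewrite (_ : (0 <=? _)%Z = true) //; apply/Z.leb_le; nia.
Qed.

Lemma cf_at_none (a : nat) : (0 < a)%N ->
  (forall j : nat, ((24 * Z.of_nat j + x) * Z.of_nat (a * a) <> x * Z.of_nat l)%Z) ->
  cf_at r N (Z.of_nat l * x) (24 * Z.of_nat a ^ 2) = 0%Z.
Proof.
move=> a0 hn; rewrite /cf_at -/x; set t := (_ - _)%Z; set D := (24 * (24 * _))%Z.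
have d0 : (0 < D)%Z by rewrite /D; have : (0 < Z.of_nat a ^ 2)%Z by [apply: Z.pow_pos_nonneg; lia]; lia.
case: ifP => // /andP [/Z.eqb_eq m0 /Z.leb_le t0].
have e := Z.div_mod t D ltac:(lia); rewrite m0 Z.add_0_r in e.
have q0 : (0 <= t / D)%Z by apply: Z.div_pos.
case: (hn (Z.to_nat (t / D))); rewrite Z2Nat.id // Nat2Z.inj_mul.
have tE : t = (24 * (x * Z.of_nat l) - 24 * (x * Z.of_nat a ^ 2))%Z by rewrite /t; ring.
have DE : D = (24 * (24 * (Z.of_nat a ^ 2)))%Z by [].
move: (t / D)%Z e => q e; rewrite DE tE in e.
have -> : (Z.of_nat a * Z.of_nat a = Z.of_nat a ^ 2)%Z by ring.
by move: (Z.of_nat a ^ 2)%Z (x * Z.of_nat l)%Z e => A2 Y; clear; nia.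
Qed.

(** In f((a t + b) / d) the exponent j + x_N/24 becomes (j + x_N/24) a/d. It equals x_N/24 exactly
    when j + x_N/24 = l x_N / (24 a^2), which is the index of c_f in [c_l]. *)
Lemma c_l_eigenvalue c : (forall t, Hp t -> hecke_sum r N f l t = Cmult c (f t)) ->
  c_l r N l = Cmult (RtoC (Rpower (INR l) (- IZR (twok r N) / 4))) c.
Proof.
move=> hc; rewrite /c_l; congr (Cmult _ _).
have pl := lt_0_INR l ltac:(lia).
have ex (p : nat * nat) : exists B : nat -> C, p \in hecke_index N l ->
  [/\ forall t, Hp t -> is_seriesC (fun n => Cmult (B n) (ee (Cmult (RtoC (INR n / (24 * INR l))) t)))
        (Cmult (ee (Cmult (RtoC (INR K / (24 * INR l))) t)) (f (tri_act p.1 p.2 (l %/ p.1) t))),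
      forall j n : nat, ((24 * Z.of_nat j + x) * Z.of_nat (p.1 * p.1) + Z.of_nat K = Z.of_nat n)%Z ->
        B n = Cmult (RtoC (IZR (eta_coef r N j))) (eR ((INR j + IZR x / 24) * (INR p.2 / INR (l %/ p.1)))) &
      forall n : nat, (forall j : nat, ((24 * Z.of_nat j + x) * Z.of_nat (p.1 * p.1) + Z.of_nat K <> Z.of_nat n)%Z) -> B n = RtoC 0].
  case: p => a b; case inI : ((a, b) \in hecke_index N l); last by exists (fun=> RtoC 0).
  have /(hecke_indexP _ _ _ l0) [al _ bl _] := inI.
  have a0 := dvdn_gt0 l0 al; have d0 : (0 < l %/ a)%N by exact: leq_ltn_trans bl.
  have [|//|B hB] := @shifted_series a b (l %/ a) (a * a) a0 d0.
  - by rewrite mulnCA [(l %/ a * a)%N]divnK.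
  - by have := dvdn_leq l0 al; nia.
  by exists B.
have [B hB] := functional_choice _ ex.
(* The function f itself is the case a = d = 1, b = 0, s = l. *)
have [|//|Bf [sf cf _]] := @shifted_series 1 0 1 l isT isT.
- by [].
- by nia.
have fa : List.Forall (fun p => p \in hecke_index N l) (hecke_index N l).
  have : {subset hecke_index N l <= hecke_index N l} by [].
  elim: {1 4}(hecke_index N l) => [|p s IH] sub; constructor; first by apply: sub; rewrite mem_head.
  by apply: IH => y ys; apply: sub; rewrite inE ys orbT.
pose D n := Cminus (Csum (hecke_index N l) (fun p => Cmult (hecke_weight r N l p.1 p.2) (B p n))) (Cmult c (Bf n)).
have pH : 0 < 24 * INR l by lra.
have m1 : RtoC (-1) = Copp (RtoC 1) by rewrite -RtoC_opp.
have D0 k : D k = RtoC 0.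
  apply: (qseries_zero pH) => t ht.
  have h1 := seriesC_sum fa (fun p pI => @seriesC_scal _ _ (hecke_weight r N l p.1 p.2) (let: And3 h _ _ := hB p pI in h t ht)).
  have h2 := @seriesC_scal _ _ (Copp c) (sf t ht).
  have h3 := seriesC_plus h1 h2.
  have e0 : Cplus (Csum (hecke_index N l) (fun p => Cmult (hecke_weight r N l p.1 p.2)
     (Cmult (ee (Cmult (RtoC (INR K / (24 * INR l))) t)) (f (tri_act p.1 p.2 (l %/ p.1) t)))))
     (Cmult (Copp c) (Cmult (ee (Cmult (RtoC (INR K / (24 * INR l))) t)) (f (tri_act 1 0 1 t)))) = RtoC 0.
    have -> : tri_act 1 0 1 t = t by rewrite /tri_act /=; field; exact: C1_nz.
    rewrite (eq_Csum (G := fun p => Cmult (ee (Cmult (RtoC (INR K / (24 * INR l))) t))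
      (Cmult (hecke_weight r N l p.1 p.2) (f (tri_act p.1 p.2 (l %/ p.1) t)))) fa); last by move=> p _; ring.
    by rewrite CsumMl -/(hecke_sum r N f l t) hc //; ring.
  rewrite e0 in h3; apply: seriesC_ext h3 => n; rewrite /D /=.
  set E := ee _.
  rewrite (eq_Csum (G := fun p => Cmult E (Cmult (hecke_weight r N l p.1 p.2) (B p n))) fa); last by move=> p _; ring.
  by rewrite CsumMl; ring.
have KE : (0 <= x * Z.of_nat l + Z.of_nat K)%Z.
  rewrite /K Nat2Z.inj_mul Zabs2Nat.id_abs Nat2Z.inj_mul.
  have : (1 <= Z.of_nat l)%Z by lia.
  move: (Z.of_nat l) (x) => L y; clear => L1; have : (L <= L * L)%Z by nia.
  by case: (Z.abs_spec y) => [[y0 ->]|[y0 ->]]; nia.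
(* The place of q^(x_N/24) in units of 1/(24 l), after multiplication by q^(K/(24 l)); there f has
   coefficient 1. *)
pose n0 := Z.to_nat (x * Z.of_nat l + Z.of_nat K).
have n0E : Z.of_nat n0 = (x * Z.of_nat l + Z.of_nat K)%Z by rewrite Z2Nat.id.
have bf : Bf n0 = RtoC 1.
  rewrite (cf 0%N n0); last by rewrite n0E; ring.
  by rewrite eta_coef0 Cmult_1_l /= /Rdiv Rmult_0_l Rmult_0_r eR_0.
have := D0 n0; rewrite /D bf Cmult_1_r => e.
have -> : c = Csum (hecke_index N l) (fun p => Cmult (hecke_weight r N l p.1 p.2) (B p n0)).
  move: (Csum _ _) e => S e; have -> : S = Cplus (Cminus S c) c by ring.
  by rewrite e Cplus_0_l.
pose F (a b : nat) := let d := (l %/ a)%N in Cmult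
  (RtoC (IZR (kron (Z.of_nat a) (Z.of_nat (varpi r N))) * Rpower (INR a) (IZR (twok r N) / 2) *
    IZR (cf_at r N (Z.of_nat l * x) (24 * Z.of_nat a ^ 2))))%R
  (Cmult (Cmult (CpowZ (RtoC (IZR (kron (- Z.of_nat N * Z.of_nat b) (Z.of_nat (gcdn a d))))) (twok r N))
     (eR (INR b * INR d * (IZR x / (24 * INR l) - IZR x / 24))%R)) (psi r N l a b)).
transitivity (Csum (hecke_index N l) (fun p => F p.1 p.2)).
  rewrite Csum_hecke_index; apply: eq_Csum_in => a _; rewrite -CsumMl //.
apply: eq_Csum_pair => a b inI; have [_ b1 b2] := hB _ inI.
cbn [fst snd] in b1, b2.
have /(hecke_indexP _ _ _ l0) [al _ bl _] := inI.
have a0 := dvdn_gt0 l0 al; have d0 : (0 < l %/ a)%N by exact: leq_ltn_trans bl.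
rewrite /F [fst _]/= [snd _]/= /hecke_weight /hecke_unit.
case: (classic (exists j : nat, ((24 * Z.of_nat j + x) * Z.of_nat (a * a) = x * Z.of_nat l)%Z)) => [[j hj]|nj].
  rewrite (cf_at_solution a0 hj) (b1 j n0); last by rewrite n0E hj.
  (* With j + x_N/24 = x_N d / (24 a), the factor e((j + x_N/24) b/d) is e(b d x_N / (24 l)). *)
  have -> : eR (INR b * INR (l %/ a) * (IZR x / (24 * INR l) - IZR x / 24)) =
    Cmult (em (- Z.of_nat b * Z.of_nat (l %/ a) * x)) (eR ((INR j + IZR x / 24) * (INR b / INR (l %/ a)))).
    rewrite /em -eR_add; congr eR; rewrite !mult_IZR opp_IZR -!INR_IZR_INZ.
    have lE : INR l = INR a * INR (l %/ a) by rewrite -{1}(divnK al) mult_INR Rmult_comm.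
    have pa := lt_0_INR a ltac:(lia); have pd := lt_0_INR (l %/ a) ltac:(lia).
    have := f_equal IZR hj; rewrite !mult_IZR plus_IZR mult_IZR -!INR_IZR_INZ mult_INR lE => hj'.
    have e2 : (INR j + IZR x / 24) = IZR x * INR (l %/ a) / (24 * INR a).
      apply: (Rmult_eq_reg_r (24 * (INR a * INR a))); last by nra.
      by transitivity ((24 * INR j + IZR x) * (INR a * INR a)); [field|rewrite hj'; field; lra].
    by rewrite e2; field; lra.
  rewrite !RtoC_mult /x; ring.
rewrite (cf_at_none a0) => [|j hj]; last by apply: nj; exists j.
rewrite (b2 n0); last by move=> j hj; apply: nj; exists j; move: hj; rewrite n0E => /Z.add_cancel_r.
by rewrite Rmult_0_r Cmult_0_l Cmult_0_r.
Qed.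
End Eigenvalue.

Lemma hecke_eigenform r N l : (0 < N)%N -> weakly_admissible r N -> in_Lf r N l ->
  exists c, forall t, Hp t -> hecke_sum r N (eta_quotient r N) l t = Cmult c (eta_quotient r N t).
Proof.
move=> N0 [Mf cases] lL; have fnz := @eta_quotient_neq0 r N N0.
have l0 : (0 < l)%N by case: lL.
have [_ [ftr _]] := Mf; have htr := hecke_sum_transforms N0 fnz ftr lL.
case: cases => [dM|[_ [dS Sf]]].
  apply: (dim_eq1_multiple dM Mf _ fnz); case: Mf => hol [_ cu]; split; first exact: hecke_sum_hol.
  by split=> // a b c d det; exact: (hecke_sum_cusp N0 ftr cu).
apply: (dim_eq1_multiple dS Sf _ fnz); case: Sf => hol [_ cu]; split; first exact: hecke_sum_hol.
by split=> // a b c d det; exact: (hecke_sum_cusp N0 ftr cu).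
Qed.

Unset Implicit Arguments.
Local Close Scope R_scope.
Local Close Scope Z_scope.

Theorem theorem9p24 (N : nat) (r : nat -> Z) :
  is_level r N ->
  weakly_admissible r N ->
  forall l1 l2 : nat, in_Lf r N l1 -> in_Lf r N l2 -> coprime l1 l2 ->
    c_l r N (l1 * l2) = Cmult (c_l r N l1) (c_l r N l2).
Proof.
move=> [N0 _] wa l1 l2 L1 L2 cop.
have fnz := @eta_quotient_neq0 r N N0; have [[_ [ftr _]] _] := wa.
have [p1 p2] := (l_gt0 L1, l_gt0 L2).
have [c1 h1] := hecke_eigenform N0 wa L1; have [c2 h2] := hecke_eigenform N0 wa L2.
have h12 := hecke_sum_mul N0 fnz ftr L1 L2 cop h1 h2.
have p12 : (0 < l1 * l2)%N by rewrite muln_gt0 p1.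
rewrite (c_l_eigenvalue N0 p1 h1) (c_l_eigenvalue N0 p2 h2) (c_l_eigenvalue N0 p12 h12).
rewrite mult_INR -Rpower_mult_distr; [|by apply: lt_0_INR; lia|by apply: lt_0_INR; lia].
by rewrite RtoC_mult; ring.
Qed.
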